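(* Let $\Omega\subseteq\mathbb{R}^n$ be open. Given $p(\cdot)\in\mathcal{P}(\Omega)$, suppose that $1\le p_-\le p_+<\infty$ and $p(\cdot)\in LH(\Omega)$. Given an $n\times n$ matrix weight $W\in\mathcal{A}_{p(\cdot)}$, with $v=|W|_{\mathrm{op}}$, $$\mathscr{W}^{1,p(\cdot)}(v,W,\Omega)=\mathscr{H}^{1,p(\cdot)}(v,W,\Omega).$$
   Context: Exponents: $\mathcal{P}(\Omega)$ is the set of Lebesgue measurable $p(\cdot):\Omega\to[1,\infty]$; $p_-=\operatorname{ess\,inf}_\Omega p$, $p_+=\operatorname{ess\,sup}_\Omega p$; $1/p(x)+1/p'(x)=1$ with $1/\infty=0$. Modular: $\rho_{p(\cdot)}(f)=\int_{\Omega\setminus\Omega_\infty}|f(x)|^{p(x)}dx+\|f\|_{L^\infty(\Omega_\infty)}$, $\Omega_\infty=\{x\in\Omega:p(x)=\infty\}$. Norm: $\|f\|_{L^{p(\cdot)}(\Omega)}=\inf\{\lambda>0:\rho_{p(\cdot)}(f/\lambda)\le1\}$. Log-Hölder continuity: $p(\cdot)\in LH(\Omega)$ if there are constants $C_0,C_\infty,p_\infty$ with $|p(x)-p(y)|\le \frac{C_0}{-\log|x-y|}$ for all $x,y\in\Omega$ with $|x-y|<1/2$, and $|p(x)-p_\infty|\le\frac{C_\infty}{\log(e+|x|)}$ for all $x\in\Omega$. Weights: $\mathcal{S}_n$ is the set of self-adjoint positive semidefinite $n\times n$ matrices; $|\cdot|_{\mathrm{op}}$ is the operator norm. An $n\times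 n$ matrix weight on $\Omega$ is a measurable $W:\Omega\to\mathcal{S}_n$ with $|W|_{\mathrm{op}}\in L^1_{\mathrm{loc}}(\Omega)$. $\|\mathbf{f}\|_{L^{p(\cdot)}(W,\Omega)}:=\||W\mathbf{f}|\|_{L^{p(\cdot)}(\Omega)}$ for measurable $\mathbf{f}:\Omega\to\mathbb{R}^n$, and $\|f\|_{L^{p(\cdot)}(v,\Omega)}:=\|fv\|_{L^{p(\cdot)}(\Omega)}$ for measurable scalar $f$. Matrix $\mathcal{A}_{p(\cdot)}$: $W\in\mathcal{A}_{p(\cdot)}(\Omega)$ means $$[W]_{\mathcal{A}_{p(\cdot)}}=\sup_{Q}|Q|^{-1}\Big\|\,\big\||W(x)W^{-1}(\cdot)|_{\mathrm{op}}\chi_Q(\cdot)\big\|_{L^{p'(\cdot)}(\Omega)}\chi_Q(x)\Big\|_{L^{p(\cdot)}_x(\Omega)}<\infty,$$ the supremum over cubes $Q\subset\Omega$, where $L^{p(\cdot)}_x$ indicates the norm in the variable $x$. Standing convention on the domain: a matrix weight $W$ on a domain $\Omega$ is implicitly assumed to satisfy this condition on some larger domain $\Omega'$ (not specified further), and reference to the domain is suppressed, so that one writes $W\in\mathcal{A}_{p(\cdot)}$ instead of $W\in\mathcal{A}_{p(\cdot)}(\Omega)$. Sobolev spaces: $\mathscr{W}^{1,1}_{\mathrm{loc}}(\Omega)$ is the set of $f\in L^1_{\mathrm{loc}}(\Omega)$ whose weak first derivatives all exist in $L^1_{\mathrm{loc}}(\Omega)$. $\mathscr{W}^{1,p(\cdot)}(v,W,\Omega)$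 is the set of $f\in\mathscr{W}^{1,1}_{\mathrm{loc}}(\Omega)$ with $$\|f\|_{\mathscr{W}^{1,p(\cdot)}(v,W,\Omega)}=\|f\|_{L^{p(\cdot)}(v,\Omega)}+\|\nabla f\|_{L^{p(\cdot)}(W,\Omega)}<\infty.$$ $\mathscr{H}^{1,p(\cdot)}(v,W,\Omega)$ is the closure of $C^\infty(\Omega)\cap\mathscr{W}^{1,p(\cdot)}(v,W,\Omega)$ in $\mathscr{W}^{1,p(\cdot)}(v,W,\Omega)$. *)

(* Defs.v *)
From HB Require Import structures.
From mathcomp Require Import all_boot all_order all_algebra.
From mathcomp Require Import all_classical all_reals all_analysis.
From mathcomp Require Import measurable_realfun ess_sup_inf hoelder.

Set Implicit Arguments.
Unset Strict Implicit.
Unset Printing Implicit Defensive.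

Import Order.TTheory GRing.Theory Num.Theory.
Import numFieldNormedType.Exports.

Local Open Scope classical_set_scope.
Local Open Scope ring_scope.

(* R^N, with N >= 1 written n.+1, is the type 'rV[R]_n.+1 of row vectors for
   points; the values of vector fields are column vectors, so that the action
   of a matrix is W x *m F x. All functions are total; only their values on
   the open set Omega matter. *)

Section euclidean.
Context {R : realType}.

(* The library norm on matrices is the sup norm. *)
Definition enorm m n (M : 'M[R]_(m, n)) : R :=
  Num.sqrt (\sum_i \sum_j M i j ^+ 2).

Definition opnorm n (M : 'M[R]_n) : R :=
  sup [set enorm (M *m u) | u in [set u : 'cV[R]_n | enorm u <= 1]].

Definition psdmx n (M : 'M[R]_n) : Prop :=
  M^T = M /\ forall u : 'cV[R]_n, 0 <= (u^T *m M *m u) 0 0.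

Definition cube n (a : 'rV[R]_n) (l : R) : set 'rV[R]_n :=
  [set x | forall i, a 0 i <= x 0 i <= a 0 i + l].

End euclidean.

(* Lebesgue outer measure by countable covers with half-open boxes, and its
   Caratheodory sigma-algebra, i.e. the Lebesgue measurable sets. *)
Section lebesgue.
Context {R : realType} {n : nat}.
Local Open Scope ereal_scope.

Definition box (c : 'rV[R]_n.+1 * 'rV[R]_n.+1) : set 'rV[R]_n.+1 :=
  [set x | forall i, (c.1 0 i < x 0 i <= c.2 0 i)%R].

Definition box_volume (c : 'rV[R]_n.+1 * 'rV[R]_n.+1) : R :=
  (\prod_i Num.max 0 (c.2 0 i - c.1 0 i))%R.

Definition box_cover (A : set 'rV[R]_n.+1) :
    set (nat -> 'rV[R]_n.+1 * 'rV[R]_n.+1) :=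
  [set c | A `<=` \bigcup_k box (c k)].

Definition lebesgue_outer (A : set 'rV[R]_n.+1) : \bar R :=
  ereal_inf [set \sum_(k <oo) (box_volume (c k))%:E | c in box_cover A].

Lemma box_volume_ge0 c : 0 <= (box_volume c)%:E.
Proof.
by rewrite lee_fin; apply: prodr_ge0 => i _; rewrite le_max lexx.
Qed.

Lemma lebesgue_outer_ge0 A : 0 <= lebesgue_outer A.
Proof.
apply: le_ereal_inf_tmp => _ [c _ <-].
by apply: nneseries_ge0 => k _ _; exact: box_volume_ge0.
Qed.

Lemma lebesgue_outer0 : lebesgue_outer set0 = 0.
Proof.
apply/eqP; rewrite eq_le lebesgue_outer_ge0 andbT.
apply: ereal_inf_lbound; exists (fun=> (0, 0)%R); first by move=> x [].
rewrite eseries0// => k _ _; congr EFin; rewrite /box_volume.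
by rewrite (bigD1 ord0)//= subrr maxxx mul0r.
Qed.

Lemma le_lebesgue_outer :
  {homo lebesgue_outer : A B / A `<=` B >-> A <= B}.
Proof.
move=> A B AB; apply: ereal_inf_le_tmp => _ [c Bc <-].
by exists c => //; exact: subset_trans AB Bc.
Qed.

Lemma lebesgue_outer_sigma_subadditive : sigma_subadditive lebesgue_outer.
Proof.
move=> A; have [[i ioo]|] := pselect (exists i, lebesgue_outer (A i) = +oo).
  rewrite (eseries_pinfty _ _ ioo) ?leey// => k _.
  by rewrite -ltNye (lt_le_trans _ (lebesgue_outer_ge0 _)).
rewrite -forallNE => Aoo.
apply/lee_addgt0Pr => e e0.
rewrite (le_trans _ (epsilon_trick _ _ (ltW e0)))//; last first.
  by move=> k; exact: lebesgue_outer_ge0.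
have cover k : {c | box_cover (A k) c &
    \sum_(j <oo) (box_volume (c j))%:E
      <= lebesgue_outer (A k) + (e / (2 ^ k.+1)%:R)%:E}.
  apply: cid2.
  have e2 : (0 < e / (2 ^ k.+1)%:R)%R by rewrite divr_gt0// ltr0n expn_gt0.
  have fink : lebesgue_outer (A k) \is a fin_num.
    by rewrite ge0_fin_numE ?lebesgue_outer_ge0// ltey; exact/eqP/Aoo.
  have [_ [c Ac <-] /ltW cA] := lb_ereal_inf_adherent e2 fink.
  by exists c.
pose G k := s2val (cover k).
pose vG (p : nat * nat) : \bar R := (box_volume (G p.1 p.2))%:E.
have vG0 p : 0 <= vG p by exact: box_volume_ge0.
apply: (@le_trans _ _ (\esum_(p in [set: nat * nat]) vG p)).
  have /card_esym/ppcard_eqP[f] := card_nat2.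
  apply: ereal_inf_lbound; exists (fun k => G (f k).1 (f k).2).
    move=> x [i _ /(s2valP (cover i))[j _ Gx]].
    by exists (f^-1%FUN (i, j)) => //=; rewrite invK ?inE.
  rewrite -(esum_pred_image vG f xpredT) ?[fun=> _]set_true//.
  by rewrite image_eq.
pose J : nat -> set (nat * nat) := fun i => [set (i, j) | j in setT].
rewrite (_ : setT = \bigcup_k J k); last first.
  by rewrite predeqE => -[a b]; split => // _; exists a => //; exists b.
rewrite esum_bigcupT//=; last first.
  apply/trivIsetP => i j _ _ ij.
  rewrite predeqE => -[a b]; split => //= -[] [_] _ [<-{a} _].
  by move=> [b' _] [] /esym/eqP; rewrite (negbTE ij).
rewrite -(image_id [set: nat]) -fun_true esum_pred_image//; last first.
  by move=> k _; apply: esum_ge0 => q _; exact: vG0.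
apply: lee_nneseries => k _.
  by move=> _; apply: esum_ge0 => q _; exact: vG0.
apply: le_trans (s2valP' (cover k)).
rewrite -[leRHS](esum_pred_image vG (pair k) predT)//=; last first.
  by move=> ? ? _ _; exact: (@can_inj _ _ _ snd).
rewrite le_eqVlt; apply/orP; left; apply/eqP; congr esum.
by rewrite predeqE => -[a b]; split; move=> [i _ <-]; exists i.
Qed.

HB.instance Definition _ := isOuterMeasure.Build R 'rV[R]_n.+1 lebesgue_outer
  lebesgue_outer0 lebesgue_outer_ge0 le_lebesgue_outer
  lebesgue_outer_sigma_subadditive.

HB.instance Definition _ :=
  @isMeasurable.Build (caratheodory_display lebesgue_outer) 'rV[R]_n.+1
    lebesgue_outer.-caratheodory
    (caratheodory_measurable_set0 lebesgue_outer)
    (@caratheodory_measurable_setC _ _ lebesgue_outer)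
    (@caratheodory_measurable_bigcup _ _ lebesgue_outer).

Definition leb : set 'rV[R]_n.+1 -> \bar R := lebesgue_outer.

Lemma leb_sigma_additive : semi_sigma_additive leb.
Proof.
exact: (@caratheodory_measure_sigma_additive R 'rV[R]_n.+1 lebesgue_outer).
Qed.

HB.instance Definition _ := isMeasure.Build _ 'rV[R]_n.+1 R leb
  lebesgue_outer0 lebesgue_outer_ge0 leb_sigma_additive.

End lebesgue.

Section variable_exponent.
Context {R : realType} {n : nat}.
Implicit Types (Omega : set 'rV[R]_n.+1) (p : 'rV[R]_n.+1 -> \bar R).
Local Open Scope ereal_scope.

Definition exponent Omega p : Prop :=
  measurable_fun Omega p /\ forall x, Omega x -> 1 <= p x.

(* The values -oo and +oo outside Omega make the essential bounds range over
   Omega only. *)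
Definition exponent_sup Omega p : \bar R :=
  ess_sup leb (patch (cst -oo) Omega p).

Definition exponent_inf Omega p : \bar R :=
  ess_inf leb (patch (cst +oo) Omega p).

Definition infinite_part Omega p : set 'rV[R]_n.+1 :=
  [set x | Omega x /\ p x = +oo].

Definition modular Omega p (f : 'rV[R]_n.+1 -> \bar R) : \bar R :=
  \int[leb]_(x in Omega `\` infinite_part Omega p)
     poweR `|f x| (fine (p x))
  + ess_sup leb ((abse \o f) \_ (infinite_part Omega p)).

Definition vnorm Omega p (f : 'rV[R]_n.+1 -> \bar R) : \bar R :=
  ereal_inf [set l%:E | l in
    [set l : R | (0 < l)%R /\ modular Omega p (fun x => f x * l^-1%:E) <= 1]].

(* When x = y both sides of the first bound are 0, since ln 0 = 0. *)
Definition log_holder Omega p : Prop :=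
  exists C0 Coo poo : R,
    (forall x y, Omega x -> Omega y -> (enorm (x - y) < 2^-1)%R ->
       `|p x - p y| <= (C0 / - ln (enorm (x - y)))%:E) /\
    (forall x, Omega x ->
       `|p x - poo%:E| <= (Coo / ln (expR 1 + enorm x))%:E).

End variable_exponent.

Section weights.
Context {R : realType} {n : nat}.
Implicit Types (Omega : set 'rV[R]_n.+1) (p : 'rV[R]_n.+1 -> \bar R).
Implicit Types (W : 'rV[R]_n.+1 -> 'M[R]_n.+1).
Local Open Scope ereal_scope.

Definition L1loc Omega (f : 'rV[R]_n.+1 -> R) : Prop :=
  measurable_fun Omega f /\
  forall K, K `<=` Omega -> compact K -> \int[leb]_(x in K) `|f x|%:E < +oo.

Definition matrix_weight Omega W : Prop :=
  [/\ forall i j, measurable_fun Omega (fun x => W x i j),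
      forall x, Omega x -> psdmx (W x) &
      L1loc Omega (fun x => opnorm (W x))].

Definition Ap_const Omega p W : \bar R :=
  ereal_sup [set E | exists a l, let Q := cube a l in
    [/\ (0 < l)%R, Q `<=` Omega &
      E = (leb Q)^-1 *
        vnorm Omega p (fun x =>
          vnorm Omega (hoelder_conjugate \o p) (fun y =>
            (opnorm (W x *m invmx (W y)) * \1_Q y)%:E) * (\1_Q x)%:E)]].

(* The occurrence of W^-1 presupposes that W is invertible almost everywhere;
   this has to be required, as invmx M = M when M is singular. *)
Definition matrix_Ap Omega p W : Prop :=
  {ae leb, forall x, Omega x -> W x \in unitmx} /\ Ap_const Omega p W < +oo.

(* W is an A_p weight on some larger domain; the values of the total functions
   p and W outside Omega serve as the extension. *)
Definition matrix_Ap_larger Omega p W : Prop :=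
  exists Omega', [/\ open Omega', Omega `<=` Omega', exponent Omega' p,
    matrix_weight Omega' W & matrix_Ap Omega' p W].

End weights.

Section sobolev.
Context {R : realType} {n : nat}.
Implicit Types (Omega : set 'rV[R]_n.+1) (p : 'rV[R]_n.+1 -> \bar R).
Implicit Types (v f g phi : 'rV[R]_n.+1 -> R).
Implicit Types (W : 'rV[R]_n.+1 -> 'M[R]_n.+1) (F : 'rV[R]_n.+1 -> 'cV[R]_n.+1).

Definition partial (i : 'I_n.+1) f : 'rV[R]_n.+1 -> R :=
  fun x => 'D_(delta_mx 0 i) f x.

Definition partials (s : seq 'I_n.+1) f := foldr partial f s.

Definition smooth Omega f : Prop :=
  forall (s : seq 'I_n.+1) x, Omega x ->
    {for x, continuous (partials s f)} /\
    forall i, derivable (partials s f) x (delta_mx 0 i).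

Definition test_function Omega phi : Prop :=
  smooth setT phi /\
  exists K, [/\ compact K, K `<=` Omega & forall x, ~ K x -> phi x = 0].

Definition is_weak_partial Omega (i : 'I_n.+1) f g : Prop :=
  forall phi, test_function Omega phi ->
    (\int[leb]_(x in Omega) (f x * partial i phi x)%:E
     = - \int[leb]_(x in Omega) (g x * phi x)%:E)%E.

Definition is_weak_gradient Omega f F : Prop :=
  forall i, L1loc Omega (fun x => F x i 0) /\
    is_weak_partial Omega i f (fun x => F x i 0).

Definition W11loc Omega f : Prop :=
  L1loc Omega f /\ exists F, is_weak_gradient Omega f F.

(* A representative: the weak gradient is unique up to a null subset of
   Omega. *)
Definition weak_gradient Omega f : 'rV[R]_n.+1 -> 'cV[R]_n.+1 :=
  xget (fun=> 0) (is_weak_gradient Omega f).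

Definition sobolev_norm Omega p v W f : \bar R :=
  (vnorm Omega p (fun x => (f x * v x)%:E) +
   vnorm Omega p (fun x => (enorm (W x *m weak_gradient Omega f x))%:E))%E.

(* Sets of representatives: both sets are closed under modification of f on a
   null subset of Omega. *)
Definition sobolevW Omega p v W : set ('rV[R]_n.+1 -> R) :=
  [set f | W11loc Omega f /\ (sobolev_norm Omega p v W f < +oo)%E].

Definition sobolevH Omega p v W : set ('rV[R]_n.+1 -> R) :=
  [set f | sobolevW Omega p v W f /\
    forall e : R, 0 < e -> exists g,
      [/\ smooth Omega g, sobolevW Omega p v W g &
          (sobolev_norm Omega p v W (fun x => (f x - g x)%R) < e%:E)%E]].

End sobolev.

(* Main.v *)
Require Import Defs.
From HB Require Import structures.
From mathcomp Require Import all_boot all_order all_algebra.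
From mathcomp Require Import all_classical all_reals all_analysis.
From mathcomp Require Import measurable_realfun ess_sup_inf hoelder.
From mathcomp Require Import ring lra zify.
Import Order.TTheory GRing.Theory Num.Theory.
Import numFieldNormedType.Exports.
Set Implicit Arguments.
Unset Strict Implicit.
Unset Printing Implicit Defensive.
Local Open Scope classical_set_scope.
Local Open Scope ring_scope.

(* Meyers-Serrin with matrix weights. All estimates are made on the modular
   [pmod D q W F], the integral over [D] of |W F|^q.

   Mollification uses a smooth kernel carried by the cube [x - d, x]. Testing
   the A_p condition on the cubes of a grid of side [d] bounds the averaging
   operators on each cube; the log-Holder condition makes d^(q x - q y) bounded
   on such a cube, which turns the norm bound into one on modulars, and summing
   over the grid gives a bound for mollification that is uniform in [d], up to
   an error vanishing with [d]. Convergence then has to be checked on a dense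
   class only: indicators of finite unions and intersections of half-open boxes
   are constant just to the lower left of every point, so that mollifying them
   is eventually exact at each point; outer regularity of Lebesgue measure and
   dominated convergence carry this over to measurable sets and to all fields.

   For p = 1 and W = 1 this convergence yields the uniqueness of weak gradients.
   A smooth partition of unity psi_k subordinate to cubes in Omega and the sum
   of the mollifications of the psi_k f, at scales decreasing fast enough, give
   the approximation of f. *)

(** * Lebesgue measure *)

(** The obstacle is that A_p is an inequality between norms, and norms with a variable exponent do
    not add up over disjoint cubes, while modulars do. Rescaling a field on a cube multiplies |W
    F|^q by powers with different exponents q x; the log-Holder condition makes these powers
    comparable only if the modular on the cube is not below a fixed power of d. Each cube is
    therefore granted the extra amount d^(n+2); in dimension n+1 there are about d^-(n+1) cubes, so
    the total error is of order d. A_p is used on single cubes only, through Young's inequality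
    after inserting W^-1(y) W(y). Testing it with a small positive function times a basis vector e_j
    shows that |W e_j|^q is integrable on cubes, which supplies the envelopes for dominated
    convergence. The choice v = |W|_op enters twice: it bounds the term f grad psi_k of the product
    rule by a multiple of |f| v, and it is at most a constant times the sum of the |W e_j|, so that
    approximating f with weight v reduces to the vector fields psi_k f e_j. *)

Lemma exists_inv_lt {R : realType} (e : R) : 0 < e ->
  exists k, forall m, (k <= m)%N -> m.+1%:R^-1 < e.
Proof.
move=> e0; exists (Num.truncn e^-1) => m km.
rewrite invf_plt ?posrE//; apply: lt_le_trans (truncnS_gt _) _.
by rewrite ler_nat ltnS.
Qed.

Section lebesgue_measure.
Context {R : realType} {n : nat}.
Notation V := 'rV[R]_n.+1.
Notation mu := (@leb R n).

Definition row_upd (x : V) (i : 'I_n.+1) (c : R) : V :=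
  \row_j if j == i then c else x 0 j.

Lemma row_updE (x : V) i c j : row_upd x i c 0 j = if j == i then c else x 0 j.
Proof. by rewrite mxE. Qed.

Lemma box_volumeD1 (a : V * V) i : box_volume a =
  Num.max 0 (a.2 0 i - a.1 0 i) *
  \prod_(j | j != i) Num.max 0 (a.2 0 j - a.1 0 j).
Proof. by rewrite /box_volume (bigD1 i). Qed.

(** A hyperplane cuts every half-open box into two half-open boxes whose volumes add up exactly,
    empty pieces included; a cover of [X] thus splits into covers of its two parts at no cost. *)
Lemma measurable_coord_le (i : 'I_n.+1) (c : R) :
  measurable [set x : V | x 0 i <= c].
Proof.
apply: le_caratheodory_measurable => X.
apply: le_ereal_inf_tmp => _ [a Xa <-].
pose a1 k := ((a k).1, row_upd (a k).2 i (Num.min ((a k).2 0 i) c)).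
pose a2 k := (row_upd (a k).1 i (Num.max ((a k).1 0 i) c), (a k).2).
have volE k : box_volume (a k) = box_volume (a1 k) + box_volume (a2 k).
  rewrite !(box_volumeD1 _ i) /= !row_updE eqxx.
  under [X in _ = _ * X + _]eq_bigr => j /negbTE ji do rewrite row_updE ji.
  under [X in _ = _ + _ * X]eq_bigr => j /negbTE ji do rewrite row_updE ji.
  rewrite -mulrDl; congr (_ * _).
  set u := (a k).1 0 i; set w := (a k).2 0 i.
  rewrite /Num.min /Num.max; case: (ltP w c) => h1; case: (ltP u c) => h2;
  repeat case: ltP => ?; lra.
under eq_eseriesr do rewrite volE EFinD.
rewrite nneseriesD//; [|by move=> k _ _; exact: box_volume_ge0..].
apply: leeD; apply: ereal_inf_lbound.
- exists a1 => // x [/Xa[k _ xk] /= xc]; exists k => // j /=.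
  rewrite row_updE; case: eqP => [->|_]; last exact: xk.
  by rewrite le_min xc; have /andP[-> ->] := xk i.
- exists a2 => // x [/Xa[k _ xk] /= /negP xc]; exists k => // j /=.
  rewrite row_updE; case: eqP => [->|_]; last exact: xk.
  by have /andP[h ->] := xk i; rewrite gt_max h ltNge; case: leP xc.
Qed.

Lemma measurable_coord_gt (i : 'I_n.+1) (c : R) :
  measurable [set x : V | c < x 0 i].
Proof.
rewrite (_ : [set _ | _] = ~` [set x : V | x 0 i <= c]).
  by apply: measurableC; exact: measurable_coord_le.
by apply/seteqP; split=> x /=; rewrite ltNge => /negP.
Qed.

Lemma measurable_coord i : measurable_fun setT (fun x : V => x 0 i).
Proof.
apply: (measurability (@RGenOInfty.G R)) => [|_ [_ [c ->] <-]].
  exact: RGenOInfty.measurableE.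
rewrite setTI; rewrite (_ : _ @^-1` _ = [set x : V | c < x 0 i]).
  exact: measurable_coord_gt.
by apply/seteqP; split=> x /=; rewrite in_itv/= andbT.
Qed.

Lemma measurable_forall_ord (P : 'I_n.+1 -> V -> Prop) :
  (forall i, measurable [set x | P i x]) ->
  measurable [set x | forall i, P i x].
Proof.
move=> mP; rewrite (_ : [set _ | _] = \bigcap_(i in setT) [set x | P i x]).
  by apply: fin_bigcap_measurable => // i _; exact: mP.
by apply/seteqP; split=> [x h i _|x h i]; exact: h.
Qed.

Lemma measurable_box (a : V * V) : measurable (box a).
Proof.
apply: measurable_forall_ord => i.
rewrite (_ : [set _ | _] = [set x : V | a.1 0 i < x 0 i] `&`
                           [set x : V | x 0 i <= a.2 0 i]).
  by apply: measurableI; [exact: measurable_coord_gt|exact: measurable_coord_le].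
by apply/seteqP; split=> x /=; [move=> /andP[]|move=> [-> ->]].
Qed.

Lemma measurable_cube (a : V) l : measurable (cube a l).
Proof.
apply: measurable_forall_ord => i.
rewrite (_ : [set _ | _] = ~` [set x : V | a 0 i + l < x 0 i] `&`
                           (fun x : V => x 0 i) @^-1` `[a 0 i, +oo[%classic).
  apply: measurableI; first by apply: measurableC; exact: measurable_coord_gt.
  by rewrite -[X in measurable X]setTI; exact: measurable_coord.
apply/seteqP; split=> x /=; rewrite in_itv/= andbT.
  by move=> /andP[-> h]; split=> //; apply/negP; rewrite -leNgt.
by move=> [/negP]; rewrite -leNgt => -> ->.
Qed.

Lemma nbhs_coordP (x : V) (A : set V) : nbhs x A <->
  exists2 e : R, 0 < e & forall y : V, (forall i, `|x 0 i - y 0 i| < e) -> A y.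
Proof.
split.
  move=> /nbhs_ballP[e e0 xA]; exists e => // y xy; apply: xA.
  by split=> // i j; rewrite (ord1 i); exact: xy.
move=> [e e0 xA]; apply/nbhs_ballP; exists e => // y [_ xy]; apply: xA => i.
exact: xy.
Qed.

Lemma rat_between (u w : R) : u < w -> exists q : rat, u < ratr q < w.
Proof.
by move=> uw; have [q] := rat_in_itvoo uw; rewrite in_itv /= => ?; exists q.
Qed.

Definition rat_box (q : 'rV[rat]_n.+1 * 'rV[rat]_n.+1) : V * V :=
  (map_mx ratr q.1, map_mx ratr q.2).

Lemma open_rat_box (A : set V) x : open A -> A x ->
  exists q, box (rat_box q) x /\ box (rat_box q) `<=` A.
Proof.
move=> oA Ax; have /nbhs_coordP[e e0 xA] : nbhs x A by exact: open_nbhs_nbhs.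
have /choice[f hf] (i : 'I_n.+1) : exists q, x 0 i - e < ratr q < x 0 i.
  by apply: rat_between; lra.
have /choice[g hg] (i : 'I_n.+1) : exists q, x 0 i < ratr q < x 0 i + e.
  by apply: rat_between; lra.
exists (\row_i f i, \row_i g i); split=> [i|y yb] /=.
  rewrite !mxE; have /andP[_ ->] := hf i; have /andP[h _] := hg i.
  by rewrite ltW.
apply: xA => i; have := yb i; rewrite /= !mxE => /andP[h1 h2].
have := hf i; have := hg i => /andP[? ?] /andP[? ?].
by rewrite ltr_norml; apply/andP; split; lra.
Qed.

(** Boxes with rational corners are countably many, so this union reduces the measurability of open
    sets to that of boxes. *)
Lemma open_bigcup_rat_box (A : set V) : open A ->
  A = \bigcup_(q in [set q | box (rat_box q) `<=` A]) box (rat_box q).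
Proof.
move=> oA; apply/seteqP; split => [x Ax|x [q /= qA /qA]//].
by have [q [xq qA]] := open_rat_box oA Ax; exists q.
Qed.

Lemma measurable_open (A : set V) : open A -> measurable A.
Proof.
move=> oA; rewrite (open_bigcup_rat_box oA).
rewrite bigcup_mkcond; apply: countable_bigcupT_measurable => // q.
by case: ifP => // _; exact: measurable_box.
Qed.

Lemma measurable_closed (A : set V) : closed A -> measurable A.
Proof.
by move=> cA; rewrite -(setCK A); apply/measurableC/measurable_open/closed_openC.
Qed.

Lemma measurable_compact (A : set V) : compact A -> measurable A.
Proof.
by move=> cA; apply: measurable_closed; apply: compact_closed => //; exact: norm_hausdorff.
Qed.

Lemma measurable_continuous (D : set V) (f : V -> R) : open D ->
  (forall x, D x -> {for x, continuous f}) -> measurable_fun D f.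
Proof.
move=> oD cf; apply: (measurability (@RGenOInfty.G R)) => [|_ [_ [c ->] <-]].
  exact: RGenOInfty.measurableE.
apply: measurable_open; rewrite openE => x [Dx fx]; rewrite /interior.
apply: filterI; first exact: open_nbhs_nbhs.
by apply: cf => //; apply: open_nbhs_nbhs; split => //; exact: rray_open.
Qed.

Lemma leb_box_le (a : V * V) : (mu (box a) <= (box_volume a)%:E)%E.
Proof.
pose c k : V * V := if k is 0 then a else (0, 0).
apply: ge_ereal_inf; exists (\sum_(k <oo) (box_volume (c k))%:E)%E.
  by exists c => // x ax; exists 0%N.
rewrite (@nneseries_split _ _ 0 1); last by move=> k _; exact: box_volume_ge0.
rewrite add0n big_nat1 /= eseries0 ?adde0// => -[//|k] _ _ /=.
by rewrite (box_volumeD1 _ ord0)/= subrr maxxx mul0r.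
Qed.

(** A half-open box with the corners of the cube misses its lower faces, so the lower corner is
    pushed back by [l]. The resulting factor 2^(n+1) only affects constants. *)
Lemma leb_cube_le (a : V) (l : R) : 0 < l ->
  (mu (cube a l) <= ((2 * l) ^+ n.+1)%:E)%E.
Proof.
move=> l0; pose c : V * V := (\row_i (a 0 i - l), \row_i (a 0 i + l)).
apply: (@le_trans _ _ (mu (box c))).
  apply: le_lebesgue_outer => x ax i; have /andP[h1 h2] := ax i.
  by rewrite /= !mxE; apply/andP; split; lra.
apply: (le_trans (leb_box_le c)); rewrite lee_fin /box_volume.
under eq_bigr do rewrite !mxE.
rewrite (eq_bigr (fun=> 2 * l)) => [|i _].
  by rewrite prodr_const card_ord.
by rewrite /Num.max; case: ltP; lra.
Qed.

(* The cover is integrated over the cube one coordinate at a time: after [j]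
   steps, the factors of index [i < j] have become lengths. *)
Lemma leb_cube_ge (a : V) (l : R) : 0 < l ->
  ((l ^+ n.+1)%:E <= mu (cube a l))%E.
Proof.
move=> l0; apply: le_ereal_inf_tmp => _ [c acover <-].
pose I k i : set R := `](c k).1 0 i, (c k).2 0 i]%classic.
pose L k i : R := Num.max 0 ((c k).2 0 i - (c k).1 0 i).
pose T (j : nat) k (x : V) : R :=
  (\prod_(i < n.+1) if (i < j)%N then L k i else \1_(I k i) (x 0 i)).
have T0 j k x : 0 <= T j k x.
  apply: prodr_ge0 => i _; case: ifP => _; first by rewrite le_max lexx.
  by rewrite indicE ler0n.
have main j : (j <= n.+1)%N -> forall x, cube a l x ->
    ((l ^+ j)%:E <= \sum_(k <oo) (T j k x)%:E)%E.
  elim: j => [_ x ax|j IH jn x ax].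
    rewrite expr0; have [k _ xk] := acover _ ax.
    apply: (@le_trans _ _ (\sum_(0 <= i < k.+1) (T 0%N i x)%:E)%E); last first.
      by apply: nneseries_lim_ge => i _ _; rewrite lee_fin.
    rewrite big_nat_recr//= [X in (X <= _)%E](_ : _ = (T 0%N k x)%:E).
      by apply: leeDr; apply: sume_ge0 => i _; rewrite lee_fin.
    congr EFin; rewrite /T big1// => i _.
    by rewrite indicE mem_set//= /I/= in_itv/=; exact: xk.
  pose J := Ordinal jn.
  have TE k t : cube a l (row_upd x J t) ->
      T j k (row_upd x J t) =
      (\prod_(i < n.+1 | i != J) if (i < j.+1)%N then L k i else \1_(I k i) (x 0 i))
        * \1_(I k J) t.
    move=> _; rewrite /T (bigD1 J)//= ltnn row_updE eqxx mulrC; congr (_ * _).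
    apply: eq_bigr => i iJ; rewrite row_updE (negbTE iJ).
    rewrite [in RHS]ltnS [in RHS]leq_eqVlt.
    by have /negbTE -> : (i : nat) != j by apply: contra iJ => /eqP ij; exact/eqP/val_inj.
  pose P k := \prod_(i < n.+1 | i != J)
     if (i < j.+1)%N then L k i else \1_(I k i) (x 0 i).
  have P0 k : 0 <= P k.
    apply: prodr_ge0 => i _; case: ifP => _; first by rewrite le_max lexx.
    by rewrite indicE ler0n.
  pose D : set R := `[a 0 J, a 0 J + l]%classic.
  have xD t : D t -> cube a l (row_upd x J t).
    rewrite /D/= in_itv/= => h i; rewrite row_updE; case: eqP => [->//|_].
    exact: ax.
  have mD : measurable D by exact: measurable_itv.
  have mI k i : measurable (I k i) by exact: measurable_itv.
  have -> : ((l ^+ j.+1)%:E = \int[lebesgue_measure]_(t in D) (l ^+ j)%:E)%E.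
    rewrite integral_cst//= lebesgue_measure_itv/= lte_fin ltrDl l0.
    by rewrite -EFinB -EFinM exprSr; congr (_ * _)%:E; lra.
  apply: (@le_trans _ _ (\int[lebesgue_measure]_(t in D)
      \sum_(k <oo) ((P k)%:E * (\1_(I k J) t)%:E))%E).
    apply: ge0_le_integral => //.
    - by move=> t _; rewrite lee_fin exprn_ge0// ltW.
    - apply: ge0_emeasurable_sum => k *; first by rewrite mule_ge0// lee_fin// indicE ler0n.
      apply: measurable_funeM; apply/measurable_EFinP.
      by exact: (measurable_indic (mI _ _)).
    - move=> t Dt; apply: (le_trans (IH (ltnW jn) _ (xD _ Dt))).
      by apply: lee_nneseries => k _; rewrite ?lee_fin// TE//; exact: xD.
  rewrite integral_nneseries//; last 2 first.
  - move=> k; apply: measurable_funeM; apply/measurable_EFinP.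
    by exact: (measurable_indic (mI _ _)).
  - by move=> k t _; rewrite mule_ge0// lee_fin// indicE ler0n.
  apply: lee_nneseries => k _.
    by move=> _; apply: integral_ge0 => t _; rewrite mule_ge0// lee_fin// indicE ler0n.
  rewrite ge0_integralZl_EFin ?P0//; last first.
    by apply/measurable_EFinP; exact: (measurable_indic (mI _ _)).
  rewrite integral_indic//; last exact: mI.
  rewrite /T (bigD1 J)//= ltnSn mulrC EFinM; apply: lee_wpmul2l.
    by rewrite lee_fin.
  apply: (@le_trans _ _ (lebesgue_measure (I k J))).
    by apply: le_measure; rewrite ?inE//; [exact: (measurableI _ _ (mI _ _) mD)|exact: mI].
  rewrite /I lebesgue_measure_itv/= lte_fin /L; case: ifPn => h.
    by rewrite -EFinB lee_fin le_max lexx orbT.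
  by rewrite lee_fin le_max lexx.
apply: (le_trans (main n.+1 (leqnn _) a _)).
  by move=> i; rewrite lexx lerDl ltW.
apply: lee_nneseries => k _; first by move=> _; rewrite lee_fin.
by rewrite lee_fin /T /box_volume ler_prod// => i _; rewrite ltn_ord lexx le_max lexx.
Qed.

Lemma leb_cube_fin (a : V) l : 0 < l -> (0 < mu (cube a l) < +oo)%E.
Proof.
move=> l0; apply/andP; split.
  by apply: lt_le_trans (leb_cube_ge a l0); rewrite lte_fin exprn_gt0.
by apply: le_lt_trans (leb_cube_le a l0) _; rewrite ltry.
Qed.

Lemma leb_setT_gt0 : (0 < mu setT)%E.
Proof.
have /andP[h _] := leb_cube_fin (0 : V) ltr01.
by apply: lt_le_trans h _; apply: le_lebesgue_outer.
Qed.

Lemma lebesgue_outer_shift (A : set V) (h : V) :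
  lebesgue_outer [set x | A (x + h)] = lebesgue_outer A.
Proof.
suff le (B : set V) (u : V) : (lebesgue_outer [set x : V | B (x + u)%R] <= lebesgue_outer B)%E.
  apply/eqP; rewrite eq_le le/=.
  rewrite [X in (lebesgue_outer X <= _)%E](_ : _ =
      [set x | [set x | A (x + h)] (x + (- h))%R]); first exact: le.
  by apply/seteqP; split => x /=; rewrite subrK.
apply: le_ereal_inf_tmp => _ [c Bc <-]; apply: ereal_inf_lbound.
exists (fun k => ((c k).1 - u, (c k).2 - u)).
  move=> x /= /Bc[k _ xk]; exists k => // i; have := xk i; rewrite /= !mxE.
  by move=> /andP[? ?]; apply/andP; split; lra.
apply: eq_eseriesr => k _; congr EFin; apply: eq_bigr => i _ /=.
by rewrite !mxE; congr Num.max; lra.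
Qed.

Lemma measurable_shift (h : V) : measurable_fun setT (fun x : V => x + h).
Proof.
move=> _ A mA; rewrite setTI.
have shiftE (B : set V) : lebesgue_outer [set x | B (x + h)] = lebesgue_outer B.
  exact: lebesgue_outer_shift.
rewrite /measurable/= => X.
pose Y : set V := [set y | X (y - h)].
have -> : X = [set x | Y (x + h)].
  by apply/seteqP; split => x; rewrite /Y /= addrK.
have := mA Y; rewrite -(shiftE Y) => ->.
by rewrite -(shiftE (Y `&` A)) -(shiftE (Y `&` ~` A)).
Qed.

Lemma leb_pushforward_shift (h : V) (A : set V) :
  pushforward mu (fun x : V => x + h) A = mu A.
Proof. exact: lebesgue_outer_shift. Qed.

Lemma integrable_shift (f : V -> R) (h : V) :
  mu.-integrable setT (EFin \o f) ->
  mu.-integrable setT (EFin \o (fun x => f (x + h))).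
Proof.
move=> /integrableP[mf fi]; apply/integrableP; split.
  apply/measurable_EFinP.
  have/measurable_EFinP {}mf := mf.
  exact: (measurableT_comp mf (measurable_shift h)).
rewrite (_ : (\int[_]_(x in _) _)%E =
    (\int[pushforward mu (fun x : V => (x + h)%R)]_x `|(EFin \o f) x|)%E).
  by rewrite (_ : pushforward mu _ = mu)//; apply/funext; exact: leb_pushforward_shift.
have mabs : measurable_fun setT (fun x : V => `|(EFin \o f) x|%E).
  exact: (measurableT_comp (@abse_measurable R setT) mf).
by rewrite (ge0_integral_pushforward (measurable_shift h) mu measurableT mabs (fun _ _ => abse_ge0 _)).
Qed.

Lemma integral_shift (f : V -> R) (h : V) :
  mu.-integrable setT (EFin \o f) ->
  (\int[mu]_x (f (x + h)%R)%:E = \int[mu]_x (f x)%:E)%E.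
Proof.
move=> fi; have fhi := integrable_shift h fi.
transitivity (\int[pushforward mu (fun x : V => (x + h)%R)]_x (EFin \o f) x)%E.
  have mf := measurable_int _ fi.
  by rewrite (integral_pushforward (measurable_shift h) mf fhi measurableT).
by rewrite (_ : pushforward mu _ = mu)//; apply/funext; exact: leb_pushforward_shift.
Qed.

(** Outer regularity, with covers of excess 1/(k+1). The outer sets are kept as unions of half-open
    boxes instead of open sets, because mollification from the lower left is eventually exact on
    such boxes. *)
Lemma box_cover_Gdelta (E : set V) : measurable E -> (mu E < +oo)%E ->
  exists c : nat -> nat -> V * V,
    (forall k, E `<=` \bigcup_j box (c k j)) /\
    mu ((\bigcap_k \bigcup_j box (c k j)) `\` E) = 0%E.
Proof.
move=> mE Eoo.
have Efin : lebesgue_outer E \is a fin_num.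
  by rewrite ge0_fin_numE// lebesgue_outer_ge0.
have /choice[c hc] (k : nat) : exists c : nat -> V * V, box_cover E c /\
    (\sum_(j <oo) (box_volume (c j))%:E <= mu E + k.+1%:R^-1%:E)%E.
  have k0 : 0 < k.+1%:R^-1 :> R by rewrite invr_gt0.
  have [_ [c Ec <-] /ltW cE] := lb_ereal_inf_adherent k0 Efin.
  by exists c.
exists c; split=> [k|]; first by case: (hc k).
set G := \bigcap_k _.
have mG : measurable G.
  by apply: bigcapT_measurable => k; apply: bigcupT_measurable => j; exact: measurable_box.
have EG : E `<=` G by move=> x Ex k _; case: (hc k) => + _; exact.
have GE k : (mu G <= mu E + k.+1%:R^-1%:E)%E.
  case: (hc k) => _; apply: le_trans; apply: ereal_inf_lbound.
  by exists (c k) => // x; apply.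
have Gfin : (mu G < +oo)%E.
  by apply: le_lt_trans (GE 0%N) _; rewrite lte_add_pinfty// ltry.
apply/eqP; rewrite eq_le measure_ge0 andbT.
apply/lee_addgt0Pr => e e0; rewrite add0e.
have [k ke] : exists k : nat, k.+1%:R^-1 < e.
  by have [k ke] := exists_inv_lt e0; exists k; exact: ke.
have GD : (mu G = mu E + mu (G `\` E))%E.
  rewrite -measureU//; last 2 first.
  - exact: measurableD.
  - by apply/seteqP; split => x //= [Ex [_ /(_ Ex)]].
  by rewrite setDUK.
have := GE k; rewrite GD leeD2lE//.
by move=> /le_trans; apply; rewrite lee_fin ltW.
Qed.

Lemma le_int (D : set V) (f g : V -> R) : measurable D ->
  measurable_fun D f -> measurable_fun D g ->
  (forall x, D x -> 0 <= f x /\ f x <= g x) ->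
  (\int[mu]_(x in D) (f x)%:E <= \int[mu]_(x in D) (g x)%:E)%E.
Proof.
move=> mD /measurable_EFinP mf /measurable_EFinP mg fg.
apply: (@ge0_le_integral _ _ _ mu D mD _ _ _ mf mg) => x /fg[f0 fgx].
  by rewrite lee_fin.
by rewrite lee_fin.
Qed.

Lemma int_subset (A B : set V) (f : V -> R) : measurable A -> measurable B ->
  measurable_fun B f -> (forall x, B x -> 0 <= f x) -> A `<=` B ->
  (\int[mu]_(x in A) (f x)%:E <= \int[mu]_(x in B) (f x)%:E)%E.
Proof.
move=> mA mB /measurable_EFinP mf f0 AB.
by apply: (@ge0_subset_integral _ _ _ mu A B mA mB _ mf) => // x /f0; rewrite lee_fin.
Qed.

Lemma int_scale (D : set V) (f : V -> R) (k : R) : measurable D -> measurable_fun D f ->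
  (forall x, D x -> 0 <= f x) -> 0 <= k ->
  (\int[mu]_(x in D) (k * f x)%:E = k%:E * \int[mu]_(x in D) (f x)%:E)%E.
Proof.
move=> mD /measurable_EFinP mf f0 k0.
rewrite -(@ge0_integralZl_EFin _ _ _ mu D mD _ _ mf k k0)//.
Qed.

End lebesgue_measure.

(** * Smooth functions *)

Section bump.
Context {R : realType}.

(** The pair (P, m) codes P(s) w^-m exp(-1/w) with w = s (1 - s), extended by 0. The family contains
    the usual bump, coded by (1, 0), and is stable under differentiation, so that smoothness needs a
    first derivative only. *)
Definition bump1 (t : {poly R} * nat) (s : R) : R :=
  if 0 < s < 1 then
    t.1.[s] * (s * (1 - s)) ^- t.2 * expR (- (s * (1 - s))^-1)
  else 0.

(** With w' = 1 - 2X, the derivative of P w^-m exp(-1/w) is (P' w^2 - m P w w' + P w') w^-(m+2)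
    exp(-1/w). *)
Definition dbump1 (t : {poly R} * nat) : {poly R} * nat :=
  let w := 'X * (1 - 'X) in
  (t.1^`() * w ^+ 2 - t.2%:R *: (t.1 * w * (1 - 'X *+ 2)) +
   t.1 * (1 - 'X *+ 2), t.2.+2).

Lemma bump1_out t s : ~~ (0 < s < 1) -> bump1 t s = 0.
Proof. by rewrite /bump1 => /negbTE ->. Qed.

(** Raise exp(x) >= x to the power m+1 at x = 1/((m+1) w), then take inverses. *)
Lemma expRN_inv_le m (w : R) : 0 < w -> expR (- w^-1) <= (m.+1%:R * w) ^+ m.+1.
Proof.
move=> w0; have c0 : 0 < m.+1%:R * w by rewrite mulr_gt0.
rewrite expRN -[leRHS]invrK; rewrite lef_pV2 ?posrE ?invr_gt0 ?exprn_gt0 ?expR_gt0//.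
rewrite -exprVn (_ : w^-1 = (m.+1%:R * w)^-1 *+ m.+1); last first.
  by rewrite -(mulr_natl (_ * w)^-1) invfM mulVKf// pnatr_eq0.
rewrite -(mulr_natl (_ * w)^-1) expRM_natl; apply: lerXn2r; rewrite ?nnegrE ?expR_ge0 ?invr_ge0 ?ltW//.
by apply: lt_le_trans (expR_ge1Dx _); rewrite ltrDr.
Qed.

Lemma poly_itv_bounded (p : {poly R}) :
  exists2 C : R, 0 <= C & forall s : R, 0 < s < 1 -> `|p.[s]| <= C.
Proof.
exists (\sum_(i < size p) `|p`_i|); first exact: sumr_ge0.
move=> s /andP[s0 s1]; rewrite horner_coef; apply: le_trans (ler_norm_sum _ _ _) _.
apply: ler_sum => i _; rewrite normrM ler_piMr// normrX exprn_ile1//.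
by rewrite gtr0_norm// ltW.
Qed.

(** The exponential absorbs w^-m with two powers of w to spare, whence the exponent m + 2. Vanishing
    to second order at 0 and 1 makes the extension by 0 differentiable there. *)
Lemma bump1_bound t : exists2 C : R, 0 <= C &
  forall s : R, 0 < s < 1 -> `|bump1 t s| <= C * (s * (1 - s)) ^+ 2.
Proof.
have [C C0 tC] := poly_itv_bounded t.1.
exists (C * t.2.+2%:R ^+ t.2.+2); first by rewrite mulr_ge0// exprn_ge0.
move=> s s01; rewrite /bump1 s01 !normrM.
set w := s * (1 - s); have w0 : 0 < w by case/andP: s01 => ? ?; rewrite mulr_gt0// subr_gt0.
rewrite (ger0_norm (expR_ge0 _)) (@ger0_norm _ (w ^- _)) ?invr_ge0 ?exprn_ge0 ?(ltW w0)//.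
rewrite -(mulrA C) -(mulrA `|_|); apply: ler_pM => //; first by rewrite mulr_ge0 ?expR_ge0// invr_ge0 exprn_ge0 ?ltW.
  exact: tC.
rewrite ler_pdivrMl ?exprn_gt0//; apply: le_trans (expRN_inv_le t.2.+1 w0) _.
by rewrite [leRHS]mulrCA -exprD addn2 -exprMn.
Qed.

Lemma bump1_bounded t : exists2 C : R, 0 <= C & forall s : R, `|bump1 t s| <= C.
Proof.
have [C C0 tC] := bump1_bound t; exists C => // s.
have [s01|s01] := boolP (0 < s < 1); last by rewrite bump1_out// normr0.
apply: le_trans (tC _ s01) _; rewrite ler_piMr// exprn_ile1//.
  by case/andP: s01 => ? ?; rewrite mulr_ge0//; lra.
by case/andP: s01 => ? ?; nra.
Qed.

(** A uniform quadratic remainder, unlike the mere existence of a limit, can be integrated against a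
    function. Derivatives of bumps at the endpoints, of kernels and of convolutions are all obtained
    in this form. *)
Lemma is_derive_second_order (U : normedModType R) (g : U -> R) (x v : U) (dg C : R) :
  (forall h, `|g (h *: v + x) - g x - h * dg| <= C * h ^+ 2) ->
  is_derive x v g dg.
Proof.
move=> gC; have C0 : 0 <= C.
  by have := gC 1; rewrite expr1n mulr1; exact: le_trans.
have lim : h^-1 *: ((g \o shift x) (h *: v) - g x) @[h --> 0^'] --> dg.
  apply/cvgrPdist_le => e e0; near=> h.
  have h0 : h != 0 by near: h; exact: nbhs_dnbhs_neq.
  rewrite /= distrC (_ : _ - dg = h^-1 * (g (h *: v + x) - g x - h * dg)); last first.
    by rewrite /GRing.scale/= [RHS]mulrBr mulKf.
  rewrite normrM normfV ler_pdivrMl ?normr_gt0//.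
  apply: le_trans (gC h) _; rewrite -real_normK ?num_real// expr2 mulrA mulrC.
  rewrite ler_pM2l ?normr_gt0//.
  have : `|h| <= e / (C + 1).
    near: h; apply: dnbhs0_le; rewrite divr_gt0//; lra.
  rewrite ler_pdivlMr; last lra.
  have := normr_ge0 h; nra.
by apply: DeriveDef; [apply/cvg_ex; exists dg|exact: cvg_lim].
Unshelve. all: by end_near. Qed.

Lemma is_derive_bump1 t (s : R) : is_derive s 1 (bump1 t) (bump1 (dbump1 t) s).
Proof.
have [s01|s01] := boolP (0 < s < 1); last first.
  have [C C0 tC] := bump1_bound t.
  rewrite (bump1_out (dbump1 t) s01).
  apply: (@is_derive_second_order R^o _ _ _ _ C) => h.
  rewrite mulr0 subr0 (bump1_out t s01) subr0.
  have -> : h *: (1 : R^o) + s = h + s by rewrite /GRing.scale/= mulr1.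
  have [hs|hs] := boolP (0 < h + s < 1); last first.
    by rewrite bump1_out// normr0 mulr_ge0// sqr_ge0.
  apply: le_trans (tC _ hs) _; rewrite ler_wpM2l//.
  (* An endpoint separates [s] from [u], which lies in (0, 1); hence u or 1 - u is at most |h|, and
     so is u (1 - u). *)
  rewrite -(real_normK (num_real h)); set u := h + s in hs *.
  case/andP: hs => u0 u1; have uu0 : 0 <= u * (1 - u) by rewrite mulr_ge0// ?subr_ge0 ltW.
  rewrite lerXn2r ?nnegrE//; move: s01; rewrite negb_and -!leNgt => /orP[s0|s1].
    apply: (@le_trans _ _ u); first by rewrite ler_piMr// ?ltW//; lra.
    by apply: le_trans (ler_norm h); rewrite /u gerDl.
  apply: (@le_trans _ _ (1 - u)); first by rewrite ler_piMl// ?ltW//; lra.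
  by rewrite -normrN; apply: le_trans (ler_norm _); rewrite /u; lra.
set w : {poly R} := 'X * (1 - 'X).
have wE u : w.[u] = u * (1 - u) by rewrite /w !hornerE.
have ws : w.[s] != 0.
  by rewrite wE; case/andP: s01 => ? ?; rewrite mulf_neq0// ?gt_eqF// subr_gt0.
pose iw (u : R) : R := (w.[u])^-1.
pose g : R -> R := horner t.1 * iw ^+ t.2 * (expR \o (- iw)).
have gE u : g u = t.1.[u] * (u * (1 - u)) ^- t.2 * expR (- (u * (1 - u))^-1).
  by rewrite /g !fctE /= /iw wE exprVn.
have near_g : \near s, g s = bump1 t s.
  near=> u; rewrite gE /bump1 ifT//; apply/andP; split; near: u.
    by apply: lt_nbhsr; case/andP: s01.
  by apply: lt_nbhsl; case/andP: s01.
apply: (near_eq_is_derive near_g).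
have dw : is_derive s 1 (horner w) (1 - 2 * s).
  apply: is_derive_eq; rewrite /w derivM derivX derivB derivX -[1]/(1%:P) derivC !hornerE.
  by ring.
have diw : is_derive s 1 iw (- w.[s] ^- 2 * (1 - 2 * s)) by apply: is_deriveV.
have dNiw : is_derive s 1 (- iw) (w.[s] ^- 2 * (1 - 2 * s)).
  by apply: is_derive_eq; rewrite mulNr opprK.
have de : is_derive s 1 (expR \o (- iw))
    (expR (- iw s) * (w.[s] ^- 2 * (1 - 2 * s))).
  by apply: is_derive1_comp.
have dX : is_derive s 1 (iw ^+ t.2)
    (t.2%:R * iw s ^+ t.2.-1 * (- w.[s] ^- 2 * (1 - 2 * s))).
  exact: is_deriveX.
have dp : is_derive s 1 (horner t.1 * iw ^+ t.2)
    (t.1.[s] * (t.2%:R * iw s ^+ t.2.-1 * (- w.[s] ^- 2 * (1 - 2 * s))) +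
     iw s ^+ t.2 * t.1^`().[s]).
  apply: (is_derive_eq (is_deriveM (is_derive_poly t.1 s) dX)).
  by rewrite exprfctE.
have dg : is_derive s 1 g
   ((t.1.[s] * iw s ^+ t.2) *
      (expR (- iw s) * (w.[s] ^- 2 * (1 - 2 * s))) +
    expR (- iw s) *
      (t.1.[s] * (t.2%:R * iw s ^+ t.2.-1 * (- w.[s] ^- 2 * (1 - 2 * s))) +
       iw s ^+ t.2 * t.1^`().[s])).
  by apply: (is_derive_eq (is_deriveM dp de)); rewrite mulrfctE exprfctE.
apply: is_derive_eq.
rewrite /bump1 s01 /dbump1/= -/w -wE.
have -> : (t.1^`() * w ^+ 2 - t.2%:R *: (t.1 * w * (1 - 'X *+ 2)) +
    t.1 * (1 - 'X *+ 2)).[s] =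
    t.1^`().[s] * w.[s] ^+ 2 - t.2%:R * t.1.[s] * w.[s] * (1 - 2 * s) +
    t.1.[s] * (1 - 2 * s).
  rewrite !(hornerD, hornerN, hornerM, hornerZ, hornerMn, hornerX, horner_exp).
  by rewrite -[(1 : {poly R})]/(1%:P) hornerC; ring.
rewrite /iw; move: (w.[s]) ws => z z0; case: t.2 => [|k] /=.
  by rewrite !expr0 !exprS expr0; field.
rewrite !exprSr; have zk : z ^+ k != 0 by rewrite expf_neq0.
rewrite exprVn; move: (z ^+ k) zk => y y0; field; exact/andP.
Unshelve. all: by end_near. Qed.

Lemma derivable_bump1 t (s : R) : derivable (bump1 t) s 1.
Proof. by have [] := is_derive_bump1 t s. Qed.

Lemma bump1_mvt t (a b : R) : exists c, bump1 t b - bump1 t a = bump1 (dbump1 t) c * (b - a)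
  /\ `|c - a| <= `|b - a|.
Proof.
have cont (u v : R) : {within `[u, v], continuous (bump1 t)}.
  apply: continuous_subspaceT => z; apply: differentiable_continuous.
  exact/derivable1_diffP/derivable_bump1.
have [ab|ba|->] := ltgtP a b; last by exists b; rewrite !subrr mulr0.
- have [c] := MVT ab (fun x _ => is_derive_bump1 t x) (cont a b).
  rewrite in_itv/= => /andP[ac cb] E; exists c; split=> //.
  by rewrite !ger0_norm; lra.
- have [c] := MVT ba (fun x _ => is_derive_bump1 t x) (cont b a).
  rewrite in_itv/= => /andP[ac cb] E; exists c; split; first lra.
  by rewrite !ler0_norm; lra.
Qed.

Lemma bump1_lipschitz t : exists2 C : R, 0 <= C &
  forall a b, `|bump1 t b - bump1 t a| <= C * `|b - a|.
Proof.
have [C C0 tC] := bump1_bounded (dbump1 t); exists C => // a b.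
by have [c [-> _]] := bump1_mvt t a b; rewrite normrM ler_wpM2r.
Qed.

Lemma bump1_taylor t : exists2 C : R, 0 <= C &
  forall s h, `|bump1 t (s + h) - bump1 t s - h * bump1 (dbump1 t) s| <= C * h ^+ 2.
Proof.
have [C C0 tC] := bump1_lipschitz (dbump1 t); exists C => // s h.
have [c [-> cs]] := bump1_mvt t s (s + h).
rewrite (addrC s) addrK in cs *; rewrite mulrC -mulrBr normrM mulrC.
rewrite -(real_normK (num_real h)) expr2 mulrA ler_wpM2r//.
by apply: le_trans (tC _ _) _; rewrite ler_wpM2l.
Qed.

Lemma bump1_ge0 s : 0 <= bump1 (1, 0%N) s.
Proof.
by rewrite /bump1; case: ifP => // _; rewrite hornerE expr0 invr1 mul1r mul1r expR_ge0.
Qed.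

Lemma bump1_gt0 : exists2 c : R, 0 < c & forall s, 4^-1 <= s <= 3 / 4 -> c <= bump1 (1, 0%N) s.
Proof.
(* On [1/4, 3/4] the product s (1 - s) is at least 3/16, in particular at least 1/16. *)
exists (expR (- 16)); first exact: expR_gt0.
move=> s /andP[s1 s2]; rewrite /bump1 ifT; last by apply/andP; split; lra.
rewrite hornerE expr0 invr1 !mul1r ler_expR lerN2.
have h : 16^-1 <= s * (1 - s).
  have : 0 <= (s - 4^-1) * (3 / 4 - s) by rewrite mulr_ge0//; lra.
  by lra.
rewrite -[leRHS]invrK lef_pV2// posrE ?invr_gt0//.
by apply: lt_le_trans h; rewrite invr_gt0.
Qed.

End bump.

Section smooth_class.
Context {R : realType} {n : nat}.
Notation V := 'rV[R]_n.+1.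
Implicit Types (f g k : V -> R).

Notation e_ i := (delta_mx 0 i : V).

(** A coinduction principle: smoothness is established by exhibiting a class stable under partial
    derivatives, so that only one derivative is ever computed. *)
Lemma smooth_class (O : set V) (C : (V -> R) -> Prop) :
  (forall f x, C f -> O x -> {for x, continuous f} /\
     forall i, derivable f x (e_ i)) ->
  (forall f i, C f -> C (partial i f)) -> forall f, C f -> smooth O f.
Proof.
move=> Ccont Cpart f Cf s x Ox.
by apply: Ccont => //; elim: s => //= i s; exact: Cpart.
Qed.

Lemma smooth_partial (O : set V) f i : smooth O f -> smooth O (partial i f).
Proof. by move=> sf s x Ox; have := sf (rcons s i) x Ox; rewrite /partials foldr_rcons. Qed.

End smooth_class.

(** * Convolution of an integrable function with a smooth kernel *)

Section convolution.
Context {R : realType} {n : nat}.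
Notation V := 'rV[R]_n.+1.
Notation mu := (@leb R n).
Implicit Types (f g k : V -> R).
Notation e_ i := (delta_mx 0 i : V).

Lemma coord_norm_le (x : V) i : `|x 0 i| <= `|x|.
Proof.
rewrite [leRHS]/Num.norm/= mx_normrE; apply/bigmax_geP; right.
by exists (ord0, i).
Qed.

Lemma norm_coord_ge (x : V) (c : R) : 0 <= c -> (forall i, `|x 0 i| <= c) -> `|x| <= c.
Proof.
move=> c0 xc; rewrite [leLHS]/Num.norm/= mx_normrE; apply/bigmax_leP; split=> // -[i j] _ /=.
by rewrite (ord1 i).
Qed.

Definition bounded_lipschitz k := exists2 C : R, 0 <= C &
  forall x y, `|k x| <= C /\ `|k x - k y| <= C * `|x - y|.

Lemma lipschitz_continuous k (C : R) :
  (forall x y, `|k x - k y| <= C * `|x - y|) -> continuous k.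
Proof.
move=> kC x; apply/(@cvgrPdist_le _ _ _ (nbhs x) (nbhs_filter x)) => e e0.
have eC : 0 < e / (`|C| + 1) by rewrite divr_gt0// ltr_wpDl.
near=> y.
apply: le_trans (kC _ _) _.
have : `|x - y| <= e / (`|C| + 1).
  near: y; apply/nbhs_coordP; exists (e / (`|C| + 1)) => // y xy.
  apply: norm_coord_ge => [|i]; first exact: ltW.
  by rewrite !mxE ltW//; exact: xy.
rewrite ler_pdivlMr ?ltr_wpDl// => h; apply: le_trans h.
rewrite mulrC ler_wpM2l//; apply: le_trans (ler_norm _) _.
by rewrite lerDl.
Unshelve. all: by end_near. Qed.

Lemma bounded_lipschitz_continuous k : bounded_lipschitz k -> continuous k.
Proof.
by move=> [C C0 kC]; apply: (@lipschitz_continuous _ C) => x y; case: (kC x y).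
Qed.

Lemma bounded_lipschitzM f g : bounded_lipschitz f -> bounded_lipschitz g ->
  bounded_lipschitz (fun x => f x * g x).
Proof.
move=> [C C0 fC] [D D0 gD]; exists (C * D + C * D).
  by rewrite addr_ge0// mulr_ge0.
move=> x y; have [fx fxy] := fC x y; have [gx gxy] := gD x y; have [gy _] := gD y y.
split.
  rewrite normrM; apply: le_trans (ler_pM _ _ fx gx) _ => //.
  by rewrite lerDl mulr_ge0.
have -> : f x * g x - f y * g y = f x * (g x - g y) + (f x - f y) * g y by ring.
apply: le_trans (ler_normD _ _) _; rewrite !normrM mulrDl lerD//.
  by rewrite -mulrA ler_pM.
by rewrite [leRHS]mulrAC ler_pM.
Qed.

Lemma bounded_lipschitz_prod (s : seq 'I_n.+1) (F : 'I_n.+1 -> V -> R) :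
  (forall i, bounded_lipschitz (F i)) ->
  bounded_lipschitz (fun x => \prod_(i <- s) F i x).
Proof.
move=> FL; elim: s => [|i s IH].
  exists 1 => // x y.
  by rewrite !big_nil normr1 subrr normr0 mul1r.
rewrite (_ : (fun x => _) = (fun x => F i x * \prod_(j <- s) F j x)).
  exact: bounded_lipschitzM.
by apply/funext => x; rewrite big_cons.
Qed.

Lemma bounded_lipschitz_scale k (c : R) : bounded_lipschitz k ->
  bounded_lipschitz (fun x => k (c *: x)).
Proof.
move=> [C C0 kC]; exists (C + C * `|c|); first by rewrite addr_ge0// mulr_ge0.
move=> x y; have [kx kxy] := kC (c *: x) (c *: y); split.
  by apply: le_trans kx _; rewrite lerDl mulr_ge0.
apply: le_trans kxy _; rewrite -scalerBr normrZ mulrA ler_wpM2r//.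
by rewrite lerDr.
Qed.

(** First-order expansion along the i-th axis, uniform in the base point; integrated against f it
    gives a remainder at most C h^2 times the L^1 norm of f, so convolution can be differentiated
    without a limit theorem. *)
Definition taylor1 (i : 'I_n.+1) k k' := exists2 C : R, 0 <= C &
  forall x (h : R), `|k (h *: e_ i + x) - k x - h * k' x| <= C * h ^+ 2.

Lemma taylor1_scale i k k' (c : R) : taylor1 i k k' ->
  taylor1 i (fun x => k (c *: x)) (fun x => c * k' (c *: x)).
Proof.
move=> [C C0 kC]; exists (C * c ^+ 2); first by rewrite mulr_ge0// sqr_ge0.
move=> x h; have := kC (c *: x) (c * h).
rewrite -scalerA -scalerDr exprMn mulrA.
by rewrite (mulrC h c) -(mulrA C).
Qed.

Definition mbump (t : 'I_n.+1 -> {poly R} * nat) (x : V) : R :=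
  \prod_i bump1 (t i) (x 0 i).

Definition dmbump (i : 'I_n.+1) (t : 'I_n.+1 -> {poly R} * nat) :=
  fun j => if j == i then dbump1 (t j) else t j.

Lemma mbump_bounded_lipschitz t : bounded_lipschitz (mbump t).
Proof.
apply: bounded_lipschitz_prod => i.
have [C C0 tC] := bump1_bounded (t i); have [D D0 tD] := bump1_lipschitz (t i).
exists (C + D); first exact: addr_ge0.
move=> x y; split; first by apply: le_trans (tC _) _; rewrite lerDl.
apply: le_trans (tD _ _) _; rewrite ler_pM ?lerDr//.
by have := coord_norm_le (x - y) i; rewrite !mxE.
Qed.

Lemma mbump_taylor1 i t : taylor1 i (mbump t) (mbump (dmbump i t)).
Proof.
have [C C0 tC] := bump1_taylor (t i).
pose P (x : V) := \prod_(j < n.+1 | j != i) bump1 (t j) (x 0 j).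
have [D D0 PD] : exists2 D : R, 0 <= D & forall x, `|P x| <= D.
  have /choice[D hD] (j : 'I_n.+1) : exists D : R, 0 <= D /\ forall s, `|bump1 (t j) s| <= D.
    by have [D D0 tD] := bump1_bounded (t j); exists D.
  exists (\prod_(j < n.+1 | j != i) D j); first by apply: prodr_ge0 => j _; case: (hD j).
  by move=> x; rewrite normr_prod; apply: ler_prod => j _; have [_ ->] := hD j; rewrite normr_ge0.
exists (C * D); first exact: mulr_ge0.
move=> x h.
have bE u (y : V) : (forall j, j != i -> u j = t j /\ y 0 j = x 0 j) ->
    mbump u y = bump1 (u i) (y 0 i) * P x.
  move=> uy; rewrite /mbump (bigD1 i)//=; congr (_ * _); apply: eq_bigr => j ji.
  by have [-> ->] := uy j ji.
rewrite (bE t (h *: e_ i + x)); last first.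
  by move=> j ji; rewrite !mxE (negbTE ji) andbF mulr0 add0r.
rewrite (bE t x)// (bE (dmbump i t) x); last by move=> j ji; rewrite /dmbump (negbTE ji).
by rewrite /dmbump !mxE !eqxx mulr1 (addrC h) mulrA -!mulrBl normrM mulrAC ler_pM.
Qed.

Lemma measurable_fun_continuous k : continuous k -> measurable_fun setT k.
Proof. by move=> ck; apply: measurable_continuous => [|x _]; [exact: openT|exact: ck]. Qed.

Lemma integrable_scale (D : set V) f (c : R) : measurable D ->
  mu.-integrable D (EFin \o f) -> mu.-integrable D (EFin \o (fun x => c * f x)).
Proof. by move=> mD fi; exact: (integrableZl mD c fi). Qed.

Lemma integrable_sub (D : set V) f g : measurable D ->
  mu.-integrable D (EFin \o f) -> mu.-integrable D (EFin \o g) ->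
  mu.-integrable D (EFin \o (fun x => f x - g x)).
Proof. by move=> mD fi gi; exact: (integrableB mD fi gi). Qed.

Lemma integrable_mul_bounded (D : set V) f g (C : R) : measurable D ->
  mu.-integrable D (EFin \o f) -> measurable_fun D g ->
  (forall x, D x -> `|g x| <= C) ->
  mu.-integrable D (EFin \o (fun x => f x * g x)).
Proof.
move=> mD fi mg gC.
have : mu.-integrable D (fun x => (C%:E * (EFin \o f) x)%E) by exact: integrableZl.
apply: le_integrable => //.
  have /measurable_EFinP mf := measurable_int _ fi.
  by apply/measurable_EFinP; exact: measurable_funM.
move=> x Dx /=; rewrite lee_fin !normrM mulrC ler_wpM2r//.
by apply: le_trans (gC x Dx) _; exact: ler_norm.
Qed.

Definition convol f k (x : V) : R := \int[mu]_y (f y * k (x - y)).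

Lemma measurable_reflect k x : continuous k -> measurable_fun setT (fun y : V => k (x - y)).
Proof.
move=> ck; apply: measurable_fun_continuous.
have -> : (fun y => k (x - y)) = k \o (fun y => x - y) by [].
move=> y; apply: continuous_comp; last exact: ck.
by apply: continuousB; [exact: cst_continuous|move=> A].
Qed.

Lemma convol_integrable f k x : mu.-integrable setT (EFin \o f) ->
  bounded_lipschitz k -> mu.-integrable setT (EFin \o (fun y => f y * k (x - y))).
Proof.
move=> fi kL; have [C C0 kC] := kL.
apply: (integrable_mul_bounded (C := C)) => //.
  by apply: measurable_reflect; exact: bounded_lipschitz_continuous.
by move=> y _; case: (kC (x - y) (x - y)).
Qed.

Lemma Rintegral_mul_le f g (c : R) : mu.-integrable setT (EFin \o f) ->
  mu.-integrable setT (EFin \o (fun y => f y * g y)) ->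
  (forall y, `|g y| <= c) ->
  `|\int[mu]_y (f y * g y)| <= c * \int[mu]_y `|f y|.
Proof.
move=> fi fg gc; apply: le_trans (le_normr_Rintegral _ _) _ => //.
have absi : mu.-integrable setT (EFin \o (fun y => `|f y|)).
  exact: (integrable_abse fi).
rewrite -RintegralZl//; apply: le_Rintegral => //.
- exact: (integrable_abse fg).
- exact: integrable_scale.
- by move=> y _; rewrite normrM mulrC ler_wpM2r.
Qed.

Lemma convol_continuous f k : mu.-integrable setT (EFin \o f) ->
  bounded_lipschitz k -> continuous (convol f k).
Proof.
move=> fi kL; have [C C0 kC] := kL.
apply: (@lipschitz_continuous _ (C * \int[mu]_y `|f y|)) => x z.
rewrite /convol -RintegralB//; [|exact: convol_integrable..].
under eq_Rintegral do rewrite -mulrBr.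
rewrite mulrAC; apply: Rintegral_mul_le => //.
- rewrite (_ : (fun y => _) = (fun y => f y * k (x - y) - f y * k (z - y))).
    by apply: integrable_sub => //; exact: convol_integrable.
  by apply/funext => y; rewrite mulrBr.
- move=> y; have [_] := kC (x - y) (z - y).
  by rewrite opprB addrA subrK.
Qed.

Lemma convol_is_derive f k k' i x : mu.-integrable setT (EFin \o f) ->
  bounded_lipschitz k -> bounded_lipschitz k' -> taylor1 i k k' ->
  is_derive x (e_ i) (convol f k) (convol f k' x).
Proof.
move=> fi kL kL' [C C0 kC].
apply: (@is_derive_second_order _ _ _ _ _ _ (C * \int[mu]_y `|f y|)) => h.
rewrite /convol -(RintegralZl h measurableT (convol_integrable x fi kL')).

have hi : mu.-integrable setT (EFin \o (fun y => h * (f y * k' (x - y)))).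
  by apply: integrable_scale => //; exact: convol_integrable.
have di : mu.-integrable setT (EFin \o (fun y => f y * k (h *: e_ i + x - y) - f y * k (x - y))).
  by apply: integrable_sub => //; exact: convol_integrable.
rewrite -RintegralB//; [|exact: convol_integrable..].
rewrite -RintegralB//.
have E y : f y * k (h *: e_ i + x - y) - f y * k (x - y) - h * (f y * k' (x - y)) =
    f y * (k (h *: e_ i + (x - y)) - k (x - y) - h * k' (x - y)).
  by rewrite (addrA _ x); ring.
under eq_Rintegral do rewrite E.
rewrite mulrAC; apply: Rintegral_mul_le => //.
rewrite (_ : (fun y => _) = (fun y => f y * k (h *: e_ i + x - y) - f y * k (x - y) -
    h * (f y * k' (x - y)))).
  exact: integrable_sub.
by apply/funext => y; rewrite E.
Qed.

Lemma mbump_scale_bounded_lipschitz t (d : R) : bounded_lipschitz (fun z => mbump t (d *: z)).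
Proof. exact/bounded_lipschitz_scale/mbump_bounded_lipschitz. Qed.

Lemma convol_mbump_is_derive f t (d : R) i x : mu.-integrable setT (EFin \o f) ->
  is_derive x (e_ i) (convol f (fun z => mbump t (d *: z)))
    (d * convol f (fun z => mbump (dmbump i t) (d *: z)) x).
Proof.
move=> fi; apply: is_derive_eq.
  apply: (convol_is_derive _ _ _ _ (taylor1_scale d (mbump_taylor1 i t))) => //.
    exact: mbump_scale_bounded_lipschitz.
  have [C C0 kC] := mbump_scale_bounded_lipschitz (dmbump i t) d.
  exists (`|d| * C); first exact: mulr_ge0.
  move=> y z; have [ky kyz] := kC y z.
  by rewrite -mulrBr !normrM -mulrA !ler_wpM2l.
rewrite /convol -(RintegralZl d measurableT
  (convol_integrable x fi (mbump_scale_bounded_lipschitz _ d))).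
by apply: eq_Rintegral => y _; rewrite mulrCA.
Qed.

Lemma smooth_convol f t (d c : R) : mu.-integrable setT (EFin \o f) ->
  smooth setT (fun x => c * convol f (fun z => mbump t (d *: z)) x).
Proof.
move=> fi; pose C g := exists c t, g = (fun x => c * convol f (fun z => mbump t (d *: z)) x).
have der c' t' i x : is_derive x (e_ i) (fun x => c' * convol f (fun z => mbump t' (d *: z)) x)
    (c' * (d * convol f (fun z => mbump (dmbump i t') (d *: z)) x)).
  apply: (@is_deriveZ _ _ _ (convol f (fun z => mbump t' (d *: z))) c' x).
  exact: convol_mbump_is_derive.
apply: (@smooth_class _ _ setT C); last by exists c, t.
  move=> _ x [c' [t' ->]] _; split.
    apply: (@continuousZl_tmp _ _ _ (convol f (fun z => mbump t' (d *: z)))).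
    by apply: convol_continuous => //; exact: mbump_scale_bounded_lipschitz.
  by move=> i; have [] := der c' t' i x.
move=> _ i [c' [t' ->]]; exists (c' * d), (dmbump i t').
by apply/funext => x; rewrite /partial (@derive_val _ _ _ _ _ _ _ (der c' t' i x)) mulrA.
Qed.

Lemma kernel_is_derive t (d : R) i x y : is_derive y (e_ i)
  (fun y => mbump t (d *: (x - y))) (- d * mbump (dmbump i t) (d *: (x - y))).
Proof.
have [C C0 kC] := taylor1_scale d (mbump_taylor1 i t).
apply: (@is_derive_second_order _ _ _ _ _ _ C) => h.
have := kC (x - y) (- h); rewrite sqrrN.
have -> : - h *: e_ i + (x - y) = x - (h *: e_ i + y).
  by rewrite scaleNr opprD addrCA.
by have -> : - h * (d * mbump (dmbump i t) (d *: (x - y))) =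
   h * (- d * mbump (dmbump i t) (d *: (x - y))) by ring.
Qed.

Lemma smooth_kernel t (d : R) x : smooth setT (fun y : V => mbump t (d *: (x - y))).
Proof.
pose C g := exists c t, g = (fun y => c * mbump t (d *: (x - y))).
have der c' t' i y : is_derive y (e_ i) (fun y => c' * mbump t' (d *: (x - y)))
    (c' * (- d * mbump (dmbump i t') (d *: (x - y)))).
  apply: (@is_deriveZ _ _ _ (fun y : V => mbump t' (d *: (x - y))) c' y).
  exact: kernel_is_derive.
apply: (@smooth_class _ _ setT C).
- move=> _ y [c' [t' ->]] _; split; last by move=> i; have [] := der c' t' i y.
  apply: (@continuousZl_tmp _ _ _ (fun y : V => mbump t' (d *: (x - y)))).
  pose k z := mbump t' (d *: z).
  have -> : (fun y => mbump t' (d *: (x - y))) = k \o (fun y => x - y) by [].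
  apply: continuous_comp; first by apply: continuousB; [exact: cst_continuous|move=> A].
  exact/bounded_lipschitz_continuous/mbump_scale_bounded_lipschitz.
- move=> _ i [c' [t' ->]]; exists (c' * - d), (dmbump i t').
  by apply/funext => y; rewrite /partial (@derive_val _ _ _ _ _ _ _ (der c' t' i y)) mulrA.
- by exists 1, t; apply/funext => y; rewrite mul1r.
Qed.

End convolution.

(** * Algebra of smooth functions, compact supports and integration by parts *)

Section smooth_algebra.
Context {R : realType} {n : nat}.
Notation V := 'rV[R]_n.+1.
Notation mu := (@leb R n).
Implicit Types (f g w dw phi : V -> R) (O U K : set V).
Notation e_ i := (delta_mx 0 i : V).

Lemma near_open_eq U f g (x : V) : open U -> U x -> (forall y, U y -> f y = g y) ->
  \near x, f x = g x.
Proof.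
by move=> oU Ux fg; apply: filterS (open_nbhs_nbhs (conj oU Ux)) => y; exact: fg.
Qed.

Lemma near_eq_continuous f g (x : V) : (\near x, f x = g x) ->
  {for x, continuous f} -> {for x, continuous g}.
Proof.
move=> fg cf; rewrite /prop_for /continuous_at -(nbhs_singleton fg).
exact: cvg_trans (@near_eq_cvg _ _ _ (nbhs_filter x) _ _ fg) cf.
Qed.

Lemma eq_on_partials U f g s (x : V) : open U -> (forall y, U y -> f y = g y) ->
  U x -> partials s f x = partials s g x.
Proof.
move=> oU fg; elim: s x => [|i s IH] x Ux /=; first exact: fg.
by rewrite /partial; apply: near_eq_derive; exact: near_open_eq Ux IH.
Qed.

Lemma smooth_locally O f : (forall x, O x -> exists U g,
    [/\ open U, U x, smooth U g & forall y, U y -> f y = g y]) -> smooth O f.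
Proof.
move=> fO s x /fO[U [g [oU Ux sg fg]]].
have gf : \near x, partials s g x = partials s f x.
  by apply: (near_open_eq oU Ux) => y Uy; rewrite (eq_on_partials s oU fg).
have [cg dg] := sg s x Ux; split; first exact: near_eq_continuous gf cg.
by move=> i; exact: near_eq_derivable (dg i).
Qed.

Lemma sub_smooth O U f : U `<=` O -> smooth O f -> smooth U f.
Proof. by move=> UO sf s x Ux; exact: sf (UO _ Ux). Qed.

Lemma smooth_is_derive O f i (x : V) : smooth O f -> O x ->
  is_derive x (e_ i) f (partial i f x).
Proof. by move=> sf Ox; have [_ /(_ i)df] := sf [::] x Ox; exact: DeriveDef. Qed.

Lemma smooth_continuous O f : smooth O f -> forall x, O x -> {for x, continuous f}.
Proof. by move=> sf x Ox; case: (sf [::] x Ox). Qed.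

Lemma smooth_cst O (c : R) : smooth O (cst c).
Proof.
apply: (@smooth_class _ _ O (fun f => exists c, f = cst c)); last by exists c.
  move=> _ x [c' ->] _; split; first exact: cst_continuous.
  by move=> i; exact: derivable_cst.
move=> _ i [c' ->]; exists 0; apply/funext => x.
by rewrite /partial derive_cst.
Qed.

Lemma smoothD O f g : open O -> smooth O f -> smooth O g ->
  smooth O (fun x => f x + g x).
Proof.
move=> oO sf sg.
pose C h := exists s, forall x, O x -> h x = partials s f x + partials s g x.
apply: (@smooth_class _ _ O C).
- move=> h x [s hE] Ox.
  have fh : \near x, (partials s f + partials s g) x = h x.
    by apply: (near_open_eq oO Ox) => y Oy; rewrite hE.
  have [cf df] := sf s x Ox; have [cg dg] := sg s x Ox; split.
    by apply: (near_eq_continuous fh); exact: continuousD.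
  by move=> i; apply: (near_eq_derivable fh); exact: derivableD.
- move=> h i [s hE]; exists (i :: s) => x Ox.
  have [_ df] := sf s x Ox; have [_ dg] := sg s x Ox.
  rewrite /= /partial -deriveD//; apply: near_eq_derive.
  by apply: (near_open_eq oO Ox) => y Oy; rewrite hE.
- by exists [::].
Qed.

Lemma smooth_sum O (F : nat -> V -> R) m : open O -> (forall k, smooth O (F k)) ->
  smooth O (fun x => \sum_(k < m) F k x).
Proof.
move=> oO sF; elim: m => [|m IH].
  rewrite (_ : (fun x => _) = cst 0); first exact: smooth_cst.
  by apply/funext => x; rewrite big_ord0.
rewrite (_ : (fun x => _) = (fun x => \sum_(k < m) F k x + F m x)); first exact: smoothD.
by apply/funext => x; rewrite big_ord_recr.
Qed.

Lemma smoothM O f g : open O -> smooth O f -> smooth O g ->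
  smooth O (fun x => f x * g x).
Proof.
move=> oO sf sg.
(* By the Leibniz rule, iterated partials of the product are finite sums of products of iterated
   partials; the list [L] records which ones, repetitions included. *)
pose T (L : seq (seq 'I_n.+1 * seq 'I_n.+1)) x :=
  \sum_(st <- L) partials st.1 f x * partials st.2 g x.
pose C h := exists L, forall x, O x -> h x = T L x.
have key L x : O x -> {for x, continuous (T L)} /\ forall i,
    is_derive x (e_ i) (T L)
      (T (flatten [seq [:: (i :: st.1, st.2); (st.1, i :: st.2)] | st <- L]) x).
  move=> Ox; elim: L => [|[s t] L [cL dL]].
    have -> : T [::] = cst 0 by apply/funext => y; rewrite /T big_nil.
    split=> [|i]; first exact: cst_continuous.
    exact: is_derive_cst.
  have TE : T ((s, t) :: L) = partials s f * partials t g + T L.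
    by apply/funext => y; rewrite /T big_cons.
  have [cf df] := sf s x Ox; have [cg dg] := sg t x Ox; rewrite TE; split.
    by apply: continuousD => //; exact: continuousM.
  move=> i; apply: (is_derive_eq (is_deriveD (is_deriveM (DeriveDef (df i) erefl)
    (DeriveDef (dg i) erefl)) (dL i))).
  rewrite /T /= !big_cons/= addrA; congr (_ + _).
  by rewrite /GRing.scale/= addrC (mulrC (partials t g x)).
apply: (@smooth_class _ _ O C).
- move=> h x [L hE] Ox.
  have fh : \near x, T L x = h x.
    by apply: (near_open_eq oO Ox) => y Oy; rewrite hE.
  have [cT dT] := key L x Ox; split; first exact: near_eq_continuous fh cT.
  by move=> i; apply: (near_eq_derivable fh); have [] := dT i.
- move=> h i [L hE].
  exists (flatten [seq [:: (i :: st.1, st.2); (st.1, i :: st.2)] | st <- L]) => x Ox.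
  have [_ /(_ i)[_ <-]] := key L x Ox; apply: near_eq_derive.
  by apply: (near_open_eq oO Ox) => y Oy; rewrite hE.
- by exists [:: ([::], [::])] => x Ox; rewrite /T big_seq1.
Qed.

Lemma partialM O f g i (x : V) : smooth O f -> smooth O g -> O x ->
  partial i (fun x => f x * g x) x = partial i f x * g x + f x * partial i g x.
Proof.
move=> sf sg Ox; rewrite /partial (@derive_val _ _ _ _ _ _ _ (is_deriveM
  (smooth_is_derive i sf Ox) (smooth_is_derive i sg Ox))).
by rewrite /GRing.scale/= addrC (mulrC (g x)).
Qed.

Lemma partial_sum O (F : nat -> V -> R) m i (x : V) : (forall k, smooth O (F k)) -> O x ->
  partial i (fun x => \sum_(k < m) F k x) x = \sum_(k < m) partial i (F k) x.
Proof.
move=> sF Ox.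
suff H : is_derive x (e_ i) (fun x => \sum_(k < m) F k x)
   (\sum_(k < m) partial i (F k) x) by exact: (@derive_val _ _ _ _ _ _ _ H).
elim: m => [|m IH].
  rewrite big_ord0 (_ : (fun x => _) = cst 0); first exact: is_derive_cst.
  by apply/funext => y; rewrite big_ord0.
rewrite big_ord_recr/= (_ : (fun x => _) = (fun x => \sum_(k < m) F k x) + F m).
  by apply: is_deriveD => //; exact: smooth_is_derive (sF m) Ox.
by apply/funext => y; rewrite big_ord_recr.
Qed.

Lemma continuous_support K w : closed K -> (forall x, K x -> {for x, continuous w}) ->
  (forall x, ~ K x -> w x = 0) -> continuous w.
Proof.
move=> cK cw w0 x; have [/cw//|Kx] := pselect (K x).
apply: (@near_eq_continuous (cst 0)); last exact: cst_continuous.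
by apply: (near_open_eq (closed_openC cK) Kx) => y /w0 ->.
Qed.

Lemma compact_support_bounded K w : compact K -> continuous w ->
  (forall x, ~ K x -> w x = 0) -> exists2 C : R, 0 <= C & forall x, `|w x| <= C.
Proof.
move=> cK cw w0.
have : compact (w @` K) by apply: continuous_compact => //; exact: continuous_subspaceT.
move=> /compact_bounded[C [_ hC]]; exists (`|C| + 1); first by rewrite addr_ge0.
move=> x; have [Kx|/w0 ->] := pselect (K x); last by rewrite normr0 addr_ge0.
apply: (hC (`|C| + 1)); last by exists x.
by rewrite (le_lt_trans (ler_norm C))// ltrDl.
Qed.

Lemma compact_sub_cube K : compact K -> exists2 l : R, 0 < l & K `<=` cube (const_mx (- l)) (2 * l).
Proof.
move=> /compact_bounded[C [_ hC]]; exists (`|C| + 1); first by rewrite ltr_wpDl.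
move=> x Kx i; rewrite mxE.
have xC : `|x| <= `|C| + 1.
  by apply: hC => //; rewrite (le_lt_trans (ler_norm C))// ltrDl.
have := le_trans (coord_norm_le x i) xC; rewrite ler_norml => /andP[? ?].
by apply/andP; split=> //; lra.
Qed.

Lemma compact_leb_fin K : compact K -> (mu K < +oo)%E.
Proof.
move=> /compact_sub_cube[l l0 Kl].
apply: le_lt_trans (le_lebesgue_outer Kl) _.
by have /andP[] := @leb_cube_fin R n (const_mx (- l)) (2 * l) (mulr_gt0 (ltr0n _ 2) l0).
Qed.

Lemma bounded_support_integrable K w (C : R) : measurable K -> (mu K < +oo)%E ->
  measurable_fun setT w -> (forall x, `|w x| <= C) ->
  (forall x, ~ K x -> w x = 0) -> mu.-integrable setT (EFin \o w).
Proof.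
move=> mK Koo mw wC w0; apply/integrableP; split; first exact/measurable_EFinP.
rewrite (_ : (fun x => _) = (fun x => `|w x|%:E) \_ K); last first.
  apply/funext => x /=; rewrite patchE; case: ifPn => // xK.
  by rewrite w0 ?normr0// => Kx; move: xK; rewrite mem_set.
rewrite -integral_mkcond; apply: (@le_lt_trans _ _ (\int[mu]_(x in K) C%:E)%E).
  apply: ge0_le_integral => //.
  - by apply/measurable_EFinP; apply: measurable_funTS; exact: measurableT_comp.
  - by move=> x _; rewrite lee_fin.
rewrite integral_cst//; apply: lte_mul_pinfty => //.
by rewrite lee_fin (le_trans _ (wC 0)).
Qed.

Lemma compact_support_integrable K w : compact K -> continuous w ->
  (forall x, ~ K x -> w x = 0) -> mu.-integrable setT (EFin \o w).
Proof.
move=> cK cw w0; have [C C0 wC] := compact_support_bounded cK cw w0.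
apply: (bounded_support_integrable (measurable_compact cK) (compact_leb_fin cK) _ wC w0).
exact: measurable_fun_continuous.
Qed.

Lemma line_mvt w dw i (x : V) (h : R) : 0 < h ->
  (forall y, is_derive y (e_ i) w (dw y)) ->
  exists2 c : R, 0 <= c <= h & w (h *: e_ i + x) - w x = dw (c *: e_ i + x) * h.
Proof.
move=> h0 wd; pose p (t : R) := w (t *: e_ i + x).
have pd (t : R) : is_derive t 1 p (dw (t *: e_ i + x)).
  have [d1 d2] := wd (t *: e_ i + x).
  have E : (fun u : R => u^-1 *: ((p \o shift t) (u *: (1 : R)) - p t)) =
      (fun u => u^-1 *: ((w \o shift (t *: e_ i + x)) (u *: e_ i) - w (t *: e_ i + x))).
    apply/funext => u /=; rewrite /p; congr (_ *: (w _ - _)).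
    by rewrite [u *: 1]mulr1 scalerDl addrA.
  by apply: DeriveDef; rewrite /derivable /derive E.
have cp : {within `[0, h], continuous p}.
  apply: continuous_subspaceT => t; apply: differentiable_continuous.
  by apply/derivable1_diffP; case: (pd t).
have [c ch E] := MVT h0 (fun t _ => pd t) cp; exists c.
  by move: ch; rewrite in_itv/= => /andP[/ltW -> /ltW ->].
by move: E; rewrite /p scale0r add0r subr0.
Qed.

(** Translation invariance replaces Fubini: difference quotients of [w] have integral 0, and by the
    mean value theorem they converge to [dw] while staying bounded with a common bounded support. *)
Lemma integral_partial_eq0 K w dw i : compact K -> continuous w -> continuous dw ->
  (forall y, is_derive y (e_ i) w (dw y)) ->
  (forall x, ~ K x -> w x = 0) -> (forall x, ~ K x -> dw x = 0) ->
  (\int[mu]_x (dw x)%:E = 0)%E.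
Proof.
move=> cK cw cdw wd w0 dw0.
have [C C0 wC] := compact_support_bounded cK cdw dw0.
have [l l0 Kl] := compact_sub_cube cK.
pose h m : R := m.+1%:R^-1.
have h0 m : 0 < h m by rewrite invr_gt0.
have h1 m : h m <= 1 by rewrite invf_le1// ler1n.
pose D m x := (h m)^-1 * (w (x + h m *: e_ i) - w x).
have wi : mu.-integrable setT (EFin \o w) by exact: compact_support_integrable cK cw w0.
have Di m : mu.-integrable setT (EFin \o D m).
  by apply: integrable_scale => //; apply: integrable_sub => //; exact: integrable_shift.
have D0 m : (\int[mu]_x (D m x)%:E = 0)%E.
  under eq_integral do rewrite /D EFinM EFinB.
  have si := integrable_shift (h m *: e_ i) wi.
  rewrite integralZl//; last exact: integrableB.
  rewrite integralB// integral_shift// subee ?mule0//.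
  exact: integrable_fin_num.
(* The steps [h m] are at most 1, so the difference quotients live on the cube of [K] enlarged by 1
   on each side. *)
pose B : set V := cube (const_mx (- (l + 1))) (2 * (l + 1)).
have DB m x : `|D m x| <= C * \1_B x.
  rewrite /D (addrC x); have [c ch ->] := line_mvt x (h0 m) wd.
  rewrite mulrCA mulVf ?gt_eqF// mulr1.
  have [Bx|Bx] := pselect (B x); first by rewrite indicE mem_set// mulr1.
  rewrite dw0 ?normr0 ?mulr_ge0// => /Kl Kx; apply: Bx => j.
  have := Kx j; rewrite !mxE/=; case/andP: ch => t0 th.
  have /andP[? ?] : 0 <= c * (j == i)%:R <= 1.
    case: (j == i); rewrite ?mulr1 ?mulr0 ?lexx ?ler01//.
    by rewrite t0 (le_trans th).
  move=> /andP[? ?]; apply/andP; split; lra.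
have mB : measurable B by exact: measurable_cube.
have Boo : (mu B < +oo)%E.
  by have /andP[] := @leb_cube_fin R n (const_mx (- (l + 1))) (2 * (l + 1))
    (mulr_gt0 (ltr0n _ 2) (addr_gt0 l0 ltr01)).
have Bi : mu.-integrable setT (EFin \o (fun x => C * \1_B x)).
  apply: integrable_scale => //.
  apply: (bounded_support_integrable (K := B) (C := 1)) => //.
    by move=> x; rewrite indicE ger0_norm// lern1 leq_b1.
  by move=> x Bx; rewrite indicE memNset.
have lim0 x : (D ^~ x) m @[m --> \oo] --> dw x.
  have [d1 d2] := wd x.
  have : (fun u : R => u^-1 *: ((w \o shift x) (u *: e_ i) - w x)) u @[u --> 0^'] --> dw x.
    by rewrite -d2.
  move=> /cvgr_dnbhsP/(_ h); rewrite (_ : (fun m => D m x) =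
    (fun m => (h m)^-1 *: ((w \o shift x) (h m *: e_ i) - w x))); last first.
    by apply/funext => m /=; rewrite /D (addrC x).
  by apply; split=> [m|]; [rewrite gt_eqF|exact: cvg_harmonic].
have limD : {ae mu, forall x, setT x -> (D m x)%:E @[m --> \oo] --> (dw x)%:E}.
  by apply: aeW => x _; apply: cvg_EFin; [exact: nearW|exact: lim0].
have domD : {ae mu, forall x m, setT x -> (`|(D m x)%:E| <= (C * \1_B x)%:E)%E}.
  by apply: aeW => x m _; rewrite lee_fin; exact: DB.
have [_ _] := @dominated_convergence _ _ _ mu setT measurableT
  (fun m x => (D m x)%:E) (EFin \o dw) (EFin \o (fun x => C * \1_B x))
  (fun m => measurable_int _ (Di m))
  (proj2 (measurable_EFinP _ _) (measurable_fun_continuous cdw)) limD Bi domD.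
rewrite (_ : [sequence _]_m = cst 0%E); last by apply/funext => m; exact: D0.
move=> lim; apply: (@cvg_unique _ (@ereal_hausdorff R) _ _ _ _ lim).
exact: cvg_cst.
Qed.
Lemma integral_support O K w : K `<=` O -> (forall x, ~ K x -> w x = 0) ->
  (\int[mu]_(x in O) (w x)%:E = \int[mu]_x (w x)%:E)%E.
Proof.
move=> KO w0; rewrite integral_mkcond; apply: eq_integral => x _ /=.
rewrite patchE; case: ifPn => // xO; rewrite w0// => /KO Ox.
by move: xO; rewrite mem_set.
Qed.

Lemma partial_support K w i : closed K -> (forall x, ~ K x -> w x = 0) ->
  forall x, ~ K x -> partial i w x = 0.
Proof.
move=> cK w0 x Kx; rewrite /partial.
have wx : \near x, w x = cst 0 x.
  exact: (near_open_eq (closed_openC cK) Kx).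
by rewrite (near_eq_derive _ wx) derive_cst.
Qed.

Lemma compact_closed_row K : compact K -> closed K.
Proof. by apply: compact_closed; exact: norm_hausdorff. Qed.

(** The function [g] may behave badly near the boundary of [O], but its product with a test function
    extends by 0 to the whole space, where [integral_partial_eq0] applies to it. *)
Lemma smooth_weak_partial O g i : open O -> smooth O g ->
  is_weak_partial O i g (partial i g).
Proof.
move=> oO sg phi [sphi [K [cK KO phi0]]].
have clK := compact_closed_row cK.
have dphi0 := partial_support i clK phi0.
have sphiO : smooth O phi by exact: sub_smooth sphi.
have cA : continuous (fun x => g x * partial i phi x).
  apply: (continuous_support clK) => x Kx; last by rewrite dphi0 ?mulr0.
  apply: continuousM; first exact: smooth_continuous sg _ (KO _ Kx).
  exact: smooth_continuous (smooth_partial i sphiO) _ (KO _ Kx).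
have cB : continuous (fun x => partial i g x * phi x).
  apply: (continuous_support clK) => x Kx; last by rewrite phi0 ?mulr0.
  apply: continuousM; first exact: smooth_continuous (smooth_partial i sg) _ (KO _ Kx).
  exact: smooth_continuous sphiO _ (KO _ Kx).
have cW : continuous (fun x => g x * phi x).
  apply: (continuous_support clK) => x Kx; last by rewrite phi0 ?mulr0.
  apply: continuousM; first exact: smooth_continuous sg _ (KO _ Kx).
  exact: smooth_continuous sphiO _ (KO _ Kx).
have A0 x : ~ K x -> g x * partial i phi x = 0 by move=> /dphi0 ->; rewrite mulr0.
have B0 x : ~ K x -> partial i g x * phi x = 0 by move=> /phi0 ->; rewrite mulr0.
have Ai := compact_support_integrable cK cA A0.
have Bi := compact_support_integrable cK cB B0.
have wd y : is_derive y (e_ i) (fun x => g x * phi x)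
    (g y * partial i phi y + partial i g y * phi y).
  have [Ky|Ky] := pselect (K y).
    apply: (is_derive_eq (is_deriveM (smooth_is_derive i sg (KO _ Ky))
      (smooth_is_derive i sphiO (KO _ Ky)))).
    by rewrite /GRing.scale/= (mulrC (phi y)).
  rewrite A0// B0// addr0; apply: (@near_eq_is_derive _ _ _ (cst 0)).
    by apply: (near_open_eq (closed_openC clK) Ky) => z /phi0 ->; rewrite mulr0.
have cD : continuous (fun x => g x * partial i phi x + partial i g x * phi x).
  by move=> y; exact: (continuousD (cA y) (cB y)).
have W0 x : ~ K x -> g x * phi x = 0 by move=> /phi0 ->; rewrite mulr0.
have D0 x : ~ K x -> g x * partial i phi x + partial i g x * phi x = 0.
  by move=> Kx; rewrite A0// B0// addr0.
have := integral_partial_eq0 cK cW cD wd W0 D0.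
rewrite (integral_support KO A0) (integral_support KO B0).
under eq_integral do rewrite EFinD.
rewrite integralD//.
rewrite -(fineK (integrable_fin_num measurableT Ai)) -(fineK (integrable_fin_num measurableT Bi)).
by rewrite -EFinD => -[/eqP]; rewrite addr_eq0 => /eqP ->; rewrite EFinN.
Qed.

Lemma continuous_L1loc O w : open O -> (forall x, O x -> {for x, continuous w}) ->
  L1loc O w.
Proof.
move=> oO cw; split; first exact: measurable_continuous.
move=> K KO cK.
have : compact (w @` K).
  apply: continuous_compact => //; apply: continuous_in_subspaceT => x.
  by rewrite inE => /KO; exact: cw.
move=> /compact_bounded[C [_ hC]].
have wC x : K x -> `|w x| <= `|C| + 1.
  by move=> Kx; apply: hC; [rewrite (le_lt_trans (ler_norm C))// ltrDl|exists x].
have mK := measurable_compact cK.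
have mw : measurable_fun K w.
  apply: (measurable_funS _ KO); first exact: measurable_open.
  exact: measurable_continuous.
apply: (@le_lt_trans _ _ (\int[mu]_(x in K) (`|C| + 1)%:E)%E).
  apply: ge0_le_integral => //.
  by apply/measurable_EFinP; exact: measurableT_comp.
rewrite integral_cst//; by apply: lte_mul_pinfty => //; exact: compact_leb_fin.
Qed.

End smooth_algebra.

(** * Euclidean and operator norms *)

Section enorm_theory.
Context {R : realType}.

Lemma enorm_ge0 m n (M : 'M[R]_(m, n)) : 0 <= enorm M.
Proof. exact: sqrtr_ge0. Qed.

Lemma coord_enorm_le m n (M : 'M[R]_(m, n)) i j : `|M i j| <= enorm M.
Proof.
rewrite -sqrtr_sqr /enorm ler_sqrt.
  rewrite (bigD1 i)//= (bigD1 j)//= -addrA lerDl addr_ge0//.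
    by apply: sumr_ge0 => k _; exact: sqr_ge0.
  by apply: sumr_ge0 => k _; apply: sumr_ge0 => l _; exact: sqr_ge0.
by apply: sumr_ge0 => k _; apply: sumr_ge0 => l _; exact: sqr_ge0.
Qed.

Lemma sum_sqr_le (I : finType) (a : I -> R) : (forall i, 0 <= a i) ->
  \sum_i a i ^+ 2 <= (\sum_i a i) ^+ 2.
Proof.
move=> a0; rewrite expr2 mulr_suml; apply: ler_sum => i _.
rewrite expr2 ler_wpM2l// (bigD1 i)//= lerDl.
by apply: sumr_ge0 => k _.
Qed.

Lemma enorm_le_sum m n (M : 'M[R]_(m, n)) : enorm M <= \sum_i \sum_j `|M i j|.
Proof.
have S0 : 0 <= \sum_i \sum_j `|M i j| by apply: sumr_ge0 => k _; exact: sumr_ge0.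
rewrite -[leRHS]ger0_norm// -sqrtr_sqr ler_sqrt ?sqr_ge0//.
apply: (@le_trans _ _ (\sum_i (\sum_j `|M i j|) ^+ 2)).
  apply: ler_sum => i _; apply: le_trans (sum_sqr_le _) => //.
  by apply: ler_sum => j _; rewrite real_normK// num_real.
by apply: sum_sqr_le => i; exact: sumr_ge0.
Qed.

Lemma enormZ m n (c : R) (M : 'M[R]_(m, n)) : enorm (c *: M) = `|c| * enorm M.
Proof.
rewrite /enorm; under eq_bigr => i _ do under eq_bigr => j _ do rewrite mxE exprMn.
under eq_bigr do rewrite -mulr_sumr.
by rewrite -mulr_sumr sqrtrM ?sqr_ge0// sqrtr_sqr.
Qed.

Lemma enorm0 m n : enorm (0 : 'M[R]_(m, n)) = 0.
Proof. by rewrite -(scale0r 0) enormZ normr0 mul0r. Qed.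

Lemma enorm_eq0 m n (M : 'M[R]_(m, n)) : enorm M = 0 -> M = 0.
Proof.
move=> M0; apply/matrixP => i j; rewrite mxE; apply/eqP.
by rewrite -normr_eq0 eq_le normr_ge0 andbT -M0 coord_enorm_le.
Qed.

Lemma enormN m n (M : 'M[R]_(m, n)) : enorm (- M) = enorm M.
Proof. by rewrite -scaleN1r enormZ normrN1 mul1r. Qed.

Lemma sum_const_ord n (c : R) : n.+1%:R * c = \sum_(i < n.+1) c.
Proof. by rewrite sumr_const card_ord mulr_natl. Qed.

(* The factor is crude: only the order of magnitude of constants matters. *)
Lemma enorm_sum_le n I (r : seq I) (F : I -> 'cV[R]_n.+1) :
  enorm (\sum_(k <- r) F k) <= n.+1%:R * \sum_(k <- r) enorm (F k).
Proof.
apply: le_trans (enorm_le_sum _) _.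
rewrite sum_const_ord; apply: ler_sum => i _.
rewrite big_ord1 summxE; apply: le_trans (ler_norm_sum _ _ _) _.
by apply: ler_sum => k _; exact: coord_enorm_le.
Qed.

Lemma enorm_le_const n (u : 'cV[R]_n.+1) (c : R) : (forall i, `|u i 0| <= c) ->
  enorm u <= n.+1%:R * c.
Proof.
move=> uc; apply: le_trans (enorm_le_sum _) _.
rewrite sum_const_ord; apply: ler_sum => i _.
by rewrite big_ord1.
Qed.

Lemma enorm_mulmx_le n (M : 'M[R]_n.+1) (u : 'cV[R]_n.+1) :
  enorm (M *m u) <= n.+1%:R * (n.+1%:R * (enorm M * enorm u)).
Proof.
apply: enorm_le_const => i; rewrite mxE; apply: le_trans (ler_norm_sum _ _ _) _.
rewrite sum_const_ord; apply: ler_sum => j _.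
by rewrite normrM ler_pM// coord_enorm_le.
Qed.

Lemma mulmx_col_sum n (M : 'M[R]_n.+1) (u : 'cV[R]_n.+1) :
  M *m u = \sum_j u j 0 *: (M *m delta_mx j 0).
Proof.
rewrite {1}(matrix_sum_delta u) mulmx_sumr; apply: eq_bigr => j _.
by rewrite big_ord1 scalemxAr.
Qed.

Lemma has_sup_opnorm n (M : 'M[R]_n.+1) :
  has_sup [set enorm (M *m u) | u in [set u : 'cV[R]_n.+1 | enorm u <= 1]].
Proof.
split; first by exists 0, 0; rewrite /= ?enorm0// mulmx0 enorm0.
exists (n.+1%:R * (n.+1%:R * (enorm M * 1))) => _ [u /= u1 <-].
apply: le_trans (enorm_mulmx_le _ _) _.
by rewrite !ler_wpM2l// ?enorm_ge0.
Qed.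

Lemma enorm_mulmx_opnorm n (M : 'M[R]_n.+1) (u : 'cV[R]_n.+1) :
  enorm (M *m u) <= opnorm M * enorm u.
Proof.
have [/enorm_eq0 ->|u0] := eqVneq (enorm u) 0; first by rewrite mulmx0 !enorm0 mulr0.
have u1 : 0 < enorm u by rewrite lt0r u0 enorm_ge0.
rewrite -ler_pdivrMr//.
have <- : enorm (M *m ((enorm u)^-1 *: u)) = enorm (M *m u) / enorm u.
  by rewrite -scalemxAr enormZ ger0_norm ?invr_ge0 ?enorm_ge0// mulrC.
apply: ub_le_sup; first by case: (has_sup_opnorm M).
exists ((enorm u)^-1 *: u) => //=.
by rewrite enormZ ger0_norm ?invr_ge0 ?enorm_ge0// mulVf.
Qed.

Lemma opnorm_ge0 n (M : 'M[R]_n.+1) : 0 <= opnorm M.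
Proof.
apply: ub_le_sup; first by case: (has_sup_opnorm M).
by exists 0; rewrite /= ?enorm0// mulmx0 enorm0.
Qed.

Lemma enorm_delta n (j : 'I_n.+1) : enorm (delta_mx j 0 : 'cV[R]_n.+1) = 1.
Proof.
rewrite /enorm (bigD1 j)//= [X in _ + X]big1 => [|i ij].
  by rewrite big_ord1 !mxE !eqxx expr1n addr0 sqrtr1.
by rewrite big_ord1 !mxE (negbTE ij) expr0n.
Qed.

Lemma enorm_col_opnorm n (M : 'M[R]_n.+1) j :
  enorm (M *m (delta_mx j 0 : 'cV[R]_n.+1)) <= opnorm M.
Proof. by have := enorm_mulmx_opnorm M (delta_mx j 0); rewrite enorm_delta mulr1. Qed.

(** Converse to [enorm_col_opnorm] up to a constant: bounds with the scalar weight |W|_op follow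
    from bounds for W applied to basis vectors. *)
Lemma opnorm_le_cols n (M : 'M[R]_n.+1) :
  opnorm M <= n.+1%:R * \sum_j enorm (M *m (delta_mx j 0 : 'cV[R]_n.+1)).
Proof.
apply: ge_sup; first by case: (has_sup_opnorm M).
move=> _ [u /= u1 <-]; rewrite mulmx_col_sum; apply: le_trans (enorm_sum_le _ _) _.
rewrite ler_wpM2l//; apply: ler_sum => j _; rewrite enormZ ler_piMl ?enorm_ge0//.
exact: le_trans (coord_enorm_le _ _ _) u1.
Qed.

End enorm_theory.

Section powR_extra.
Context {R : realType}.
Implicit Types (a b c q P : R).

Lemma le_powR_l q a b : 0 <= q -> 0 <= a -> a <= b -> a `^ q <= b `^ q.
Proof. by move=> q0 a0 ab; rewrite ge0_ler_powR// nnegrE// (le_trans a0). Qed.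

Lemma powR_const_le q P c a : 1 <= c -> 0 <= a -> q <= P -> (c * a) `^ q <= c `^ P * a `^ q.
Proof.
move=> c1 a0 qP; rewrite powRM// ?(le_trans ler01)//.
by rewrite ler_wpM2r ?powR_ge0// ler_powR.
Qed.

(* Each weighted term [c k * a k] is at most the [1/q]-th power of the right-hand
   side, and the weights [(c k)^-1] sum to at most 1. *)
Lemma powR_weighted_sum q m (a c : nat -> R) : 1 <= q ->
  (forall k, 0 <= a k) -> (forall k, 0 < c k) -> \sum_(k < m) (c k)^-1 <= 1 ->
  (\sum_(k < m) a k) `^ q <= \sum_(k < m) (c k * a k) `^ q.
Proof.
move=> q1 a0 c0 c1; set S := (X in _ <= X).
have q0 : 0 < q by exact: lt_le_trans q1.
have S0 : 0 <= S by apply: sumr_ge0 => k _; exact: powR_ge0.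
have aS (k : 'I_m) : a k <= S `^ q^-1 * (c k)^-1.
  have ca0 : 0 <= c k * a k by rewrite mulr_ge0// ltW.
  rewrite ler_pdivlMr// mulrC.
  have -> : c k * a k = ((c k * a k) `^ q) `^ q^-1.
    by rewrite -powRrM divff ?gt_eqF// powRr1.
  apply: le_powR_l; [by rewrite invr_ge0 ltW|exact: powR_ge0|].
  rewrite /S (bigD1 k)//= lerDl; apply: sumr_ge0 => j _; exact: powR_ge0.
apply: (@le_trans _ _ ((S `^ q^-1) `^ q)).
  apply: le_powR_l; [exact: ltW|exact: sumr_ge0|].
  apply: le_trans (ler_sum _ (fun k _ => aS k)) _.
  by rewrite -mulr_sumr ler_piMr// powR_ge0.
by rewrite -powRrM mulVf ?gt_eqF// powRr1.
Qed.

End powR_extra.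

(** * Mollification over lower-left cubes *)

Section mollifier.
Context {R : realType} {n : nat}.
Notation V := 'rV[R]_n.+1.
Notation mu := (@leb R n).
Implicit Types (f g : V -> R) (d : R).
Notation e_ i := (delta_mx 0 i : V).

Definition kern d (z : V) : R := mbump (fun=> (1, 0%N)) (d^-1 *: z).

(* The kernel lives on the lower-left cube: [kern d (x - y) != 0] forces
   [x - d < y < x] coordinatewise. *)
Definition lower_cube d (x : V) : set V := [set y | forall i, x 0 i - d < y 0 i < x 0 i].

Lemma kern_ge0 d z : 0 <= kern d z.
Proof. by apply: prodr_ge0 => i _; exact: bump1_ge0. Qed.

Lemma kern_bounded_lipschitz d : bounded_lipschitz (kern d).
Proof. exact: mbump_scale_bounded_lipschitz. Qed.

Lemma kern_le : exists2 C : R, 0 < C & forall d z, kern d z <= C.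
Proof.
have [C C0 kC] := @mbump_bounded_lipschitz R n (fun=> (1, 0%N)).
exists (C + 1); first by rewrite ltr_wpDl.
move=> d z; have [h _] := kC (d^-1 *: z) 0.
by apply: le_trans (ler_norm _) _; apply: le_trans h _; rewrite lerDl.
Qed.

Lemma kern_out d (x y : V) : 0 < d -> ~ lower_cube d x y -> kern d (x - y) = 0.
Proof.
move=> d0 xy; have /existsNP[i hi] : ~ forall i, x 0 i - d < y 0 i < x 0 i by [].
rewrite /kern /mbump (bigD1 i)//= bump1_out ?mul0r//.
apply/negP => /andP[h1 h2]; apply: hi; move: h1 h2; rewrite !mxE.
rewrite pmulr_rgt0 ?invr_gt0// ltr_pdivrMl// mulr1 => h1 h2.
by apply/andP; split; lra.
Qed.

Lemma lower_cube_sub d (x : V) : lower_cube d x `<=` cube (\row_i (x 0 i - d)) d.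
Proof. by move=> y xy i; have /andP[h1 h2] := xy i; rewrite mxE; apply/andP; split; lra. Qed.

Lemma measurable_kern d x : measurable_fun setT (fun y : V => kern d (x - y)).
Proof. by apply: measurable_reflect; exact/bounded_lipschitz_continuous/kern_bounded_lipschitz. Qed.

Lemma kern_integrable d (x : V) : 0 < d ->
  mu.-integrable setT (EFin \o (fun y => kern d (x - y))).
Proof.
move=> d0; have [C C0 kC] := kern_le.
apply: (@bounded_support_integrable _ _ (cube (\row_i (x 0 i - d)) d) _ C).
- exact: measurable_cube.
- by have /andP[] := @leb_cube_fin R n (\row_i (x 0 i - d)) d d0.
- exact: measurable_kern.
- by move=> y; rewrite ger0_norm ?kern_ge0.
- by move=> y xy; apply: kern_out => // /lower_cube_sub.
Qed.

Definition mass d : R := \int[mu]_y kern d (0 - y).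

Lemma massE d (x : V) : 0 < d -> \int[mu]_y kern d (x - y) = mass d.
Proof.
move=> d0; rewrite /mass /Rintegral.
have <- := @integral_shift _ _ (fun y => kern d (0 - y)) (- x) (kern_integrable 0 d0).
by apply: f_equal; apply: eq_integral => y _; rewrite sub0r opprB.
Qed.

(** Only the order of magnitude of the mass matters, so it is bounded below on a subcube where every
    factor of the kernel is bounded below, without a change of variables. *)
Lemma mass_ge : exists2 c : R, 0 < c & forall d, 0 < d -> c * d ^+ n.+1 <= mass d.
Proof.
have [k k0 hk] := @bump1_gt0 R.
exists ((k / 2) ^+ n.+1); first by rewrite exprn_gt0// divr_gt0.
(* The kernel is evaluated at -y, so the coordinates of -y/d range over [1/4, 3/4] when y ranges
   over this cube of side d/2. *)
move=> d d0; set a : V := const_mx (- (3 / 4 * d)).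
have d2 : 0 < d / 2 by rewrite divr_gt0.
have -> : (k / 2) ^+ n.+1 * d ^+ n.+1 = k ^+ n.+1 * (d / 2) ^+ n.+1.
  by rewrite -!exprMn; congr (_ ^+ _); ring.
rewrite -lee_fin /mass fineK; last first.
  by apply: integrable_fin_num => //; exact: kern_integrable.
have mQ : measurable (cube a (d / 2)) by exact: measurable_cube.
rewrite EFinM; apply: (@le_trans _ _ ((k ^+ n.+1)%:E * mu (cube a (d / 2)))%E).
  by apply: lee_wpmul2l; [rewrite lee_fin exprn_ge0// ltW|exact: leb_cube_ge].
rewrite -integral_cst//.
apply: (@le_trans _ _ (\int[mu]_(y in cube a (d / 2)) (kern d (0 - y))%:E)%E); last first.
  apply: ge0_subset_integral => //; last by move=> y _; rewrite lee_fin kern_ge0.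
  by apply/measurable_EFinP; exact: measurable_kern.
apply: ge0_le_integral => //.
- by move=> y _; rewrite lee_fin exprn_ge0// ltW.
- by apply/measurable_EFinP; apply: measurable_funTS; exact: measurable_kern.
- move=> y ay; rewrite lee_fin /kern /mbump -[n.+1 in leLHS]card_ord -prodr_const.
  apply: ler_prod => i _; rewrite (ltW k0)/=; apply: hk; have := ay i.
  rewrite !mxE sub0r => /andP[h1 h2].
  by rewrite ler_pdivlMl// ler_pdivrMl//; apply/andP; split; lra.
Qed.

Lemma mass_gt0 d : 0 < d -> 0 < mass d.
Proof.
move=> d0; have [c c0 hc] := mass_ge.
by apply: lt_le_trans (hc d d0); rewrite mulr_gt0// exprn_gt0.
Qed.

Definition moll d f (x : V) : R := (mass d)^-1 * convol f (kern d) x.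

Lemma moll_integrable d f x : mu.-integrable setT (EFin \o f) ->
  mu.-integrable setT (EFin \o (fun y => f y * kern d (x - y))).
Proof. by move=> fi; apply: convol_integrable => //; exact: kern_bounded_lipschitz. Qed.

Lemma smooth_moll d f : mu.-integrable setT (EFin \o f) -> smooth setT (moll d f).
Proof. exact: smooth_convol. Qed.

Lemma mollB d f g x : mu.-integrable setT (EFin \o f) -> mu.-integrable setT (EFin \o g) ->
  moll d (fun y => f y - g y) x = moll d f x - moll d g x.
Proof.
move=> fi gi; rewrite /moll -mulrBr /convol -RintegralB//; [|exact: moll_integrable..].
by congr (_ * _); apply: eq_Rintegral => y _; rewrite mulrBl.
Qed.

Lemma mollZ d f c x : mu.-integrable setT (EFin \o f) ->
  moll d (fun y => c * f y) x = c * moll d f x.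
Proof.
move=> fi; rewrite /moll mulrCA /convol -(RintegralZl c measurableT (moll_integrable d x fi)).
by congr (_ * _); apply: eq_Rintegral => y _; rewrite mulrA.
Qed.

Lemma eq_moll d f g x : (forall y, f y = g y) -> moll d f x = moll d g x.
Proof. by move=> /funext ->. Qed.

Lemma moll0 d x : moll d (fun=> 0) x = 0.
Proof. by rewrite /moll /convol; under eq_Rintegral do rewrite mul0r; rewrite Rintegral_cst// mul0r mulr0. Qed.

Lemma moll_sum d m (F : 'I_m -> V -> R) x :
  (forall k, mu.-integrable setT (EFin \o F k)) ->
  moll d (fun y => \sum_k F k y) x = \sum_k moll d (F k) x.
Proof.
move=> Fi; elim: m F Fi => [|m IH] F Fi.
  by rewrite big_ord0 -[RHS](moll0 d x); apply: eq_moll => y; rewrite big_ord0.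
rewrite big_ord_recl/= -IH//.
have Si : mu.-integrable setT (EFin \o (fun y => \sum_(i < m) F (lift ord0 i) y)).
  rewrite (_ : EFin \o _ = (fun y => (\sum_(i < m) (F (lift ord0 i) y)%:E)%E)).
    by apply: integrable_sum => // i _; exact: Fi.
  by apply/funext => y; rewrite /= sumEFin.
rewrite /moll -mulrDr /convol -RintegralD//; [|exact: moll_integrable..].
by congr (_ * _); apply: eq_Rintegral => y _; rewrite big_ord_recl mulrDl.
Qed.

Lemma eq_lower_moll d f g x : 0 < d -> (forall y, lower_cube d x y -> f y = g y) ->
  moll d f x = moll d g x.
Proof.
move=> d0 fg; congr (_ * _); apply: eq_Rintegral => y _.
by have [/fg ->//|/kern_out ->//] := pselect (lower_cube d x y); rewrite !mulr0.
Qed.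

Lemma moll_cst d c x : 0 < d -> moll d (fun=> c) x = c.
Proof.
move=> d0; rewrite /moll /convol RintegralZl ?massE//; last exact: kern_integrable.
by rewrite mulrCA mulVf ?mulr1// gt_eqF// mass_gt0.
Qed.

Lemma moll_const d f c x : 0 < d -> (forall y, lower_cube d x y -> f y = c) ->
  moll d f x = c.
Proof. by move=> d0 fc; rewrite (eq_lower_moll d0 fc) moll_cst. Qed.

Lemma moll_range d f x : 0 < d -> mu.-integrable setT (EFin \o f) ->
  (forall y, 0 <= f y <= 1) -> 0 <= moll d f x <= 1.
Proof.
move=> d0 fi f01; apply/andP; split.
  rewrite mulr_ge0 ?invr_ge0 ?(ltW (mass_gt0 d0))//; apply: Rintegral_ge0 => y _.
  by rewrite mulr_ge0 ?kern_ge0//; case/andP: (f01 y).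
rewrite -[leRHS](moll_cst 1 x d0) ler_wpM2l ?invr_ge0 ?(ltW (mass_gt0 d0))//.
apply: le_Rintegral => //.
- exact: moll_integrable.
- have := kern_integrable x d0; congr (integrable _ _ _).
  by apply/funext => y; rewrite /= mul1r.
- by move=> y _; rewrite ler_wpM2r ?kern_ge0//; case/andP: (f01 y).
Qed.

(** The kernel is bounded, vanishes off [lower_cube d x], and has mass of order d^(n+1). The set [Q]
    is left free so that one grid cube can serve for many points x. *)
Lemma moll_abs_le : exists2 C : R, 0 < C & forall d f x (Q : set V), 0 < d ->
  mu.-integrable setT (EFin \o f) -> measurable Q -> lower_cube d x `<=` Q ->
  (`|moll d f x|%:E <= (C / d ^+ n.+1)%:E * \int[mu]_(y in Q) `|f y|%:E)%E.
Proof.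
have [C C0 kC] := kern_le; have [c c0 mc] := mass_ge.
exists (C / c); first exact: divr_gt0.
move=> d f x Q d0 fi mQ xQ.
have m0 := mass_gt0 d0.
have absi : mu.-integrable setT (EFin \o (fun y => `|f y|)) by exact: (integrable_abse fi).
have mf : measurable_fun setT f by exact/measurable_EFinP/(measurable_int _ fi).
rewrite /moll normrM EFinM (ger0_norm (ltW _)) ?invr_gt0//.
rewrite EFin_normr_Rintegral//; last exact: moll_integrable.
apply: (@le_trans _ _ ((mass d)^-1%:E * (C%:E * \int[mu]_(y in Q) `|f y|%:E))%E).
  apply: lee_wpmul2l; first by rewrite lee_fin invr_ge0 ltW.
  pose w y := `|f y * kern d (x - y)|.
  have fki := measurable_int _ (moll_integrable d x fi).
  have mabs (g : V -> R) : measurable_fun setT g -> measurable_fun Q (fun y => `|g y|).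
    move=> mg; apply: measurable_funTS.
    exact: (measurableT_comp (@normr_measurable R setT) mg).
  apply: le_trans (le_abse_integral mu measurableT fki) _.
  have w0 y : ~ Q y -> w y = 0.
    by move=> yQ; rewrite /w kern_out ?mulr0 ?normr0// => /xQ.
  rewrite -(integral_support (@subset_refl _ Q) w0).
  rewrite -(int_scale mQ (mabs _ mf) (fun y _ => normr_ge0 (f y)) (ltW C0)).
  have /measurable_EFinP mfk := fki.
  apply: (le_int mQ (mabs _ mfk) (measurable_funM (measurable_cst _) (mabs _ mf))).
  move=> y _; rewrite normr_ge0 /w normrM mulrC; split=> //.
  by rewrite ler_wpM2r// ger0_norm ?kern_ge0.
rewrite muleA -EFinM; apply: lee_wpmul2r.
  by apply: integral_ge0 => y _; rewrite lee_fin.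
rewrite lee_fin mulrC -mulrA ler_wpM2l ?(ltW C0)//.
by rewrite -invfM lef_pV2 ?posrE// ?mulr_gt0// ?exprn_gt0// mc.
Qed.

(** The derivative of the convolution falls on the kernel, and differentiating kern(x - y) in y
    instead of x changes the sign. The second hypothesis is the weak derivative tested on this one
    kernel. *)
Lemma moll_partial d f g i x : mu.-integrable setT (EFin \o f) ->
  (\int[mu]_y (f y * partial i (fun y => kern d (x - y)) y) =
    - (\int[mu]_y (g y * kern d (x - y)))) ->
  partial i (moll d f) x = moll d g x.
Proof.
move=> fi fg.
have der := is_deriveZ (mass d)^-1 (convol_mbump_is_derive (fun=> (1, 0%N)) d^-1 i x fi).
rewrite /partial (@derive_val _ _ _ _ _ _ _ der) /moll; congr (_ * _).
rewrite -[RHS]opprK -fg /convol.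
have E : (fun y => f y * partial i (fun y => kern d (x - y)) y) = (fun y => - d^-1 *
    (f y * mbump (dmbump i (fun=> (1, 0%N))) (d^-1 *: (x - y)))).
  apply/funext => y.
  by rewrite /partial (@derive_val _ _ _ _ _ _ _ (kernel_is_derive _ _ _ _ _)); ring.
have ki := convol_integrable x fi
  (mbump_scale_bounded_lipschitz (dmbump i (fun=> (1, 0%N))) d^-1).
by rewrite E (RintegralZl _ measurableT ki) mulNr opprK.
Qed.

End mollifier.

Section measurability.
Context {R : realType} {n : nat}.
Notation V := 'rV[R]_n.+1.
Implicit Types (D : set V).

(** Since [powR] tests whether its base is 0, the two branches are measured separately. *)
Lemma measurable_powR2 D (f g : V -> R) : measurable D -> measurable_fun D f ->
  measurable_fun D g -> measurable_fun D (fun x => f x `^ g x).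
Proof.
move=> mD mf mg; have mlnf := measurableT_comp (@measurable_ln R) mf.
have me := measurableT_comp (@measurable_expR R) (measurable_funM mg mlnf).
have mf0 := measurable_fun_eqr mf (measurable_cst (0 : R)).
have mg0 := measurable_fun_eqr mg (measurable_cst (0 : R)).
have mD0 : measurable (D `&` (fun x => f x == 0) @^-1` [set true]).
  exact: (mf0 mD _ (I : measurable [set true])).
have mD1 : measurable (D `&` (fun x => f x == 0) @^-1` [set false]).
  exact: (mf0 mD _ (I : measurable [set false])).
apply: (measurable_fun_if mD mf0); last exact: (measurable_funS mD (@subIsetl _ D _) me).
have -> : (fun x => (g x == 0)%:R) = (fun x => if g x == 0 then 1 else 0 : R).
  by apply/funext => x; case: (g x == 0).
apply: (measurable_fun_if mD0 (measurable_funS mD (@subIsetl _ D _) mg0));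
  exact: measurable_cst.
Qed.

Lemma measurable_enorm D m k (M : V -> 'M[R]_(m, k)) :
  (forall i j, measurable_fun D (fun x => M x i j)) ->
  measurable_fun D (fun x => enorm (M x)).
Proof.
move=> mM.
have E x : enorm (M x) = (\sum_i \sum_j M x i j ^+ 2) `^ 2^-1.
  rewrite powR12_sqrt//; apply: sumr_ge0 => i _; apply: sumr_ge0 => j _.
  exact: sqr_ge0.
under eq_fun do rewrite E.
apply: (measurableT_comp (measurable_powR _)).
apply: measurable_sum => i; apply: measurable_sum => j.
exact: measurable_funX.
Qed.

Lemma measurable_mulmx D (M : V -> 'M[R]_n.+1) (F : V -> 'cV[R]_n.+1) :
  (forall i j, measurable_fun D (fun x => M x i j)) ->
  (forall i, measurable_fun D (fun x => F x i 0)) ->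
  measurable_fun D (fun x => enorm (M x *m F x)).
Proof.
move=> mM mF; apply: measurable_enorm => i j; rewrite (ord1 j).
under eq_fun do rewrite mxE.
by apply: measurable_sum => k; exact: (measurable_funM (mM i k) (mF k)).
Qed.

End measurability.

(** Write tau^(q/rho) = tau * exp((1 - q/rho) (- ln tau)). The exponent is nonnegative, and since -
    ln tau <= M (- ln d) it is at most M (rho - q) (- ln d) <= 2 M L. This is where log-Holder
    continuity turns scaling of the norm into scaling of the modular, uniformly in d. *)
Lemma scale_exponent (R : realType) (tau d rho q L : R) (M : nat) :
  0 < d < 1 -> d ^+ M <= tau <= 1 -> 1 <= rho -> q <= rho ->
  (rho - q) * - ln d <= 2 * L ->
  tau <= (tau `^ rho^-1) `^ q /\
  (tau `^ rho^-1) `^ q <= expR (2 * M%:R * L) * tau.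
Proof.
move=> /andP[d0 d1] /andP[dt t1] r1 qr LL.
have t0 : 0 < tau by apply: lt_le_trans dt; rewrite exprn_gt0.
have lt0 : ln tau <= 0 by rewrite -ln1 ler_ln// posrE.
have r0 : 0 < rho by exact: lt_le_trans r1.
have qrho : rho^-1 * q <= 1 by rewrite mulrC ler_pdivrMr// mul1r.
rewrite -powRrM /powR gt_eqF//; split.
  rewrite -[leLHS](lnK (x := tau)) ?posrE// ler_expR -[leLHS]mul1r.
  by rewrite ler_wnM2r.
rewrite -[X in _ <= _ * X](lnK (x := tau)) ?posrE// -expRD ler_expR.
have Md : - ln tau <= M%:R * - ln d.
  rewrite mulrN lerN2 mulr_natl -lnXn// ler_ln ?posrE ?exprn_gt0//.
have rq : (1 - rho^-1 * q) * - ln tau <= (rho - q) * (M%:R * - ln d).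
  apply: ler_pM => //; [lra|lra|].
  have -> : 1 - rho^-1 * q = rho^-1 * (rho - q) by field; rewrite gt_eqF.
  by rewrite ler_piMl ?subr_ge0// invf_le1.
have := ler_wpM2l (ler0n R M) LL.
have -> : M%:R * ((rho - q) * - ln d) = (rho - q) * (M%:R * - ln d) by ring.
move=> h; have := le_trans rq h; rewrite !mulrN; lra.
Qed.

(** * Modular bounds for mollification *)

Section vector_mollifier.
Context {R : realType} {n : nat}.
Notation V := 'rV[R]_n.+1.
Notation mu := (@leb R n).
Implicit Types (F G : V -> 'cV[R]_n.+1) (M : 'M[R]_n.+1) (d : R).

Definition vintegrable F := forall i, mu.-integrable setT (EFin \o (fun y => F y i 0)).

Definition mollv d F (x : V) : 'cV[R]_n.+1 := \col_i moll d (fun y => F y i 0) x.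

Lemma vintegrable_mulmx M F : vintegrable F -> vintegrable (fun y => M *m F y).
Proof.
move=> Fi i; rewrite (_ : EFin \o _ = (fun y => (\sum_j (M i j * F y j 0)%:E)%E)).
  by apply: integrable_sum => // j _; apply: integrable_scale.
by apply/funext => y; rewrite /= mxE sumEFin.
Qed.

Lemma mulmx_mollv M d F x i : vintegrable F ->
  (M *m mollv d F x) i 0 = moll d (fun y => (M *m F y) i 0) x.
Proof.
move=> Fi; rewrite mxE.
transitivity (moll d (fun y => \sum_j M i j * F y j 0) x).
  rewrite moll_sum; last by move=> j; apply: integrable_scale.
  by apply: eq_bigr => j _; rewrite mxE mollZ.
by apply: eq_moll => y; rewrite mxE.
Qed.

Lemma mollvB d F G x : vintegrable F -> vintegrable G ->
  mollv d (fun y => F y - G y) x = mollv d F x - mollv d G x.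
Proof.
move=> Fi Gi; apply/matrixP => i j; rewrite !mxE -mollB//.
by apply: eq_moll => y; rewrite !mxE.
Qed.

(** A constant matrix commutes with mollification. It is later frozen at [M = W x], which produces
    the mixed quantity |W(x) F(y)| controlled by A_p. *)
Lemma enorm_mollv_le : exists2 C : R, 0 < C & forall d M F x (Q : set V), 0 < d ->
  vintegrable F -> measurable Q -> lower_cube d x `<=` Q ->
  ((enorm (M *m mollv d F x))%:E <=
     (C / d ^+ n.+1)%:E * \int[mu]_(y in Q) (enorm (M *m F y))%:E)%E.
Proof.
have [C C0 hC] := @moll_abs_le R n.
exists (n.+1%:R * C); first by rewrite mulr_gt0.
move=> d M F x Q d0 Fi mQ xQ.
have MFi := vintegrable_mulmx M Fi.
have mMF i : measurable_fun setT (fun y => (M *m F y) i 0).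
  exact/measurable_EFinP/(measurable_int _ (MFi i)).
have mE : measurable_fun Q (fun y => enorm (M *m F y)).
  apply: measurable_enorm => i j; rewrite (ord1 j).
  exact: measurable_funTS.
have K i : (`|(M *m mollv d F x) i 0|%:E <=
    (C / d ^+ n.+1)%:E * \int[mu]_(y in Q) (enorm (M *m F y))%:E)%E.
  rewrite mulmx_mollv//; apply: le_trans (hC _ _ _ _ d0 (MFi i) mQ xQ) _.
  apply: lee_wpmul2l; first by rewrite lee_fin divr_ge0// ?(ltW C0)// exprn_ge0// ltW.
  apply: (le_int mQ _ mE) => [|y _]; last by rewrite coord_enorm_le.
  exact: (measurableT_comp (@normr_measurable R setT) (measurable_funTS (mMF i))).
rewrite -(mulrA n.+1%:R C) EFinM -muleA.
set I : \bar R := ((C / d ^+ n.+1)%:E * \int[mu]_(y in Q) (enorm (M *m F y))%:E)%E in K *.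
have I0 : (0 <= I)%E.
  apply: mule_ge0; first by rewrite lee_fin divr_ge0// ?(ltW C0)// exprn_ge0// ltW.
  by apply: integral_ge0 => y _; rewrite lee_fin enorm_ge0.
case: I K I0 => [r| |] K I0 //; last by rewrite gt0_muley ?lte_fin// leey.
by rewrite -EFinM lee_fin; apply: enorm_le_const => i; have := K i; rewrite lee_fin.
Qed.

End vector_mollifier.

Section modular.
Context {R : realType} {n : nat}.
Notation V := 'rV[R]_n.+1.
Notation mu := (@leb R n).

Implicit Types (F G : V -> 'cV[R]_n.+1) (d : R).

Definition addc (a : V) (d : R) : V := \row_i (a 0 i + d).

Lemma addcE a d i : addc a d 0 i = a 0 i + d.
Proof. by rewrite mxE. Qed.

Definition pmod (D : set V) (q : V -> R) (W : V -> 'M[R]_n.+1) (F : V -> 'cV[R]_n.+1) : \bar R :=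
  (\int[mu]_(x in D) (enorm (W x *m F x) `^ q x)%:E)%E.

(* The part of the A_p condition used to control mollifiers: averaging over a
   cube is bounded, uniformly in the cube. *)
Definition cube_bound (O : set V) (q : V -> R) (W : V -> 'M[R]_n.+1) (A : R) :=
  forall (a : V) (l : R) F (u : V -> R), 0 < l -> cube a l `<=` O ->
    (forall i, measurable_fun (cube a l) (fun x => F x i 0)) ->
    (pmod (cube a l) q W F <= 1)%E ->
    measurable_fun (cube a l) u ->
    (forall x, cube a l x -> 0 <= u x /\
      ((u x)%:E <= \int[mu]_(y in cube a l) (enorm (W x *m F y))%:E)%E) ->
    (\int[mu]_(x in cube a l) ((u x / (A * l ^+ n.+1)) `^ q x)%:E <= 1)%E.

Context (O : set V) (q : V -> R) (W : V -> 'M[R]_n.+1) (A P L d0 : R).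
Context (oO : open O).
Context (mq : measurable_fun O q).
Context (q1P : forall x, O x -> 1 <= q x <= P).
Context (mW : forall i j, measurable_fun O (fun x => W x i j)).
Context (A1 : 1 <= A).
Context (HA : cube_bound O q W A).
Context (d01 : 0 < d0 < 1).
Context (osc : forall d (x y : V), 0 < d < d0 -> O x -> O y ->
  (forall i, `|x 0 i - y 0 i| <= 2 * d) -> `|q x - q y| * - ln d <= L).

Lemma measurable_weight D i j : measurable D -> D `<=` O ->
  measurable_fun D (fun x => W x i j).
Proof. by move=> mD DO; exact: (measurable_funS (measurable_open oO) DO (mW i j)). Qed.

Lemma measurable_exponent D : measurable D -> D `<=` O -> measurable_fun D q.
Proof. by move=> mD DO; exact: (measurable_funS (measurable_open oO) DO mq). Qed.

Lemma measurable_pmod_integrand D F : measurable D -> D `<=` O ->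
  (forall i, measurable_fun D (fun x => F x i 0)) ->
  measurable_fun D (fun x => enorm (W x *m F x) `^ q x).
Proof.
move=> mD DO mF; apply: (measurable_powR2 mD _ (measurable_exponent mD DO)).
exact: (measurable_mulmx (fun i j => measurable_weight i j mD DO) mF).
Qed.

Lemma vintegrable_measurable D F i : vintegrable F -> measurable_fun D (fun x => F x i 0).
Proof.
by move=> Fi; exact: (measurable_funTS (proj1 (measurable_EFinP _ _) (measurable_int _ (Fi i)))).
Qed.

Lemma smooth_mollv_measurable D d F i : vintegrable F ->
  measurable_fun D (fun x => mollv d F x i 0).
Proof.
move=> Fi; apply: measurable_funTS; under eq_fun do rewrite mxE.
apply: measurable_fun_continuous => x.
by apply: (smooth_continuous (smooth_moll d (Fi i))).
Qed.

(** Local estimate. Dividing [F] by lam = tau^(1/rho) makes its modular on the doubled cube at most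
    1, so [cube_bound] applies; multiplying back by lam costs a bounded factor by [scale_exponent],
    which needs [tau] not much smaller than a power of d. The conclusion concerns the upper-right
    subcube, whose points have their lower cubes inside the doubled cube. *)
Lemma moll_cube_bound : exists2 C : R, 0 <= C & forall d (a : V) F (tau : R),
  0 < d < d0 -> cube a (2 * d) `<=` O -> vintegrable F ->
  (pmod (cube a (2 * d)) q W F <= tau%:E)%E -> d ^+ n.+2 <= tau <= 1 ->
  (pmod (cube (addc a d) d) q W (mollv d F) <= (C * tau)%:E)%E.
Proof.
have [C C0 hC] := @enorm_mollv_le R n.
pose B := 1 + C * A * 2 ^+ n.+1.
have A0 : 0 < A by exact: lt_le_trans A1.
have B0 : 0 <= C * A * 2 ^+ n.+1 by rewrite !mulr_ge0// ?exprn_ge0// ltW.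
have B1 : 1 <= B by rewrite /B lerDl.
exists (B `^ P * expR (2 * n.+2%:R * L)); first by rewrite mulr_ge0 ?powR_ge0// expR_ge0.
move=> d a F tau dd aO Fi Ftau /[dup] tau1 /andP[taud tau_le1].
have d1 : 0 < d < 1.
  by case/andP: dd => -> h; case/andP: d01 => _ h2; exact: lt_trans h h2.
have /andP[d_gt0 _] := d1.
have dd0 : 0 < 2 * d by rewrite mulr_gt0.
have lnd : 0 < - ln d by rewrite oppr_gt0 -ln1 ltr_ln ?posrE//; case/andP: d1.
have tau0 : 0 < tau by apply: lt_le_trans taud; rewrite exprn_gt0.
set Q2 := cube a (2 * d) in aO Ftau *; set Q := cube _ d.
have mQ2 : measurable Q2 by exact: measurable_cube.
have mQ : measurable Q by exact: measurable_cube.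
have QQ2 : Q `<=` Q2.
  move=> x xQ i; have := xQ i; rewrite addcE => /andP[? ?].
  by apply/andP; split; lra.
have lowQ x : Q x -> lower_cube d x `<=` Q2.
  move=> xQ y xy i; have := xQ i; have := xy i; rewrite addcE => /andP[? ?] /andP[? ?].
  by apply/andP; split; lra.
have aQ2 : Q2 a by move=> i; rewrite lexx lerDl ltW.
have L0 : 0 <= L.
  apply: le_trans (osc dd (aO _ aQ2) (aO _ aQ2) _).
    by rewrite subrr normr0 mul0r.
  by move=> i; rewrite subrr normr0 ltW.
pose w := L / - ln d.
have w0 : 0 <= w by rewrite divr_ge0// ltW.
have qw x : Q2 x -> `|q x - q a| <= w.
  move=> xQ; rewrite ler_pdivlMr//; apply: osc => //; [exact: aO|exact: aO|].
  move=> i; have /andP[? ?] := xQ i; rewrite ger0_norm; lra.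
(* An upper bound for all exponents on the cube, exceeding each of them by at most 2 w = 2 L / (- ln
   d). *)
pose rho := q a + w.
have rho1 : 1 <= rho by have /andP[? _] := q1P (aO _ aQ2); rewrite /rho; lra.
have qrho x : Q2 x -> q x <= rho.
  by move=> /qw; rewrite ler_norml /rho => /andP[? ?]; lra.
have rhoq x : Q2 x -> (rho - q x) * - ln d <= 2 * L.
  move=> /qw; rewrite ler_norml => /andP[? ?].
  have -> : 2 * L = 2 * w * - ln d by rewrite /w -mulrA divfK// gt_eqF.
  by rewrite ler_wpM2r ?(ltW lnd)// /rho; lra.
pose lam := tau `^ rho^-1.
have lam0 : 0 < lam by exact: powR_gt0.
have sc x : Q2 x -> tau <= lam `^ q x /\ lam `^ q x <= expR (2 * n.+2%:R * L) * tau.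
  by move=> xQ; apply: (scale_exponent d1) => //; [exact: qrho|exact: rhoq].
have q1 x : Q2 x -> 1 <= q x <= P by move=> /aO; exact: q1P.
pose F' x := lam^-1 *: F x.
have mF' i : measurable_fun Q2 (fun x => F' x i 0).
  rewrite (_ : (fun x => _) = (fun x => lam^-1 * F x i 0)); last first.
    by apply/funext => x; rewrite mxE.
  exact: (measurable_funM (measurable_cst _) (@vintegrable_measurable Q2 F i Fi)).
have F'1 : (pmod Q2 q W F' <= 1)%E.
  apply: (@le_trans _ _ (tau^-1%:E * pmod Q2 q W F)%E); last first.
    apply: (@le_trans _ _ (tau^-1%:E * tau%:E)%E).
      by apply: lee_wpmul2l => //; rewrite lee_fin invr_ge0 ltW.
    by rewrite -EFinM mulVf// gt_eqF.
  have mF i := @vintegrable_measurable Q2 F i Fi.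
  rewrite /pmod -(int_scale mQ2 (measurable_pmod_integrand mQ2 aO mF)) ?invr_ge0 ?(ltW tau0)//;
    last by move=> x _; exact: powR_ge0.
  apply: (le_int mQ2 (measurable_pmod_integrand mQ2 aO mF') _).
    exact: (measurable_funM (measurable_cst _) (measurable_pmod_integrand mQ2 aO mF)).
  move=> x xQ; split; first exact: powR_ge0.
  rewrite /F' -scalemxAr enormZ.
  rewrite ger0_norm ?invr_ge0 ?(ltW lam0)// powRM ?invr_ge0 ?(ltW lam0) ?enorm_ge0//.
  rewrite ler_wpM2r ?powR_ge0//.
  have -> : lam^-1 `^ q x = (lam `^ q x)^-1.
    by rewrite -powR_inv1 ?(ltW lam0)// -powRrM mulN1r powRN.
  by rewrite lef_pV2 ?posrE ?powR_gt0//; case: (sc x xQ).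
pose E x := enorm (W x *m mollv d F x).
have E0 x : 0 <= E x by exact: enorm_ge0.
(* The factor cancels the constant of [enorm_mollv_le] and the scaling by [lam]; the indicator
   discards the points whose lower cubes may leave the doubled cube. *)
pose u x := d ^+ n.+1 / (C * lam) * E x * \1_Q x.
have u0 x : 0 <= u x.
  by rewrite /u !mulr_ge0// ?invr_ge0 ?mulr_ge0 ?exprn_ge0 ?(ltW d_gt0) ?(ltW C0) ?(ltW lam0)// indicE.
have mE : measurable_fun Q2 E.
  apply: measurable_mulmx => [i j|i]; first exact: measurable_weight.
  exact: smooth_mollv_measurable.
have mu_ : measurable_fun Q2 u.
  exact: (measurable_funM (measurable_funM (measurable_cst _) mE) (measurable_indic mQ)).
have uint x : Q2 x -> 0 <= u x /\
    ((u x)%:E <= \int[leb]_(y in Q2) (enorm (W x *m F' y))%:E)%E.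
  move=> xQ2; split=> //; have [xQ|xQ] := pselect (Q x); last first.
    rewrite /u indicE memNset// mulr0; apply: integral_ge0 => y _.
    by rewrite lee_fin enorm_ge0.
  have mWF : measurable_fun Q2 (fun y => enorm (W x *m F y)).
    exact: (@measurable_mulmx _ _ Q2 (fun=> W x) F (fun i j => measurable_cst (W x i j))
      (fun i => @vintegrable_measurable Q2 F i Fi)).
  under eq_integral do rewrite /F' -scalemxAr enormZ ger0_norm ?invr_ge0 ?(ltW lam0)//.
  rewrite (int_scale mQ2 mWF) ?invr_ge0 ?(ltW lam0)//; last by move=> y _; exact: enorm_ge0.
  rewrite /u indicE mem_set// mulr1.
  have -> : d ^+ n.+1 / (C * lam) * E x = lam^-1 * (d ^+ n.+1 / C * E x).
    by field; rewrite !gt_eqF.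
  rewrite EFinM; apply: lee_wpmul2l; first by rewrite lee_fin invr_ge0 ltW.
  have := lee_wpmul2l (x := (d ^+ n.+1 / C)%:E) _ (hC d (W x) F x Q2 d_gt0 Fi mQ2 (lowQ x xQ)).
  rewrite -EFinM muleA -EFinM.
  have -> : d ^+ n.+1 / C * (C / d ^+ n.+1) = 1.
    by field; rewrite expf_neq0 ?gt_eqF.
  rewrite mul1e; apply.
  by rewrite lee_fin divr_ge0 ?exprn_ge0 ?(ltW d_gt0) ?(ltW C0).
have H := HA dd0 aO mF' F'1 mu_ uint.
pose t x := u x / (A * (2 * d) ^+ n.+1).
have t0 x : 0 <= t x by rewrite divr_ge0// mulr_ge0 ?exprn_ge0 ?(ltW A0) ?(ltW dd0).
have mt : measurable_fun Q2 (fun x => t x `^ q x).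
  exact: (measurable_powR2 mQ2 (measurable_funM mu_ (measurable_cst _))
    (measurable_exponent mQ2 aO)).
pose D := B `^ P * expR (2 * n.+2%:R * L) * tau.
have D0 : 0 <= D by rewrite !mulr_ge0 ?powR_ge0 ?expR_ge0 ?(ltW tau0).
apply: (@le_trans _ _ (D%:E * \int[leb]_(x in Q2) (t x `^ q x)%:E)%E); last first.
  by rewrite -[leRHS]mule1; apply: lee_wpmul2l; rewrite ?lee_fin.
have tq0 x : Q2 x -> 0 <= t x `^ q x by move=> _; exact: powR_ge0.
rewrite -(int_scale mQ2 mt tq0 D0).
apply: (@le_trans _ _ (\int[leb]_(x in Q) (D * t x `^ q x)%:E)%E); last first.
  apply: (int_subset mQ mQ2 (measurable_funM (measurable_cst _) mt) _ QQ2).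
  by move=> x _; rewrite mulr_ge0 ?powR_ge0.
apply: (le_int mQ).
- apply: (measurable_pmod_integrand mQ (subset_trans QQ2 aO)).
  by move=> i; exact: smooth_mollv_measurable.
- exact: (measurable_funM (measurable_cst _) (measurable_funS mQ2 QQ2 mt)).
move=> x xQ; have xQ2 := QQ2 x xQ; split; first exact: powR_ge0.
have -> : enorm (W x *m mollv d F x) = C * A * 2 ^+ n.+1 * (lam * t x).
  rewrite /t /u indicE mem_set// mulr1 -/(E x) exprMn.
  by field; rewrite !expf_neq0 ?gt_eqF.
have /andP[qx1 qP] := q1 x xQ2.
have lt0 : 0 <= lam * t x by rewrite mulr_ge0// ltW.
apply: (@le_trans _ _ ((B * (lam * t x)) `^ q x)).
  apply: le_powR_l; [lra|exact: mulr_ge0|].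
  by rewrite ler_wpM2r// /B lerDr.
apply: le_trans (powR_const_le B1 lt0 qP) _.
have [_ scx] := sc x xQ2; rewrite /D -mulrA -(mulrA (B `^ P)) ler_wpM2l ?powR_ge0//.
by rewrite powRM ?(ltW lam0)// mulrA ler_wpM2r ?powR_ge0.
Qed.

End modular.

(** * Summation of the local bounds over a grid *)

Lemma count_close (R : realType) (t : R) m :
  (\sum_(k < m) (`|t - k%:R| <= 1)%R <= 5)%N.
Proof.
rewrite -(big_mkord xpredT (fun k => (`|t - k%:R| <= 1)%R : nat)).
under eq_bigr do rewrite -[nat_of_bool _]/(if _ then 1%N else 0%N).
rewrite -big_mkcond sum1_count -size_filter.
set s := [seq _ <- _ | _]; case E : s => [//|j r]; rewrite -E /s.
have : j \in s by rewrite E mem_head.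
rewrite mem_filter => /= /andP[tj _].
apply: (@uniq_leq_size _ _ [:: j.-2; j.-1; j; j.+1; j.+2]).
  by rewrite filter_uniq// iota_uniq.
move=> k; rewrite mem_filter => /= /andP[tk _].
have h1 : (k <= j.+2)%N.
  by rewrite -(ler_nat R) -!natr1; move: tj tk; rewrite !ler_norml => /andP[? ?] /andP[? ?]; lra.
have h2 : (j <= k.+2)%N.
  by rewrite -(ler_nat R) -!natr1; move: tj tk; rewrite !ler_norml => /andP[? ?] /andP[? ?]; lra.
rewrite !inE; lia.
Qed.

Section grid.
Context {R : realType} {n : nat}.
Notation V := 'rV[R]_n.+1.
Notation mu := (@leb R n).

Lemma sum_integral_indic (I : finType) (O : set V) (D : I -> set V) (h : V -> R) :
  measurable O -> (forall z, measurable (D z)) -> (forall z, D z `<=` O) ->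
  measurable_fun O h -> (forall x, O x -> 0 <= h x) ->
  (\sum_z \int[mu]_(x in D z) (h x)%:E =
   \int[mu]_(x in O) ((\sum_z \1_(D z) x) * h x)%:E)%E.
Proof.
move=> mO mD DO mh h0.
have m1 z : measurable_fun O (fun x => \1_(D z) x * h x).
  exact: (measurable_funM (measurable_indic (mD z)) mh).
transitivity (\int[mu]_(x in O) (\sum_z (\1_(D z) x * h x)%:E))%E; last first.
  by apply: eq_integral => x _; rewrite sumEFin mulr_suml.
rewrite (@ge0_integral_sum _ _ _ mu O mO _ (fun z x => (\1_(D z) x * h x)%:E)); last 2 first.
- by move=> z; apply/measurable_EFinP; exact: m1.
- by move=> z x /h0 hx; rewrite lee_fin mulr_ge0// indicE ler0n.
apply: eq_bigr => z _.
rewrite -[in LHS](setIidr (DO z)) integral_mkcondr; apply: eq_integral => x _.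
by rewrite patchE indicE; case: ifP => _; rewrite ?mul1r ?mul0r.
Qed.

(** The corner of the doubled cube of side 2 d. The grid cell itself is its upper-right subcube,
    with corner [addc (grid_corner b d z) d]. *)
Definition grid_corner (b : V) (d : R) K (z : {ffun 'I_n.+1 -> 'I_K}) : V :=
  \row_i (b 0 i + d * (z i)%:R - d).

(** Membership in a doubled cell is a conjunction over coordinates, so the sum over multi-indices of
    the products is the product over coordinates of sums, each at most 5 by [count_close]. *)
Lemma grid_overlap (b : V) (d : R) K (x : V) : 0 < d ->
  \sum_(z : {ffun 'I_n.+1 -> 'I_K}) (\1_(cube (grid_corner b d z) (2 * d)) x : R)
    <= 5 ^+ n.+1.
Proof.
move=> d0; pose c (i : 'I_n.+1) (k : 'I_K) : R := (`|(x 0 i - b 0 i) / d - k%:R| <= 1)%R%:R.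
apply: (@le_trans _ _ (\sum_(z : {ffun 'I_n.+1 -> 'I_K}) \prod_i c i (z i))).
  apply: ler_sum => z _; have [xz|xz] := pselect (cube (grid_corner b d z) (2 * d) x); last first.
    by rewrite indicE memNset//; apply: prodr_ge0.
  rewrite indicE mem_set//= big1// => i _; rewrite /c.
  suff -> : `|(x 0 i - b 0 i) / d - (z i)%:R| <= 1 by [].
  have := xz i; rewrite mxE => /andP[h1 h2].
  rewrite ler_norml lerBrDr lerBlDr ler_pdivlMr// ler_pdivrMr//.
  by apply/andP; split; lra.
rewrite -(bigA_distr_bigA c) -[n.+1 in leRHS]card_ord -prodr_const.
apply: ler_prod => i _; apply/andP; split; first exact: sumr_ge0.
by rewrite /c -natr_sum ler_nat count_close.
Qed.

Lemma grid_cover (b : V) (s : R) m (x : V) : 0 < s -> cube b (2 * s) x ->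
  let d := s / m.+1%:R in
  exists z : {ffun 'I_n.+1 -> 'I_(m.+1.*2)}, cube (addc (grid_corner b d z) d) d x.
Proof.
move=> s0 bx d; have d0 : 0 < d by rewrite divr_gt0.
have dK : d * (m.+1.*2)%:R = 2 * s by rewrite -mul2n natrM /d mulrCA divfK ?pnatr_eq0.
have /choice[z hz] (i : 'I_n.+1) : exists k : 'I_(m.+1.*2),
    b 0 i + d * k%:R <= x 0 i <= b 0 i + d * k%:R + d.
  have /andP[h1 h2] := bx i; pose t := (x 0 i - b 0 i) / d.
  have t0 : 0 <= t by rewrite divr_ge0 ?subr_ge0// ltW.
  have xt : x 0 i = b 0 i + d * t by rewrite /t mulrC divfK ?gt_eqF//; ring.
  have /andP[k1 k2] := truncn_itv t0; set k := Num.truncn t in k1 k2.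
  have [kK|Kk] := ltnP k (m.+1.*2).
    exists (Ordinal kK) => /=; rewrite xt lerD2l -addrA lerD2l.
    rewrite -[X in _ + X]mulr1 -mulrDr !ler_pM2l// k1/= -natr1 in k2 *.
    exact: ltW.
  (* Here x lies on the upper face, where the truncation gives an index one too large; the last
     cell, being closed, contains it. *)
  have pK : ((m.+1.*2).-1 < m.+1.*2)%N by rewrite prednK// double_gt0.
  exists (Ordinal pK) => /=.
  have -> : d * (m.+1.*2.-1)%:R = 2 * s - d.
    rewrite -dK -[m.+1.*2 in RHS]prednK ?double_gt0// -[in RHS]natr1; ring.
  have : d * (m.+1.*2)%:R <= d * k%:R by rewrite ler_pM2l// ler_nat.
  have : d * k%:R <= d * t by rewrite ler_pM2l.
  by rewrite dK => ? ?; apply/andP; split; lra.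
exists [ffun i => z i] => i; rewrite addcE mxE ffunE.
by have /andP[? ?] := hz i; apply/andP; split; lra.
Qed.

End grid.

Section setting.
Context {R : realType} {n : nat}.
Notation V := 'rV[R]_n.+1.
Notation mu := (@leb R n).
Implicit Types (F G : V -> 'cV[R]_n.+1) (d : R).

Record weight_setting (O : set V) (q : V -> R) (W : V -> 'M[R]_n.+1) (A P L d0 : R) : Prop :=
  WeightSetting {
    ws_open : open O;
    ws_measurable_exponent : measurable_fun O q;
    ws_exponent : forall x, O x -> 1 <= q x <= P;
    ws_measurable_weight : forall i j, measurable_fun O (fun x => W x i j);
    ws_const : 1 <= A;
    ws_cube_bound : cube_bound O q W A;
    ws_scale : 0 < d0 < 1;
    ws_osc : forall d (x y : V), 0 < d < d0 -> O x -> O y ->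
      (forall i, `|x 0 i - y 0 i| <= 2 * d) -> `|q x - q y| * - ln d <= L }.

Context (O : set V) (q : V -> R) (W : V -> 'M[R]_n.+1) (A P L d0 : R).
Context (S : weight_setting O q W A P L d0).

Lemma mollv_out d b s F x : 0 < d <= s -> (forall y, ~ cube b s y -> F y = 0) ->
  ~ cube b (2 * s) x -> mollv d F x = 0.
Proof.
move=> /andP[d0' ds] F0 bx; apply/matrixP => i j; rewrite !mxE.
apply: moll_const => // y xy; rewrite F0 ?mxE// => yb; apply: bx => k.
by have := yb k; have := xy k => /andP[? ?] /andP[? ?]; apply/andP; split; lra.
Qed.

(** The local bounds are summed over the cells. Doubled cells overlap boundedly, whence 5^(n+1), and
    the K^(n+1) extra amounts d^(n+2) add up to (2 s)^(n+1) d because K d = 2 s. *)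
Lemma moll_bound : exists2 C : R, 0 <= C & forall b s m F, 0 < s ->
  cube (addc b (- s)) (4 * s) `<=` O -> s / m.+1%:R < d0 -> vintegrable F ->
  (forall x, ~ cube b s x -> F x = 0) ->
  (pmod O q W F + ((s / m.+1%:R) ^+ n.+2)%:E <= 1)%E ->
  (pmod O q W (mollv (s / m.+1%:R) F) <=
    C%:E * (pmod O q W F + ((2 * s) ^+ n.+1 * (s / m.+1%:R))%:E))%E.
Proof.
case: S => oO mq q1P mW A1 HA d01 osc.
have [C C0 hC] := moll_cube_bound oO mq q1P mW A1 HA d01 osc.
exists (C * 5 ^+ n.+1); first by rewrite mulr_ge0// exprn_ge0.
move=> b s m F s0 bO; set d := s / m.+1%:R => dd0 Fi F0 Fle.
have d_gt0 : 0 < d by rewrite divr_gt0.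
have mO := measurable_open oO.
have ds : d <= s by rewrite ler_pdivrMr// ler_peMr ?(ltW s0)// ler1n.
pose K := (m.+1.*2)%N; have dK : d * K%:R = 2 * s.
  by rewrite /K -mul2n natrM /d mulrCA divfK ?pnatr_eq0.
pose I := {ffun 'I_n.+1 -> 'I_K}.
pose Q (z : I) := cube (addc (grid_corner b d z) d) d.
pose Q2 (z : I) := cube (grid_corner b d z) (2 * d).
have mQ z : measurable (Q z) by exact: measurable_cube.
have mQ2 z : measurable (Q2 z) by exact: measurable_cube.
have Q2O z : Q2 z `<=` O.
  move=> x xz; apply: bO => i; have := xz i; rewrite addcE mxE => /andP[h1 h2].
  have h3 : 0 <= d * (z i)%:R by rewrite mulr_ge0// ltW.
  have h4 : d * (z i)%:R <= d * K%:R by rewrite ler_pM2l// ler_nat ltnW.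
  by apply/andP; split; lra.
have QQ2 z : Q z `<=` Q2 z.
  move=> x xz i; have := xz i; rewrite addcE => /andP[h1 h2].
  by apply/andP; split; lra.
have QO z : Q z `<=` O by exact: subset_trans (QQ2 z) (Q2O z).
pose h x := enorm (W x *m F x) `^ q x.
pose g x := enorm (W x *m mollv d F x) `^ q x.
have mh : measurable_fun O h.
  exact: (measurable_pmod_integrand oO mq mW mO (@subset_refl _ O)
    (fun i => @vintegrable_measurable _ _ O F i Fi)).
have mg : measurable_fun O g.
  exact: (measurable_pmod_integrand oO mq mW mO (@subset_refl _ O)
    (fun i => @smooth_mollv_measurable _ _ O d F i Fi)).
have h0 x : O x -> 0 <= h x by move=> _; exact: powR_ge0.
have g0 x : O x -> 0 <= g x by move=> _; exact: powR_ge0.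
have m1 (D : I -> set V) : (forall z, measurable (D z)) ->
    measurable_fun O (fun x => \sum_z (\1_(D z) x : R)).
  by move=> mD; apply: measurable_sum => z; exact: measurable_indic.
have step1 : (pmod O q W (mollv d F) <= \sum_z pmod (Q z) q W (mollv d F))%E.
  rewrite /pmod (sum_integral_indic mO mQ QO mg g0).
  apply: (le_int mO mg (measurable_funM (m1 _ mQ) mg)) => x Ox /=; split; first exact: g0.
  have [bx|bx] := pselect (cube b (2 * s) x); last first.
    suff -> : g x = 0 by rewrite mulr0.
    rewrite /g (mollv_out _ F0 bx) ?d_gt0// mulmx0 enorm0 powR0//.
    by have /andP[h1 _] := q1P _ Ox; rewrite gt_eqF//; lra.
  have [z xz] := grid_cover m s0 bx.
  rewrite ler_peMl ?g0// (bigD1 z)//= indicE mem_set// lerDl.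
  by apply: sumr_ge0 => *; rewrite indicE.
have fin z : (pmod (Q2 z) q W F <= pmod O q W F)%E.
  exact: (int_subset (mQ2 z) mO mh h0 (Q2O z)).
have dn0 : 0 < d ^+ n.+2 by rewrite exprn_gt0.
have pge0 D G : (0 <= pmod D q W G)%E.
  by apply: integral_ge0 => x _; rewrite lee_fin powR_ge0.
have finO : pmod O q W F \is a fin_num.
  rewrite ge0_fin_numE//; apply: (@le_lt_trans _ _ 1%E); last exact: ltry.
  by apply: le_trans Fle; rewrite leeDl// lee_fin ltW.
have fin_num z : pmod (Q2 z) q W F \is a fin_num.
  by rewrite ge0_fin_numE// (le_lt_trans (fin z))// ltey_eq finO.
(* The added power supplies the lower bound on [tau] required by [moll_cube_bound]; its exponent is
   one more than the dimension, so that its sum over the grid still tends to 0. *)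
pose tau z := fine (pmod (Q2 z) q W F) + d ^+ n.+2.
have step2 z : (pmod (Q z) q W (mollv d F) <= (C * tau z)%:E)%E.
  apply: hC => //.
  - by rewrite d_gt0.
  - exact: Q2O.
  - by rewrite /tau EFinD fineK// leeDl// lee_fin ltW.
  - apply/andP; split; first by rewrite lerDr fine_ge0.
    rewrite -lee_fin /tau EFinD fineK//; apply: le_trans Fle.
    by rewrite leeD2r.
apply: (le_trans step1); apply: (@le_trans _ _ (\sum_z (C * tau z)%:E)%E).
  exact: lee_sum.
rewrite sumEFin -mulr_sumr /tau big_split/= sumr_const card_ffun !card_ord.
have -> : d ^+ n.+2 *+ (K ^ n.+1) = (2 * s) ^+ n.+1 * d.
  by rewrite -mulr_natl natrX [d ^+ _]exprSr mulrA -exprMn (mulrC K%:R) dK.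
have step3 : \sum_z fine (pmod (Q2 z) q W F) <= 5 ^+ n.+1 * fine (pmod O q W F).
  rewrite -lee_fin EFinM fineK// -sumEFin.
  under eq_bigr do rewrite fineK//.
  rewrite /pmod (sum_integral_indic mO mQ2 Q2O mh h0).
  rewrite -(int_scale mO mh h0) ?exprn_ge0//.
  apply: (le_int mO (measurable_funM (m1 _ mQ2) mh) (measurable_funM (measurable_cst _) mh)).
  move=> x Ox; split.
    by rewrite mulr_ge0 ?h0//; apply: sumr_ge0 => *; rewrite indicE.
  by rewrite ler_wpM2r ?h0//; exact: grid_overlap.
rewrite -(fineK finO) -EFinD -EFinM lee_fin -mulrA ler_wpM2l// mulrDr lerD//.
rewrite ler_peMl//; first by rewrite mulr_ge0 ?exprn_ge0// ?mulr_ge0 ?(ltW s0) ?(ltW d_gt0).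
by rewrite -[leLHS](expr1n _ n.+1) lerXn2r// ?nnegrE// ler1n.
Qed.

End setting.

Section dominated.
Context {R : realType} {n : nat}.
Notation V := 'rV[R]_n.+1.
Notation mu := (@leb R n).
Implicit Types (F G : V -> 'cV[R]_n.+1) (D : set V).

Lemma dominated_null D (g : nat -> V -> R) (h : V -> R) : measurable D ->
  (forall k, measurable_fun D (g k)) -> measurable_fun D h ->
  (\int[mu]_(x in D) (h x)%:E < +oo)%E ->
  (forall k x, D x -> 0 <= g k x <= h x) ->
  (forall x, D x -> forall e, 0 < e -> exists K, forall k, (K <= k)%N -> g k x <= e) ->
  forall e, 0 < e -> exists K, forall k, (K <= k)%N ->
    (\int[mu]_(x in D) (g k x)%:E <= e%:E)%E.
Proof.
move=> mD mg mh hoo gh g0 e e0.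
have hi : mu.-integrable D (EFin \o h).
  apply/integrableP; split; first exact/measurable_EFinP.
  rewrite (eq_integral (fun x => (h x)%:E))// => x /set_mem Dx /=.
  by have /andP[h1 h2] := gh 0%N x Dx; rewrite ger0_norm// (le_trans h1).
have lim : {ae mu, forall x, D x -> (g k x)%:E @[k --> \oo] --> 0%E}.
  apply: aeW => x Dx; apply: cvg_EFin; first exact: nearW.
  apply/cvgrPdist_le => /= r r0; have [K hK] := g0 x Dx r r0.
  exists K => // k /= Kk; rewrite sub0r normrN ger0_norm; first exact: hK.
  by case/andP: (gh k x Dx).
have dom : {ae mu, forall x k, D x -> (`|(g k x)%:E| <= (EFin \o h) x)%E}.
  apply: aeW => x k Dx; have /andP[h1 h2] := gh k x Dx.
  by rewrite /= lee_fin ger0_norm.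
have m0 : measurable_fun D (fun=> 0%E : \bar R) by exact: measurable_cst.
have [_ _] := @dominated_convergence _ _ _ mu D mD (fun k x => (g k x)%:E)
  (fun=> 0%E) (EFin \o h) (fun k => proj2 (measurable_EFinP _ _) (mg k)) m0 lim hi dom.
rewrite integral0 => /fine_cvgP[fin].
move=> /cvgrPdist_le/(_ e e0)[K2 _ hK2]; case: fin => K1 _ hK1.
exists (maxn K1 K2) => k; rewrite geq_max => /andP[k1 k2].
have := hK2 k k2; have := hK1 k k1; rewrite /= sub0r normrN => fk.
rewrite -[X in (X <= _)%E](fineK fk) lee_fin; apply: le_trans; exact: ler_norm.
Qed.

Lemma int_add D (f g : V -> R) : measurable D -> measurable_fun D f ->
  measurable_fun D g -> (forall x, D x -> 0 <= f x) -> (forall x, D x -> 0 <= g x) ->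
  (\int[mu]_(x in D) (f x + g x)%:E =
   \int[mu]_(x in D) (f x)%:E + \int[mu]_(x in D) (g x)%:E)%E.
Proof.
move=> mD /measurable_EFinP mf /measurable_EFinP mg f0 g0.
apply: (@ge0_integralD _ _ _ mu D mD (EFin \o f) (EFin \o g) _ mf _ mg) => x Dx.
  by rewrite lee_fin f0.
by rewrite lee_fin g0.
Qed.

Lemma powR_add_le (q P a b : R) : 0 <= q <= P -> 0 <= a -> 0 <= b ->
  (a + b) `^ q <= 2 `^ P * (a `^ q + b `^ q).
Proof.
move=> /andP[q0 qP] a0 b0.
have two : (1 : R) <= 2 by rewrite ler1n.
wlog ab : a b a0 b0 / a <= b.
  by move=> H; have [/H|/ltW/H] := leP a b; [exact|rewrite addrC [X in _ * X]addrC; exact].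
apply: (@le_trans _ _ ((2 * b) `^ q)).
  by apply: le_powR_l => //; [exact: addr_ge0|lra].
apply: le_trans (powR_const_le two b0 qP) _.
by rewrite ler_wpM2l ?powR_ge0// lerDr powR_ge0.
Qed.

End dominated.

Section modular_theory.
Context {R : realType} {n : nat}.
Notation V := 'rV[R]_n.+1.
Notation mu := (@leb R n).
Implicit Types (F G : V -> 'cV[R]_n.+1) (D : set V).
Context (O : set V) (q : V -> R) (W : V -> 'M[R]_n.+1) (A P L d0 : R).
Context (S : weight_setting O q W A P L d0).

Let oO := ws_open S.
Let mq := ws_measurable_exponent S.
Let q1P := ws_exponent S.
Let mW := ws_measurable_weight S.

Definition vmeasurable D F := forall i, measurable_fun D (fun x => F x i 0).

Lemma ws_integrand D F : measurable D -> D `<=` O -> vmeasurable D F ->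
  measurable_fun D (fun x => enorm (W x *m F x) `^ q x).
Proof. by move=> mD DO mF; exact: (measurable_pmod_integrand oO mq mW mD DO mF). Qed.

Lemma vmeasurableB D F G : vmeasurable D F -> vmeasurable D G ->
  vmeasurable D (fun x => F x - G x).
Proof.
move=> mF mG i; rewrite (_ : (fun x => _) = (fun x => F x i 0 - G x i 0)).
  exact: (measurable_funB (mF i) (mG i)).
by apply/funext => x; rewrite !mxE.
Qed.

Lemma pmod_le D F G (c : R) : measurable D -> D `<=` O -> vmeasurable D F -> vmeasurable D G ->
  1 <= c -> (forall x, D x -> enorm (W x *m F x) <= c * enorm (W x *m G x)) ->
  (pmod D q W F <= (c `^ P)%:E * pmod D q W G)%E.
Proof.
move=> mD DO mF mG c1 FG; have mG' := ws_integrand mD DO mG.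
rewrite /pmod -(int_scale mD mG') ?powR_ge0//; last by move=> *; exact: powR_ge0.
apply: (le_int mD (ws_integrand mD DO mF) (measurable_funM (measurable_cst _) mG')).
move=> x Dx; split; first exact: powR_ge0.
have /andP[q1 qP] := q1P (DO _ Dx).
apply: le_trans (powR_const_le c1 (enorm_ge0 _) qP).
by apply: le_powR_l; [lra|exact: enorm_ge0|exact: FG].
Qed.

Lemma pmodB D F G : measurable D -> D `<=` O -> vmeasurable D F -> vmeasurable D G ->
  (pmod D q W (fun x => (F x - G x)%R) <=
   ((n.+1%:R * 2) `^ P)%:E * (pmod D q W F + pmod D q W G))%E.
Proof.
move=> mD DO mF mG; have mF' := ws_integrand mD DO mF; have mG' := ws_integrand mD DO mG.
have mE := measurable_funD mF' mG'.
have p0 (H : V -> 'cV[R]_n.+1) x : D x -> 0 <= enorm (W x *m H x) `^ q x by move=> _; exact: powR_ge0.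
rewrite /pmod -(int_add mD mF' mG' (p0 F) (p0 G)).
rewrite -(int_scale mD mE) ?powR_ge0//; last by move=> *; rewrite addr_ge0 ?powR_ge0.
apply: (le_int mD (ws_integrand mD DO (vmeasurableB mF mG)) (measurable_funM (measurable_cst _) mE)).
move=> x Dx; split; first exact: powR_ge0.
have /andP[q1 qP] := q1P (DO _ Dx).
have N1 : (1 : R) <= n.+1%:R by rewrite ler1n.
have q0P : 0 <= q x <= P by apply/andP; split; lra.
apply: (@le_trans _ _ ((n.+1%:R * (enorm (W x *m F x) + enorm (W x *m G x))) `^ q x)).
  apply: le_powR_l; [lra|exact: enorm_ge0|].
  rewrite mulmxBr; have := enorm_sum_le [:: W x *m F x; - (W x *m G x)] id.
  by rewrite !big_cons !big_nil !addr0 enormN.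
apply: le_trans (powR_const_le N1 _ qP) _; first by rewrite addr_ge0 ?enorm_ge0.
rewrite /= powRM// -mulrA ler_wpM2l ?powR_ge0//.
by apply: powR_add_le => //; exact: enorm_ge0.
Qed.

Definition ecol (j : 'I_n.+1) : 'cV[R]_n.+1 := delta_mx j 0.

(** The averaging bound is tested on F = g e_j with g positive and so small that the modular is at
    most 1. The integral of |W(x) F(y)| in y is then |W(x) e_j| times the positive constant [kap],
    and the bound makes its q-th power integrable. *)
Lemma pmod_ecol_lty (a : V) (l : R) j : 0 < l -> cube a l `<=` O ->
  (pmod (cube a l) q W (fun=> ecol j) < +oo)%E.
Proof.
move=> l0 aO; set Q := cube a l in aO *.
have mQ : measurable Q by exact: measurable_cube.
have Qlb := leb_cube_fin a l0; rewrite -/Q in Qlb.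
set e := ecol j.
have mcst : vmeasurable Q (fun=> e) by move=> i; exact: measurable_cst.
pose v x := enorm (W x *m e).
have v0 x : 0 <= v x by exact: enorm_ge0.
have mv : measurable_fun Q v.
  exact: (measurable_mulmx (fun i k => measurable_weight oO mW i k mQ aO) mcst).
have Qfin : mu Q \is a fin_num by rewrite ge0_fin_numE//; case/andP: Qlb.
(* Chosen so that tau <= 1 and tau * mu(Q) <= 1. With g = tau / (1 + v) one has v g <= tau, hence (v
   g)^q <= tau, whose integral is at most 1. *)
pose tau := (1 + fine (mu Q))^-1.
have Q0 : 0 <= fine (mu Q) by exact: fine_ge0.
have tau0 : 0 < tau by rewrite invr_gt0; lra.
have tau1 : tau <= 1 by rewrite invf_le1; lra.
pose g y := tau / (1 + v y).
have g0 y : 0 < g y by rewrite divr_gt0// ltr_pwDl.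
have mg : measurable_fun Q g.
  apply: measurable_funM; first exact: measurable_cst.
  have : measurable_fun Q (fun y => (1 + v y) `^ (-1)).
    have m1v : measurable_fun Q (fun y => 1 + v y) by apply: measurable_funD; [exact: measurable_cst|exact: mv].
    exact: (measurableT_comp (@measurable_powR R (-1)) m1v).
  apply: eq_measurable_fun => y _; rewrite powR_inv1// addr_ge0//.
pose F y := g y *: e.
have mF : vmeasurable Q F.
  move=> i; rewrite (_ : (fun x => _) = (fun x => g x * e i 0)).
    exact: (measurable_funM mg (measurable_cst _)).
  by apply/funext => x; rewrite mxE.
have WFE x y : enorm (W x *m F y) = v x * g y.
  by rewrite /F -scalemxAr enormZ ger0_norm ?(ltW (g0 y))// mulrC.
have F1 : (pmod Q q W F <= 1)%E.
  apply: (@le_trans _ _ (\int[mu]_(x in Q) tau%:E)%E).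
    apply: (le_int mQ (ws_integrand mQ aO mF) (measurable_cst _)) => x Qx.
    split; first exact: powR_ge0.
    have /andP[q1 _] := q1P (aO _ Qx).
    have vg : v x * g x <= tau.
      rewrite /g mulrCA ler_piMr ?(ltW tau0)// ler_pdivrMr ?ltr_pwDl// mul1r.
      by rewrite lerDr.
    rewrite WFE; apply: (@le_trans _ _ (tau `^ q x)).
      by apply: le_powR_l => //; [lra|rewrite mulr_ge0// ltW].
    by rewrite ge1r_powR// tau0.
  apply: (@le_trans _ _ (tau%:E * (fine (mu Q))%:E)%E); first by rewrite integral_cst// fineK.
  by rewrite -EFinM lee_fin /tau ler_pdivrMl; lra.
pose kap := \int[mu]_(y in Q) g y.
have gi : mu.-integrable Q (EFin \o g).
  apply/integrableP; split; first exact/measurable_EFinP.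
  apply: (@le_lt_trans _ _ (\int[mu]_(x in Q) 1%:E)%E).
    apply: (le_int mQ _ (measurable_cst _)) => [|x Qx].
      exact: (measurableT_comp (@normr_measurable R setT) mg).
    split=> //; rewrite ger0_norm ?(ltW (g0 x))// /g ler_pdivrMr ?ltr_pwDl// mul1r.
    by rewrite (le_trans tau1)// lerDl.
  by rewrite integral_cst// mul1e; case/andP: Qlb.
have kapE : (\int[mu]_(y in Q) (g y)%:E = kap%:E)%E.
  by rewrite fineK//; exact: integrable_fin_num.
have kap0 : 0 < kap.
  rewrite lt0r; apply/andP; split; last first.
    by apply: Rintegral_ge0 => x _; exact: ltW.
  (* If the integral were 0, the positive function [g] would vanish almost everywhere on the cube,
     which has positive measure. *)
  apply/eqP => k0; move: kapE; rewrite k0 => gint0.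
  have : (\int[mu]_(x in Q) `|(EFin \o g) x|)%E = 0%E.
    by rewrite -[RHS]gint0; apply: eq_integral => x _; rewrite /= ger0_norm ?(ltW (g0 x)).
  move/(ae_eq_integral_abs mu mQ (measurable_int _ gi)) => [N [mN N0 QN]].
  have QsubN : Q `<=` N.
    move=> x Qx; apply: QN => /(_ Qx) [] /eqP; rewrite gt_eqF//.
  have := le_lebesgue_outer QsubN.
  rewrite [X in (_ <= X)%E]N0; case/andP: Qlb => h _ /(lt_le_trans h).
  by rewrite ltxx.
have Al0 : 0 < A * l ^+ n.+1.
  by rewrite mulr_gt0 ?exprn_gt0//; apply: lt_le_trans (ws_const S).
have uint x : Q x -> 0 <= v x * kap /\
    ((v x * kap)%:E <= \int[mu]_(y in Q) (enorm (W x *m F y))%:E)%E.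
  move=> Qx; split; first by rewrite mulr_ge0// ltW.
  under eq_integral do rewrite WFE.
  by rewrite (int_scale mQ mg _ (v0 x)) ?kapE ?EFinM// => y _; exact: ltW.
have mvk : measurable_fun Q (fun x => v x * kap).
  exact: (measurable_funM mv (measurable_cst _)).
have H := ws_cube_bound S l0 aO mF F1 mvk uint.
pose t x := v x * kap / (A * l ^+ n.+1).
have t0 x : 0 <= t x by rewrite divr_ge0 ?(ltW Al0)// mulr_ge0// ltW.
have mt : measurable_fun Q (fun x => t x `^ q x).
  exact: (measurable_powR2 mQ (measurable_funM mvk (measurable_cst _))
    (measurable_exponent oO mq mQ aO)).
pose c := 1 + A * l ^+ n.+1 / kap.
have ct : 0 <= A * l ^+ n.+1 / kap by rewrite divr_ge0 ?(ltW Al0) ?(ltW kap0).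
have c1 : 1 <= c by rewrite /c lerDl.
apply: (@le_lt_trans _ _ ((c `^ P)%:E * \int[mu]_(x in Q) (t x `^ q x)%:E)%E); last first.
  apply: (@le_lt_trans _ _ ((c `^ P)%:E * 1)%E); last by rewrite mule1 ltry.
  by apply: lee_wpmul2l; rewrite ?lee_fin ?powR_ge0.
rewrite -(int_scale mQ mt) ?powR_ge0//; last by move=> *; exact: powR_ge0.
apply: (le_int mQ (ws_integrand mQ aO mcst) (measurable_funM (measurable_cst _) mt)).
move=> x Qx; split; first exact: powR_ge0.
have /andP[q1 qP] := q1P (aO _ Qx).
apply: le_trans (powR_const_le c1 (t0 x) qP).
apply: le_powR_l; [lra|exact: enorm_ge0|].
have -> : enorm (W x *m e) = A * l ^+ n.+1 / kap * t x.
  rewrite /t -/(v x); move: (A * l ^+ n.+1) Al0 => z z0.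
  by field; rewrite !gt_eqF.
by rewrite ler_wpM2r// /c lerDr.
Qed.

End modular_theory.

(** * Convergence of mollifications *)

Section good.
Context {R : realType} {n : nat}.
Notation V := 'rV[R]_n.+1.
Notation mu := (@leb R n).
Implicit Types (F G : V -> 'cV[R]_n.+1) (D E : set V) (e r d : R).
Context (O : set V) (q : V -> R) (W : V -> 'M[R]_n.+1) (A P L d0 : R).
Context (S : weight_setting O q W A P L d0).
Context (b : V) (s : R) (s0 : 0 < s) (bO : cube (addc b (- s)) (4 * s) `<=` O).

Let oO := ws_open S.
Let mO := measurable_open oO.
Let q1P := ws_exponent S.

(** Only scales dividing [s] are used: then a grid of this mesh tiles [cube b (2 * s)] exactly, as
    [moll_bound] expects. *)
Definition mesh (m : nat) : R := s / m.+1%:R.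

Definition Bx : set V := box (b, addc b s).

Definition supported F := forall x, ~ Bx x -> F x = 0.

Record good F : Prop := Good {
  good_integrable : vintegrable F;
  good_supported : supported F;
  good_cvg : forall e, 0 < e -> exists m0, forall m, (m0 <= m)%N ->
    (pmod O q W (fun x => (F x - mollv (mesh m) F x)%R) <= e%:E)%E }.

Lemma mesh_gt0 m : 0 < mesh m.
Proof. by rewrite divr_gt0. Qed.

Lemma mesh_le m : mesh m <= s.
Proof. by rewrite /mesh ler_pdivrMr// ler_peMr ?(ltW s0)// ler1n. Qed.

Lemma mesh_small e : 0 < e -> exists m0, forall m, (m0 <= m)%N -> mesh m < e.
Proof.
move=> e0; have [m0 h] := exists_inv_lt (divr_gt0 e0 s0).
by exists m0 => m /h; rewrite ltr_pdivlMr// mulrC.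
Qed.

Lemma Bx_cube : Bx `<=` cube b s.
Proof.
move=> x xB i; have := xB i; rewrite /= addcE => /andP[/ltW -> h].
by rewrite h.
Qed.

Lemma cube_O : cube b (2 * s) `<=` O.
Proof.
move=> x xb; apply: bO => i; have := xb i; rewrite addcE => /andP[? ?].
by move: s0 => ?; apply/andP; split; lra.
Qed.

Lemma Bx_O : Bx `<=` O.
Proof.
move=> x /Bx_cube xb; apply: cube_O => i; have /andP[-> ?] := xb i.
by move: s0 => ?; rewrite /=; lra.
Qed.

Lemma measurable_Bx : measurable Bx.
Proof. exact: measurable_box. Qed.

Lemma leb_Bx_lty : (mu Bx < +oo)%E.
Proof.
apply: le_lt_trans (le_lebesgue_outer Bx_cube) _.
by have /andP[] := leb_cube_fin b s0.
Qed.

Lemma supported_cube F : supported F -> forall x, ~ cube b s x -> F x = 0.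
Proof. by move=> sF x bx; apply: sF => /Bx_cube. Qed.

Lemma vintegrable_vmeasurable F : vintegrable F -> vmeasurable setT F.
Proof. by move=> Fi i; exact: vintegrable_measurable. Qed.

Lemma vintegrableB F G : vintegrable F -> vintegrable G -> vintegrable (fun x => F x - G x).
Proof.
move=> Fi Gi i; rewrite (_ : (fun x => _) = (fun x => F x i 0 - G x i 0)).
  exact: (integrable_sub measurableT (Fi i) (Gi i)).
by apply/funext => x; rewrite !mxE.
Qed.

Lemma bounded_vintegrable F (C : R) : vmeasurable setT F -> supported F ->
  (forall x i, `|F x i 0| <= C) -> vintegrable F.
Proof.
move=> mF sF FC i.
apply: (bounded_support_integrable measurable_Bx leb_Bx_lty (mF i) (fun x => FC x i)).
by move=> x /sF ->; rewrite mxE.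
Qed.

Lemma vmeasurable_mollv D d F : vintegrable F -> vmeasurable D (mollv d F).
Proof. by move=> Fi i; exact: smooth_mollv_measurable. Qed.

Lemma sub_vmeasurable D F : vmeasurable setT F -> vmeasurable D F.
Proof. by move=> mF i; exact: measurable_funTS. Qed.

(** Closure of the convergence property under limits in modular, by the bound on mollification
    uniform in the scale. With H = F - G, the error of F is H minus (moll H - (G - moll G)), and
    each of the three parts is small. *)
Lemma good_approx F : vintegrable F -> supported F ->
  (forall e, 0 < e -> exists2 G, good G & (pmod O q W (fun x => (F x - G x)%R) <= e%:E)%E) ->
  good F.
Proof.
move=> Fi sF FG; split=> // e e0.
have [C C0 hC] := moll_bound S.
pose K : R := (n.+1%:R * 2) `^ P.
have K0 : 0 <= K by exact: powR_ge0.
(* The total loss: [pmodB] is applied twice, with factor [K] each time, and [moll_bound] contributes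
   C (eta + eta). *)
pose T := K * (1 + K * (2 * C + 1)).
have T0 : 0 <= T by rewrite !mulr_ge0// addr_ge0// mulr_ge0// addr_ge0// mulr_ge0.
pose eta : R := Num.min 2^-1 (e / (T + 1)).
have T1 : 0 < T + 1 by rewrite ltr_wpDl.
have eta0 : 0 < eta by rewrite lt_min invr_gt0 ltr0n divr_gt0.
have eta2 : eta <= 2^-1 by rewrite ge_min lexx.
have etaT : eta * T <= e.
  have : eta <= e / (T + 1) by rewrite ge_min lexx orbT.
  rewrite ler_pdivlMr// => h; apply: le_trans h.
  by rewrite ler_wpM2l ?(ltW eta0)// lerDl.
have [G gG FGeta] := FG _ eta0.
have [Gi sG cG] := gG; have [m1 hm1] := cG _ eta0.
have s1 : 0 < (2 * s) ^+ n.+1 by rewrite exprn_gt0// mulr_gt0.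
have /andP[d0_gt0 d0_lt1] := ws_scale S.
(* The mesh must be admissible for log-Holder continuity, keep the modular plus mesh^(n+2) at most 1
   together with eta <= 1/2, and make the grid error at most [eta]. *)
have min0 : 0 < Num.min d0 (Num.min 2^-1 (eta / (2 * s) ^+ n.+1)).
  by rewrite !lt_min d0_gt0 invr_gt0 ltr0n divr_gt0.
have [m2 hm2] := mesh_small min0.
exists (maxn m1 m2) => m; rewrite geq_max => /andP[/hm1 {}hm1 /hm2 {}hm2].
move: hm2; rewrite !lt_min => /and3P[md0 m2' /ltW meta].
have mesh1 : mesh m <= 1 by lra.
pose H x := F x - G x.
have Hi : vintegrable H by exact: vintegrableB.
have sH : supported H by move=> x bx; rewrite /H sF// sG// subrr.
have mHn : ((mesh m ^+ n.+2)%:E <= (2^-1)%:E)%E.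
  rewrite lee_fin exprSr; apply: le_trans (ltW m2').
  by rewrite ler_piMl ?(ltW (mesh_gt0 _))// exprn_ile1// ltW// mesh_gt0.
have step1 : (pmod O q W (mollv (mesh m) H) <= (C * (eta + eta))%:E)%E.
  apply: le_trans (hC b s m H s0 bO md0 Hi (supported_cube sH) _) _.
    apply: (le_trans (leeD FGeta mHn)).
    by rewrite -EFinD lee_fin; lra.
  rewrite [leRHS]EFinM; apply: lee_wpmul2l; first by rewrite lee_fin.
  rewrite [leRHS]EFinD; apply: (leeD FGeta); rewrite lee_fin; move: meta.
  by rewrite ler_pdivlMr// mulrC.
have mFO := sub_vmeasurable (D := O) (vintegrable_vmeasurable Fi).
have mGO := sub_vmeasurable (D := O) (vintegrable_vmeasurable Gi).
have mHO := sub_vmeasurable (D := O) (vintegrable_vmeasurable Hi).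
pose H2 x := mollv (mesh m) H x - (G x - mollv (mesh m) G x).
have mGM : vmeasurable O (fun x => G x - mollv (mesh m) G x).
  by apply: vmeasurableB; [assumption|exact: vmeasurable_mollv].
have mH2 : vmeasurable O H2.
  exact: (vmeasurableB (@vmeasurable_mollv O _ _ Hi) mGM).
have step2 : (pmod O q W H2 <= (K * (C * (eta + eta) + eta))%:E)%E.
  apply: le_trans (pmodB S mO (@subset_refl _ O) (@vmeasurable_mollv O _ _ Hi) mGM) _.
  rewrite [leRHS]EFinM; apply: lee_wpmul2l; first by rewrite lee_fin.
  by rewrite [leRHS]EFinD; exact: (leeD step1 hm1).
have -> : (fun x => F x - mollv (mesh m) F x) = (fun x => H x - H2 x).
  apply/funext => x; rewrite /H2 mollvB// /H.
  move: (mollv _ F x) (mollv _ G x) => u v.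
  by apply/matrixP => i j; rewrite !mxE; ring.
apply: le_trans (pmodB S mO (@subset_refl _ O) mHO mH2) _.
apply: (@le_trans _ _ (eta * T)%:E); last by rewrite lee_fin.
have -> : eta * T = K * (eta + K * (C * (eta + eta) + eta)) by rewrite /T; ring.
rewrite [leRHS]EFinM; apply: lee_wpmul2l; first by rewrite lee_fin.
by rewrite [leRHS]EFinD; exact: (leeD FGeta step2).
Qed.

Lemma good_sub F G : good F -> good G -> good (fun x => F x - G x).
Proof.
move=> [Fi sF cF] [Gi sG cG]; split.
- exact: vintegrableB.
- by move=> x bx; rewrite sF// sG// subrr.
move=> e e0; pose K : R := (n.+1%:R * 2) `^ P.
have K0 : 0 < K by apply: powR_gt0; rewrite mulr_gt0.
have eK : 0 < e / (K * 2) by rewrite divr_gt0// mulr_gt0.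
have [m1 h1] := cF _ eK; have [m2 h2] := cG _ eK.
exists (maxn m1 m2) => m; rewrite geq_max => /andP[/h1 {}h1 /h2 {}h2].
have -> : (fun x => F x - G x - mollv (mesh m) (fun x => F x - G x) x) =
    (fun x => (F x - mollv (mesh m) F x) - (G x - mollv (mesh m) G x)).
  apply/funext => x; rewrite mollvB//.
  move: (mollv _ F x) (mollv _ G x) => u v.
  by apply/matrixP => i j; rewrite !mxE; ring.
have mFO := sub_vmeasurable (D := O) (vintegrable_vmeasurable Fi).
have mGO := sub_vmeasurable (D := O) (vintegrable_vmeasurable Gi).
have mF' : vmeasurable O (fun x => F x - mollv (mesh m) F x).
  by apply: vmeasurableB; [assumption|exact: vmeasurable_mollv].
have mG' : vmeasurable O (fun x => G x - mollv (mesh m) G x).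
  by apply: vmeasurableB; [assumption|exact: vmeasurable_mollv].
apply: le_trans (pmodB S mO (@subset_refl _ O) mF' mG') _.
have -> : e = K * (e / (K * 2) + e / (K * 2)) by field; rewrite gt_eqF.
rewrite [leRHS]EFinM; apply: lee_wpmul2l; first by rewrite lee_fin ltW.
by rewrite [leRHS]EFinD; exact: (leeD h1 h2).
Qed.

Lemma good_scale (c : R) F : good F -> good (fun x => c *: F x).
Proof.
move=> [Fi sF cF].
have ci : vintegrable (fun x => c *: F x).
  move=> i; rewrite (_ : (fun x => _) = (fun x => c * F x i 0)); first exact: integrable_scale.
  by apply/funext => x; rewrite mxE.
split; first exact: ci.
  by move=> x bx; rewrite sF// scaler0.
move=> e e0; pose c1 := 1 + `|c|; have c11 : 1 <= c1 by rewrite lerDl.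
have K0 : 0 < c1 `^ P by apply: powR_gt0; exact: lt_le_trans c11.
have [m1 h1] := cF _ (divr_gt0 e0 K0); exists m1 => m /h1 {}h1.
have mFO := sub_vmeasurable (D := O) (vintegrable_vmeasurable Fi).
have mcO := sub_vmeasurable (D := O) (vintegrable_vmeasurable ci).
have mF' : vmeasurable O (fun x => F x - mollv (mesh m) F x).
  by apply: vmeasurableB; [assumption|exact: vmeasurable_mollv].
have mc' : vmeasurable O (fun x => c *: F x - mollv (mesh m) (fun x => c *: F x) x).
  by apply: vmeasurableB; [assumption|exact: vmeasurable_mollv].
apply: le_trans (pmod_le S mO (@subset_refl _ O) mc' mF' c11 _) _.
  move=> x _; have -> : mollv (mesh m) (fun x => c *: F x) x = c *: mollv (mesh m) F x.
    apply/matrixP => i j; rewrite !mxE -mollZ//.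
    by apply: eq_moll => y /=; rewrite !mxE.
  rewrite -scalerBr -scalemxAr enormZ ler_wpM2r ?enorm_ge0//.
  by rewrite /c1 lerDr.
have -> : e = c1 `^ P * (e / c1 `^ P) by rewrite mulrC divfK// gt_eqF.
rewrite [leRHS]EFinM; apply: lee_wpmul2l; first by rewrite lee_fin ltW.
exact: h1.
Qed.

Lemma good0 : good (fun=> 0).
Proof.
split.
- move=> i; rewrite (_ : EFin \o _ = cst 0%E); first exact: integrable0.
  by apply/funext => x /=; rewrite mxE.
- by [].
move=> e e0; exists 0%N => m _; apply: (@le_trans _ _ 0%E); last by rewrite lee_fin ltW.
rewrite /pmod (eq_integral (fun=> 0%E)) ?integral0// => x /set_mem Ox.
have -> : mollv (mesh m) (fun=> 0) x = 0.
  apply/matrixP => i j; rewrite !mxE -[RHS](moll0 (mesh m) x).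
  by apply: eq_moll => y /=; rewrite ?mxE.
rewrite subr0 mulmx0 enorm0 powR0//.
by have /andP[h _] := q1P Ox; rewrite gt_eqF//; lra.
Qed.

Lemma good_add F G : good F -> good G -> good (fun x => F x + G x).
Proof.
move=> gF gG; have := good_sub gF (good_scale (-1) gG).
congr good; apply/funext => x.
by rewrite scaleN1r opprK.
Qed.

Lemma good_sum m (F : nat -> V -> 'cV[R]_n.+1) : (forall k, good (F k)) ->
  good (fun x => \sum_(k < m) F k x).
Proof.
move=> gF; elim: m => [|m IH].
  have := good0; congr good; apply/funext => x.
  by rewrite big_ord0.
have := good_add IH (gF m); congr good; apply/funext => x.
by rewrite big_ord_recr.
Qed.

End good.

(** * Sets whose indicators are locally constant to the lower left *)

Section left_constant.
Context {R : realType} {n : nat}.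
Notation V := 'rV[R]_n.+1.
Implicit Types (E : set V).

(* Half-open boxes have this property, so that mollification from the lower
   left reproduces their indicators at every point, for small scales. *)
Definition left_constant E := forall x, exists2 r : R, 0 < r &
  forall y, lower_cube r x y -> (E y <-> E x).

Lemma lower_cube_le (r r' : R) (x : V) : r <= r' -> lower_cube r x `<=` lower_cube r' x.
Proof. by move=> rr y xy i; have /andP[? ->] := xy i; rewrite andbT; lra. Qed.

Lemma left_constant0 : left_constant set0.
Proof. by move=> x; exists 1. Qed.

Lemma left_constantT : left_constant setT.
Proof. by move=> x; exists 1. Qed.

Lemma left_constantU E E' : left_constant E -> left_constant E' -> left_constant (E `|` E').
Proof.
move=> cE cE' x; have [r r0 hr] := cE x; have [r' r'0 hr'] := cE' x.
exists (Num.min r r'); first by rewrite lt_min r0.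
move=> y xy; rewrite /setU/=; rewrite (hr y) ?(hr' y)//.
  by apply: lower_cube_le xy; rewrite ge_min lexx orbT.
by apply: lower_cube_le xy; rewrite ge_min lexx.
Qed.

Lemma left_constantI E E' : left_constant E -> left_constant E' -> left_constant (E `&` E').
Proof.
move=> cE cE' x; have [r r0 hr] := cE x; have [r' r'0 hr'] := cE' x.
exists (Num.min r r'); first by rewrite lt_min r0.
move=> y xy; rewrite /setI/=; rewrite (hr y) ?(hr' y)//.
  by apply: lower_cube_le xy; rewrite ge_min lexx orbT.
by apply: lower_cube_le xy; rewrite ge_min lexx.
Qed.

Lemma exists_min_ord m (f : 'I_m -> R) : (forall i, 0 < f i) ->
  exists2 r : R, 0 < r & forall i, r <= f i.
Proof.
elim: m f => [|m IH] f f0; first by exists 1 => // -[].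
have [r r0 hr] := IH (fun i => f (lift ord0 i)) (fun i => f0 _).
exists (Num.min r (f ord0)); first by rewrite lt_min r0 f0.
move=> i; case: (unliftP ord0 i) => [j ->|->]; last by rewrite ge_min lexx orbT.
by rewrite ge_min hr.
Qed.

(** The side on which boxes are open matters. From inside, one may move down by less than the
    distance to the lower faces; from a point with a coordinate at or below its lower bound, moving
    down stays outside; above an upper bound there is a positive gap. *)
Lemma left_constant_box c : left_constant (@box R n c).
Proof.
move=> x; have [xc|xc] := pselect (box c x).
  have [|r r0 hr] := @exists_min_ord _ (fun i => x 0 i - c.1 0 i).
    by move=> i; have /andP[h _] := xc i; rewrite subr_gt0.
  exists r => // y xy; split=> // _ i.
  have := xy i; have := hr i; have /andP[h1 h2] := xc i => ? /andP[? ?].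
  by apply/andP; split; lra.
have /existsNP[i /negP] : ~ forall i, c.1 0 i < x 0 i <= c.2 0 i by [].
rewrite negb_and -leNgt -ltNge => /orP[h|h].
  exists 1 => // y xy; split=> [yc|/xc//]; exfalso.
  by have /andP[h1 _] := yc i; have /andP[_ h2] := xy i; move: h1 h2; lra.
exists (x 0 i - c.2 0 i); first by rewrite subr_gt0.
move=> y xy; split=> [yc|/xc//]; exfalso.
by have /andP[_ h1] := yc i; have /andP[h2 _] := xy i; move: h1 h2; lra.
Qed.

Fixpoint finU (c : nat -> set V) J : set V := if J is J'.+1 then finU c J' `|` c J' else set0.
Fixpoint finI (c : nat -> set V) J : set V := if J is J'.+1 then finI c J' `&` c J' else setT.

Lemma finUP c J x : finU c J x <-> exists2 j, (j < J)%N & c j x.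
Proof.
elim: J => [|J IH] /=; first by split=> // -[].
split=> [[/IH[j jJ cj]|cJ]|[j]].
- by exists j => //; exact: ltnW.
- by exists J.
- rewrite ltnS leq_eqVlt => /orP[/eqP -> ?|jJ cj]; first by right.
  by left; apply/IH; exists j.
Qed.

Lemma finIP c J x : finI c J x <-> forall j, (j < J)%N -> c j x.
Proof.
elim: J => [|J IH] /=; first by split.
split=> [[/IH h cJ] j|h].
  by rewrite ltnS leq_eqVlt => /orP[/eqP ->//|]; exact: h.
by split; [apply/IH => j jJ; apply: h; exact: ltnW|exact: h].
Qed.

Lemma left_constant_finU c J : (forall j, left_constant (c j)) -> left_constant (finU c J).
Proof.
by move=> cc; elim: J => [|J IH] /=; [exact: left_constant0|exact: left_constantU].
Qed.

Lemma left_constant_finI c J : (forall j, left_constant (c j)) -> left_constant (finI c J).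
Proof.
by move=> cc; elim: J => [|J IH] /=; [exact: left_constantT|exact: left_constantI].
Qed.

Lemma measurable_finU c J : (forall j, measurable (c j)) -> measurable (finU c J).
Proof. by move=> mc; elim: J => [|J IH] /=; [exact: measurable0|exact: measurableU]. Qed.

Lemma measurable_finI c J : (forall j, measurable (c j)) -> measurable (finI c J).
Proof. by move=> mc; elim: J => [|J IH] /=; [exact: measurableT|exact: measurableI]. Qed.

End left_constant.

(** The sum counts the positive integers up to t, so it is the integer part of t; superlevel sets
    thus approximate a bounded function uniformly. *)
Lemma floor_sum (R : realType) (t : R) J : 0 <= t <= J%:R ->
  `|t - \sum_(i < J) (i.+1%:R <= t)%R%:R| <= 1.
Proof.
elim: J => [|J IH] in t *.
  by rewrite big_ord0 subr0 => /andP[t0 t1]; rewrite ger0_norm//; lra.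
move=> /andP[t0 tJ]; rewrite big_ord_recr/=.
have [tJ'|tJ'] := leP t J%:R.
  have -> : (J.+1%:R <= t) = false.
    by apply/negbTE; rewrite -ltNge (le_lt_trans tJ')// ltr_nat.
  by rewrite addr0; apply: IH; rewrite t0.
rewrite (eq_bigr (fun=> 1)) => [|i _]; last first.
  by have -> : i.+1%:R <= t by rewrite ltW// (le_lt_trans _ tJ')// ler_nat.
rewrite sumr_const card_ord -[1 *+ J]/(J%:R); rewrite -natr1 in tJ *.
by case: (J%:R + 1 <= t) => /=; rewrite ler_norml; apply/andP; split; lra.
Qed.

Lemma powR_le_self (R : realType) (t q : R) : 0 <= t <= 1 -> 1 <= q -> t `^ q <= t.
Proof.
move=> /andP[t0 t1] q1; have [->|tn] := eqVneq t 0.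
  by rewrite powR0// gt_eqF//; apply: lt_le_trans q1.
by apply: ge1r_powR => //; rewrite lt0r tn t0.
Qed.

(** * From half-open boxes to all fields of finite modular *)

Section density.
Context {R : realType} {n : nat}.
Notation V := 'rV[R]_n.+1.
Notation mu := (@leb R n).
Implicit Types (F G : V -> 'cV[R]_n.+1) (D E : set V) (e r d : R).
Context (O : set V) (q : V -> R) (W : V -> 'M[R]_n.+1) (A P L d0 : R).
Context (S : weight_setting O q W A P L d0).
Context (b : V) (s : R) (s0 : 0 < s) (bO : cube (addc b (- s)) (4 * s) `<=` O).

Let oO := ws_open S.
Let mO := measurable_open oO.
Let q1P := ws_exponent S.
Let OO := @subset_refl _ O.
Notation good := (good O q W b s).
Notation supported := (supported b s).
Notation Bx := (Bx b s).

(** Dominated convergence gives convergence in modular under the common envelope [H]; [good_approx]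
    then applies. *)
Lemma good_dom F (Fk : nat -> V -> 'cV[R]_n.+1) (H : V -> R) :
  (forall k, good (Fk k)) -> vintegrable F -> supported F ->
  measurable_fun O H -> (forall x, O x -> 0 <= H x) ->
  (\int[mu]_(x in O) (H x `^ q x)%:E < +oo)%E ->
  (forall k x, O x -> enorm (W x *m Fk k x) <= H x) ->
  (forall x, O x -> enorm (W x *m F x) <= H x) ->
  (forall x, O x -> forall e, 0 < e -> exists K, forall k, (K <= k)%N ->
     forall i, `|(F x - Fk k x) i 0| <= e) -> good F.
Proof.
move=> gk Fi sF mH H0 Hoo kH FH lim; apply: (good_approx S s0 bO Fi sF) => e e0.
have mF : vmeasurable O F by exact: (sub_vmeasurable (vintegrable_vmeasurable Fi)).
have mk k : vmeasurable O (Fk k).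
  exact: (sub_vmeasurable (vintegrable_vmeasurable (good_integrable (gk k)))).
pose N : R := n.+1%:R; have N1 : 1 <= N by rewrite ler1n.
have N0 : 0 < N by rewrite ltr0n.
pose g k x := enorm (W x *m (F x - Fk k x)) `^ q x.
have mg k : measurable_fun O (g k).
  exact: (ws_integrand S mO OO (vmeasurableB mF (mk k))).
have mHq : measurable_fun O (fun x => H x `^ q x).
  exact: (measurable_powR2 mO mH (ws_measurable_exponent S)).
pose h x := (N * 2) `^ P * H x `^ q x.
have mh : measurable_fun O h by exact: (measurable_funM (measurable_cst _) mHq).
have hoo : (\int[mu]_(x in O) (h x)%:E < +oo)%E.
  rewrite (int_scale mO mHq) ?powR_ge0//; last by move=> *; exact: powR_ge0.
  by apply: lte_mul_pinfty; rewrite ?lee_fin ?powR_ge0.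
have gh k x : O x -> 0 <= g k x <= h x.
  move=> Ox; rewrite /g powR_ge0/= /h.
  have /andP[q1 qP] := q1P Ox.
  have NN : 1 <= N * 2 by lra.
  apply: le_trans (powR_const_le NN (H0 x Ox) qP).
  apply: le_powR_l; [lra|exact: enorm_ge0|].
  rewrite mulmxBr; have := enorm_sum_le [:: W x *m F x; - (W x *m Fk k x)] id.
  rewrite !big_cons !big_nil !addr0 enormN => /le_trans; apply.
  rewrite -/N -mulrA ler_wpM2l ?(ltW N0)//.
  by have := kH k x Ox; have := FH x Ox; lra.
have g0 x : O x -> forall r, 0 < r -> exists K, forall k, (K <= k)%N -> g k x <= r.
  move=> Ox r r0; pose M := N * (N * (enorm (W x) * N)).
  have M0 : 0 <= M by rewrite !mulr_ge0// ?enorm_ge0 ?(ltW N0).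
  have M1 : 0 < M + 1 by rewrite ltr_wpDl.
  (* At a fixed x the matrix [W x] is a constant, so coordinatewise smallness suffices; the cap 1
     ensures t^q <= t. *)
  pose m := Num.min r 1; have m0 : 0 < m by rewrite lt_min r0 ltr01.
  have [K hK] := lim x Ox _ (divr_gt0 m0 M1); exists K => k /hK {}hK.
  have tm : enorm (W x *m (F x - Fk k x)) <= m.
    apply: le_trans (enorm_mulmx_le _ _) _.
    apply: (@le_trans _ _ (M * (m / (M + 1)))).
      rewrite /M -!mulrA !ler_wpM2l ?(ltW N0) ?enorm_ge0//.
      exact: enorm_le_const.
    rewrite mulrCA ler_piMr ?(ltW m0)// ler_pdivrMr// mul1r lerDl//.
  have /andP[q1 _] := q1P Ox.
  apply: le_trans (powR_le_self _ q1) _.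
    by rewrite enorm_ge0 (le_trans tm)// /m ge_min lexx orbT.
  by rewrite (le_trans tm)// /m ge_min lexx.
have [K hK] := dominated_null mO mg mh hoo gh g0 e0.
by exists (Fk K); [exact: gk|exact: hK].
Qed.

Lemma indic_integral_O D (h : V -> R) : measurable D -> D `<=` O -> measurable_fun O h ->
  (forall x, O x -> 0 <= h x) ->
  (\int[mu]_(x in O) (\1_D x * h x)%:E = \int[mu]_(x in D) (h x)%:E)%E.
Proof.
move=> mD DO mh h0.
have := sum_integral_indic (I := 'I_1) mO (fun=> mD) (fun=> DO) mh h0.
by rewrite big_ord1 => ->; apply: eq_integral => x _; rewrite big_ord1.
Qed.

Lemma vmeasurable_ecol (f : V -> R) j : measurable_fun setT f ->
  vmeasurable setT (fun x => f x *: ecol j).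
Proof.
move=> mf i; rewrite (_ : (fun x => _) = (fun x => f x * ecol j i 0)).
  exact: (measurable_funM mf (measurable_cst _)).
by apply/funext => x; rewrite mxE.
Qed.

Lemma ecol_le1 j i : `|(ecol j : 'cV[R]_n.+1) i 0| <= 1.
Proof. by rewrite mxE eqxx andbT; case: (i == j); rewrite ?normr1 ?normr0. Qed.

Lemma vintegrable_ecol (f : V -> R) j (C : R) : measurable_fun setT f ->
  (forall x, ~ Bx x -> f x = 0) -> (forall x, `|f x| <= C) ->
  vintegrable (fun x => f x *: ecol j).
Proof.
move=> mf f0 fC; apply: (bounded_vintegrable s0 (C := C) (vmeasurable_ecol j mf)).
  by move=> x /f0 ->; rewrite scale0r.
move=> x i; rewrite mxE normrM; apply: le_trans (fC x).
by rewrite ler_piMr// ecol_le1.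
Qed.

(** The envelope is C |W e_j| on the box, whose q-th power is integrable by [pmod_ecol_lty]. *)
Lemma good_dom_ecol j (C : R) (f : V -> R) (fk : nat -> V -> R) : 0 <= C ->
  (forall k, good (fun x => fk k x *: ecol j)) -> measurable_fun setT f ->
  (forall x, ~ Bx x -> f x = 0) -> (forall k x, ~ Bx x -> fk k x = 0) ->
  (forall x, `|f x| <= C) -> (forall k x, `|fk k x| <= C) ->
  (forall x e, 0 < e -> exists K, forall k, (K <= k)%N -> `|f x - fk k x| <= e) ->
  good (fun x => f x *: ecol j).
Proof.
move=> C0 gk mf f0 fk0 fC fkC lim.
pose v x := enorm (W x *m ecol j).
have mv : measurable_fun O v.
  exact: (@measurable_mulmx _ _ O W (fun=> ecol j) (ws_measurable_weight S) (fun i => measurable_cst (ecol j i 0))).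
have v0 x : 0 <= v x by exact: enorm_ge0.
pose H x := \1_Bx x * (C * v x).
have mBx := measurable_Bx b s.
have mvq : measurable_fun O (fun x => v x `^ q x).
  exact: (measurable_powR2 mO mv (ws_measurable_exponent S)).
have mH : measurable_fun O H.
  exact: (measurable_funM (measurable_indic mBx) (measurable_funM (measurable_cst _) mv)).
have H0 x : O x -> 0 <= H x.
  by move=> _; rewrite /H mulr_ge0 ?mulr_ge0// indicE.
have bound (g : V -> R) : (forall x, ~ Bx x -> g x = 0) -> (forall x, `|g x| <= C) ->
    forall x, O x -> enorm (W x *m (g x *: ecol j)) <= H x.
  move=> g0 gC x Ox; rewrite -scalemxAr enormZ /H.
  have [Bx'|/[dup]/g0 -> Bx'] := pselect (Bx x).
    by rewrite indicE mem_set// mul1r ler_wpM2r// v0.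
  by rewrite normr0 mul0r indicE memNset// mul0r.
apply: (good_dom (Fk := fun k x => fk k x *: ecol j) gk (vintegrable_ecol j mf f0 fC) _ mH H0).
- by move=> x /f0 ->; rewrite scale0r.
- have BxO := Bx_O s0 bO.
  have c1 : 1 <= 1 + C by rewrite lerDl.
  have p0 : 0 <= (1 + C) `^ P by exact: powR_ge0.
  apply: (@le_lt_trans _ _ (\int[mu]_(x in O) ((1 + C) `^ P * (\1_Bx x * v x `^ q x))%:E)%E).
    apply: (le_int mO (measurable_powR2 mO mH (ws_measurable_exponent S))).
      exact: (measurable_funM (measurable_cst _) (measurable_funM (measurable_indic mBx) mvq)).
    move=> x Ox; split; first exact: powR_ge0.
    have /andP[q1 qP] := q1P Ox; rewrite /H.
    have [Bx'|Bx'] := pselect (Bx x); last first.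
      by rewrite indicE memNset// !mul0r mulr0 powR0// gt_eqF//; lra.
    rewrite indicE mem_set// !mul1r; apply: le_trans (powR_const_le c1 (v0 x) qP).
    apply: le_powR_l; [lra|by rewrite mulr_ge0|].
    by rewrite ler_wpM2r// lerDr.
  rewrite (int_scale mO (measurable_funM (measurable_indic mBx) mvq)) //; last first.
    by move=> x _ /=; rewrite mulr_ge0 ?powR_ge0// indicE.
  apply: lte_mul_pinfty; rewrite ?lee_fin//.
  rewrite (indic_integral_O mBx BxO mvq); last by move=> *; exact: powR_ge0.
  have cO : cube b s `<=` O.
    move=> x xb; apply: (cube_O s0 bO) => i; have /andP[-> ?] := xb i.
    by move: s0 => ?; rewrite /=; lra.
  have mc := measurable_cube b s.
  apply: le_lt_trans (pmod_ecol_lty S j s0 cO).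
  apply: (int_subset mBx mc (measurable_funS mO cO mvq) _ (@Bx_cube _ _ b s)).
  by move=> *; exact: powR_ge0.
- by move=> k; exact: (bound (fk k) (fk0 k) (fkC k)).
- exact: (bound f f0 fC).
- move=> x Ox e e0; have [K hK] := lim x e e0; exists K => k /hK {}hK i.
  rewrite -scalerBl mxE normrM; apply: le_trans hK.
  by rewrite ler_piMr// ecol_le1.
Qed.

Lemma mollv_ecol d (f : V -> R) j x : mu.-integrable setT (EFin \o f) ->
  mollv d (fun y => f y *: ecol j) x = moll d f x *: ecol j.
Proof.
move=> fi; apply/matrixP => i k; rewrite (ord1 k) !mxE mulrC -mollZ//.
by apply: eq_moll => y; rewrite !mxE mulrC.
Qed.

Lemma indic_Bx_integrable E : measurable E -> E `<=` Bx ->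
  mu.-integrable setT (EFin \o (\1_E : V -> R)).
Proof.
move=> mE EB.
apply: (bounded_support_integrable (measurable_Bx b s) (leb_Bx_lty b s0)
  (measurable_indic mE) (C := 1)).
  by move=> x; rewrite indicE; case: (x \in E); rewrite ?normr1 ?normr0.
by move=> x xB; rewrite indicE memNset// => /EB.
Qed.

(** The base case: at each point the mollified indicator equals the indicator once the mesh is
    small, so the error is eventually 0 there; it is dominated by |W e_j|^q on the cube of side 2
    s. *)
Lemma good_left E j : measurable E -> E `<=` Bx -> left_constant E ->
  good (fun x => (\1_E x : R) *: ecol j).
Proof.
move=> mE EB cE; have E1 x : `|\1_E x : R| <= 1.
  by rewrite indicE; case: (x \in E); rewrite ?normr1 ?normr0.
have Eout x : ~ Bx x -> \1_E x = 0 :> R.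
  by move=> xB; rewrite indicE memNset// => /EB.
have Ei := indic_Bx_integrable mE EB.
have vi := vintegrable_ecol j (measurable_indic mE) Eout E1.
split; first exact: vi.
  by move=> x /Eout ->; rewrite scale0r.
pose Q := cube b (2 * s).
have mQ : measurable Q by exact: measurable_cube.
have QO : Q `<=` O := cube_O s0 bO.
pose v x := enorm (W x *m ecol j).
have v0 x : 0 <= v x by exact: enorm_ge0.
have mv : measurable_fun O v.
  exact: (@measurable_mulmx _ _ O W (fun=> ecol j) (ws_measurable_weight S)
    (fun i => measurable_cst (ecol j i 0))).
have mvq : measurable_fun O (fun x => v x `^ q x).
  exact: (measurable_powR2 mO mv (ws_measurable_exponent S)).
pose t m x : R := \1_E x - moll (mesh s m) \1_E x.
have tE m x : ((\1_E x : R) *: ecol j - mollv (mesh s m) (fun y => (\1_E y : R) *: ecol j) x) =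
    t m x *: ecol j.
  by rewrite mollv_ecol// scalerBl.
have t1 m x : `|t m x| <= 1.
  have E01 (y : V) : 0 <= (\1_E y : R) <= 1.
    by rewrite indicE; case: (y \in E); rewrite /= ?lexx ?ler01.
  have /andP[a1 a2] := moll_range x (mesh_gt0 s0 m) Ei E01.
  have /andP[a3 a4] := E01 x.
  by rewrite ler_norml /t; apply/andP; split; lra.
have tout m x : ~ Q x -> t m x = 0.
  move=> xQ; rewrite /t Eout; last first.
    by move=> /Bx_cube xb; apply: xQ => i; have /andP[-> h] := xb i; move: s0 => ? /=; lra.
  rewrite (@moll_const _ _ _ _ 0) ?subrr//; first exact: mesh_gt0.
  move=> y xy; apply: Eout => /Bx_cube yb; apply: xQ => i.
  have /andP[y1 y2] := yb i; have /andP[y3 y4] := xy i.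
  have := mesh_le s0 m; move: s0 => ? ?; apply/andP; split; lra.
pose h x := \1_Q x * v x `^ q x.
have mh : measurable_fun O h by exact: (measurable_funM (measurable_indic mQ) mvq).
have vq0 x : O x -> 0 <= v x `^ q x by move=> _; exact: powR_ge0.
have hoo : (\int[mu]_(x in O) (h x)%:E < +oo)%E.
  rewrite (indic_integral_O mQ QO mvq vq0).
  by apply: (pmod_ecol_lty S j _ QO); rewrite mulr_gt0.
pose g m x := enorm (W x *m (((\1_E x : R) *: ecol j)
  - mollv (mesh s m) (fun y => (\1_E y : R) *: ecol j) x)) `^ q x.
have mg m : measurable_fun O (g m).
  apply: (ws_integrand S mO OO); apply: vmeasurableB.
    exact: (sub_vmeasurable (vmeasurable_ecol j (measurable_indic mE))).
  exact: (@vmeasurable_mollv _ _ O (mesh s m) _ vi).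
have gE m x : g m x = (`|t m x| * v x) `^ q x.
  by rewrite /g tE -scalemxAr enormZ.
have gh m x : O x -> 0 <= g m x <= h x.
  move=> Ox; rewrite gE powR_ge0/= /h; have /andP[q1 _] := q1P Ox.
  have [Qx|Qx] := pselect (Q x); last first.
    by rewrite tout// normr0 mul0r powR0 ?gt_eqF//; [rewrite mulr_ge0 ?powR_ge0|lra].
  rewrite indicE mem_set// mul1r; apply: le_powR_l; first lra.
    by rewrite mulr_ge0.
  by rewrite ler_piMl.
move=> e e0; apply: (dominated_null mO mg mh hoo gh _ e0) => x Ox r r0.
have [d dgt hd] := cE x; have [m0 hm0] := mesh_small s0 dgt.
exists m0 => m /hm0 md; rewrite gE /t (@moll_const _ _ _ _ (\1_E x)).
- have /andP[q1 _] := q1P Ox.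
  by rewrite subrr normr0 mul0r powR0 ?(ltW r0)// gt_eqF//; lra.
- exact: mesh_gt0.
move=> y /(lower_cube_le (ltW md)) /hd yx; rewrite !indicE.
by have -> : (y \in E) = (x \in E) by apply/idP/idP => /set_mem/yx/mem_set.
Qed.

Lemma indic_le1 E x : `|\1_E x : R| <= 1.
Proof. by rewrite indicE; case: (x \in E); rewrite ?normr1 ?normr0. Qed.

Lemma good_indic_lim E (Ek : nat -> set V) j : measurable E -> E `<=` Bx ->
  (forall k, Ek k `<=` Bx) ->
  (forall k, good (fun x => (\1_(Ek k) x : R) *: ecol j)) ->
  (forall x, exists K, forall k, (K <= k)%N -> (Ek k x <-> E x)) ->
  good (fun x => (\1_E x : R) *: ecol j).
Proof.
move=> mE EB EkB gk lim.
apply: (@good_dom_ecol j 1 (\1_E) (fun k => \1_(Ek k)) ler01 gk (measurable_indic mE)).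
- by move=> x xB; rewrite indicE memNset// => /EB.
- by move=> k x xB; rewrite indicE memNset// => /EkB.
- exact: indic_le1.
- by move=> k; exact: indic_le1.
move=> x e e0; have [K hK] := lim x; exists K => k /hK {}hK; rewrite !indicE.
have -> : (x \in Ek k) = (x \in E) by apply/idP/idP => /set_mem/hK/mem_set.
by rewrite subrr normr0 ltW.
Qed.

Lemma finU_lim (c : nat -> set V) x :
  exists J0, forall J, (J0 <= J)%N -> (finU c J x <-> (\bigcup_j c j) x).
Proof.
have [[j _ cj]|nc] := pselect ((\bigcup_j c j) x).
  exists j.+1 => J jJ; split=> _; first by exists j.
  by apply/finUP; exists j.
by exists 0%N => J _; split=> // /finUP[j _ cj]; exists j.
Qed.

Lemma finI_lim (c : nat -> nat -> set V) (c' : nat -> set V) K x :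
  (forall k, exists J0, forall J, (J0 <= J)%N -> (c k J x <-> c' k x)) ->
  exists J0, forall J, (J0 <= J)%N -> (finI (fun k => c k J) K x <-> finI c' K x).
Proof.
move=> h; elim: K => [|K [J1 h1]]; first by exists 0%N.
have [J2 h2] := h K; exists (maxn J1 J2) => J; rewrite geq_max => /andP[/h1 [a1 a2] /h2 [b1 b2]].
by split=> -[u v]; split; [exact: a1|exact: b1|exact: a2|exact: b2].
Qed.

Lemma finI_bigcap (c : nat -> set V) x :
  exists J0, forall J, (J0 <= J)%N -> (finI c J x <-> (\bigcap_j c j) x).
Proof.
have [xc|nc] := pselect ((\bigcap_j c j) x).
  by exists 0%N => J _; split=> // _; apply/finIP => j _; exact: xc.
have [j nj] : exists j, ~ c j x.
  by apply/existsNP => h; apply: nc => j _; exact: h.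
by exists j.+1 => J jJ; split=> [/finIP/(_ j jJ)//|/nc].
Qed.

(** The class of sets grows by pointwise limits of indicators: finite intersections of finite unions
    of boxes, then finite intersections of countable unions, then countable intersections;
    [box_cover_Gdelta] reaches [E] up to a null set. *)
Lemma good_indic E j : measurable E -> E `<=` Bx -> good (fun x => (\1_E x : R) *: ecol j).
Proof.
move=> mE EB; have mBx := measurable_Bx b s.
have Eoo : (mu E < +oo)%E.
  by apply: le_lt_trans (le_lebesgue_outer EB) _; exact: leb_Bx_lty.
have [c [cE cG]] := box_cover_Gdelta mE Eoo.
pose U k : set V := \bigcup_i box (c k i).
have mU k : measurable (U k) by apply: bigcup_measurable => i _; exact: measurable_box.
have mfU k J : measurable (finU (fun i => box (c k i)) J).
  by apply: measurable_finU => i; exact: measurable_box.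
have gAKJ K J : good (fun x =>
    (\1_(Bx `&` finI (fun k => finU (fun i => box (c k i)) J) K) x : R) *: ecol j).
  apply: good_left.
  - by apply: (measurableI _ _ mBx); apply: measurable_finI.
  - by move=> x [].
  apply: left_constantI; first exact: left_constant_box.
  by apply: left_constant_finI => k; apply: left_constant_finU => i; exact: left_constant_box.
have gAK K : good (fun x => (\1_(Bx `&` finI U K) x : R) *: ecol j).
  apply: (good_indic_lim _ _ _ (gAKJ K)).
  - by apply: (measurableI _ _ mBx); apply: measurable_finI.
  - by move=> x [].
  - by move=> k x [].
  move=> x; have [J0 hJ0] := @finI_lim (fun k => finU (fun i => box (c k i))) U K x
    (fun k => finU_lim _ x).
  by exists J0 => J /hJ0[h1 h2]; split=> -[xB xJ]; split=> //; [exact: h1|exact: h2].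
pose G := Bx `&` \bigcap_k U k.
have mUI : measurable (\bigcap_k U k) by apply: bigcap_measurable.
have mG : measurable G by exact: (measurableI _ _ mBx mUI).
have GB : G `<=` Bx by move=> x [].
have gG : good (fun x => (\1_G x : R) *: ecol j).
  apply: (good_indic_lim mG GB _ gAK); first by move=> k x [].
  move=> x; have [J0 hJ0] := finI_bigcap U x.
  by exists J0 => J /hJ0[h1 h2]; split=> -[xB xJ]; split=> //; [exact: h1|exact: h2].
have Eout x : ~ Bx x -> \1_E x = 0 :> R.
  by move=> xB; rewrite indicE memNset// => /EB.
have viE := vintegrable_ecol j (measurable_indic mE) Eout (indic_le1 E).
apply: (good_approx S s0 bO viE).
  by move=> x /Eout ->; rewrite scale0r.
(* The two fields differ only on [G] minus [E], which is null, so the modular of the difference is 0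
   for every [e]. *)
move=> e e0; exists (fun x => (\1_G x : R) *: ecol j); first exact: gG.
have EG : E `<=` G by move=> x Ex; split; [exact: EB|move=> k _; exact: cE].
have mN : measurable (G `\` E) by apply: measurableD.
have N0 : mu (G `\` E) = 0%E.
  apply: (subset_measure0 mN (measurableD mUI mE) _ cG).
  by move=> x [[_ Gx] nE].
have mEG : vmeasurable O (fun x => (\1_E x : R) *: ecol j - (\1_G x : R) *: ecol j).
  by apply: vmeasurableB; apply: sub_vmeasurable; apply: vmeasurable_ecol; apply: measurable_indic.
apply: (@le_trans _ _ 0%E); last by rewrite lee_fin ltW.
have mg := ws_integrand S mO OO mEG.
rewrite /pmod (@ge0_negligible_integral _ _ _ mu O (G `\` E) _ mN mO)//.
- rewrite (eq_integral (fun=> 0%E)) ?integral0// => x /set_mem [Ox nGE].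
  have -> : \1_E x = \1_G x :> R.
    rewrite !indicE; have -> // : (x \in E) = (x \in G).
    apply/idP/idP => /set_mem xE; apply/mem_set; first exact: EG.
    by apply: contrapT => nE; apply: nGE.
  rewrite subrr mulmx0 enorm0 powR0// gt_eqF//.
  by have /andP[h _] := q1P Ox; lra.
- by apply/measurable_EFinP.
- by move=> x _; rewrite lee_fin powR_ge0.
Qed.

(** Layer-cake approximation with levels (i+1)/(k+1): summing the indicators of the superlevel sets
    with weight 1/(k+1) is uniformly within 1/(k+1) of f, by [floor_sum] applied to (k+1) f. *)
Lemma good_nonneg (f : V -> R) (M : nat) j : measurable_fun setT f ->
  (forall x, ~ Bx x -> f x = 0) -> (forall x, 0 <= f x <= M%:R) ->
  good (fun x => f x *: ecol j).
Proof.
move=> mf f0 fM.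
pose E k i : set V := f @^-1` `[i.+1%:R / k.+1%:R, +oo[%classic.
have mE k i : measurable (E k i).
  by rewrite -[X in measurable X]setTI; apply: mf => //; exact: measurable_itv.
have EB k i : E k i `<=` Bx.
  move=> x; rewrite /E/= in_itv/= andbT => h; apply: contrapT => /f0 fx.
  by move: h; rewrite fx leNgt divr_gt0.
pose fk k x : R := \sum_(i < k.+1 * M) k.+1%:R^-1 * \1_(E k i) x.
have fkE k x : fk k x =
    k.+1%:R^-1 * \sum_(i < k.+1 * M) ((i.+1%:R : R) <= f x * k.+1%:R)%R%:R.
  rewrite /fk mulr_sumr; apply: eq_bigr => i _; rewrite indicE; congr (_ * _).
  have -> // : (x \in E k i) = (i.+1%:R <= f x * k.+1%:R).
  rewrite -ler_pdivrMr//; apply/idP/idP => [/set_mem|h].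
    by rewrite /E/= in_itv/= andbT.
  by apply/mem_set; rewrite /E/= in_itv/= andbT.
have close k x : `|f x - fk k x| <= k.+1%:R^-1.
  have /andP[fx0 fxM] := fM x.
  have h : 0 <= f x * k.+1%:R <= (k.+1 * M)%N%:R.
    by rewrite mulr_ge0//= natrM [leRHS]mulrC ler_wpM2r.
  have := floor_sum h; rewrite fkE; set T := \sum_(i < _) _ => hT.
  have -> : f x - k.+1%:R^-1 * T = k.+1%:R^-1 * (f x * k.+1%:R - T).
    by rewrite mulrBr mulrCA mulVf ?mulr1.
  by rewrite normrM ger0_norm ?invr_ge0// ler_piMr ?invr_ge0.
have inv1 k : k.+1%:R^-1 <= 1 :> R by rewrite invf_le1// ler1n.
have M0 : 0 <= M%:R :> R by exact: ler0n.
have gfk k : good (fun x => fk k x *: ecol j).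
  have h (i : nat) : good (fun x => k.+1%:R^-1 *: ((\1_(E k i) x : R) *: ecol j)).
    by apply: (good_scale S); exact: (good_indic j (mE k i) (@EB k i)).
  have := good_sum S (k.+1 * M) h; congr good; apply/funext => x.
  by rewrite /fk scaler_suml; apply: eq_bigr => i _; rewrite scalerA.
apply: (@good_dom_ecol j (M%:R + 1) f fk _ gfk mf f0).
- by rewrite addr_ge0.
- move=> k x xB; rewrite /fk big1// => i _.
  by rewrite indicE memNset ?mulr0// => /EB.
- by move=> x; have /andP[f1 f2] := fM x; rewrite ger0_norm//; lra.
- move=> k x; have := close k x; have := inv1 k; have /andP[f1 f2] := fM x.
  move: (k.+1%:R^-1) M0 f2 (fk k x) => z; move: (M%:R : R) => N N0 f2 t.
  by rewrite !ler_norml => ? /andP[? ?]; apply/andP; split; lra.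
move=> x e e0; have [K hK] := exists_inv_lt e0; exists K => k /hK ke.
exact: le_trans (close k x) (ltW ke).
Qed.

Lemma good_bounded_scalar (f : V -> R) (M : nat) j : measurable_fun setT f ->
  (forall x, ~ Bx x -> f x = 0) -> (forall x, `|f x| <= M%:R) ->
  good (fun x => f x *: ecol j).
Proof.
move=> mf f0 fM.
have gp : good (fun x => Num.max (f x) 0 *: ecol j).
  apply: (@good_nonneg _ M).
  - exact: (measurable_maxr mf (measurable_cst _)).
  - by move=> x /f0 ->; rewrite maxxx.
  move=> x; rewrite le_max lexx orbT/= ge_max ler0n andbT.
  exact: le_trans (ler_norm _) (fM x).
have gn : good (fun x => Num.max (- f x) 0 *: ecol j).
  apply: (@good_nonneg _ M).
  - exact: (measurable_maxr (measurable_funN mf) (measurable_cst _)).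
  - by move=> x /f0 ->; rewrite oppr0 maxxx.
  move=> x; rewrite le_max lexx orbT/= ge_max ler0n andbT.
  by apply: le_trans (ler_norm _) _; rewrite normrN.
have := good_sub S gp gn; congr good; apply/funext => x.
rewrite -scalerBl; congr (_ *: _).
by rewrite /Num.max oppr_lt0; case: ltgtP => h; rewrite ?sub0r ?opprK ?subr0 ?h ?addr0.
Qed.

Lemma good_bounded F (M : nat) : vmeasurable setT F -> supported F ->
  (forall x i, `|F x i 0| <= M%:R) -> good F.
Proof.
move=> mF sF FM.
have h (i : nat) : good (fun x => F x (inord i) 0 *: ecol (inord i)).
  apply: (@good_bounded_scalar _ M); [exact: mF| |by move=> x; exact: FM].
  by move=> x /sF ->; rewrite mxE.
have := good_sum S n.+1 h; congr good; apply/funext => x.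
apply/matrixP => i k; rewrite (ord1 k) summxE (bigD1 i)//= big1 => [|l li].
  by rewrite addr0 !mxE inord_val eqxx mulr1.
by rewrite !mxE inord_val eq_sym (negbTE li) mulr0.
Qed.

(** Truncation to the sets |F| <= k gives bounded fields converging pointwise, and |W F| is an
    envelope for all of them. *)
Theorem moll_converges F : vintegrable F -> supported F ->
  (pmod O q W F < +oo)%E -> good F.
Proof.
move=> Fi sF Foo.
have mF := vintegrable_vmeasurable Fi.
have mnF : measurable_fun setT (fun x => enorm (F x)).
  by apply: measurable_enorm => i k; rewrite (ord1 k); exact: mF.
pose T (k : nat) : set V := (fun x => enorm (F x)) @^-1` `]-oo, k%:R].
have mT k : measurable (T k).
  by rewrite -[X in measurable X]setTI; apply: mnF => //; exact: measurable_itv.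
have TE k x : T k x <-> enorm (F x) <= k%:R by rewrite /T/= in_itv/=.
pose Fk k x := (\1_(T k) x : R) *: F x.
have gFk k : good (Fk k).
  apply: (@good_bounded _ k).
  - move=> i; rewrite (_ : (fun x => _) = (fun x => \1_(T k) x * F x i 0)).
      exact: (measurable_funM (measurable_indic (mT k)) (mF i)).
    by apply/funext => x; rewrite mxE.
  - by move=> x /sF Fx; rewrite /Fk Fx scaler0.
  move=> x i; rewrite /Fk mxE normrM indicE.
  have [xT|xT] := boolP (x \in T k); last by rewrite normr0 mul0r.
  rewrite normr1 mul1r; apply: le_trans (coord_enorm_le _ _ _) _.
  by apply/TE/set_mem.
have mFO := sub_vmeasurable (D := O) mF.
apply: (@good_dom F Fk (fun x => enorm (W x *m F x)) gFk Fi sF).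
- exact: (measurable_mulmx (ws_measurable_weight S) mFO).
- by move=> x _; exact: enorm_ge0.
- exact: Foo.
- move=> k x _; rewrite /Fk -scalemxAr enormZ ler_piMl ?enorm_ge0//.
  exact: indic_le1.
- by [].
move=> x _ e e0; have [K hK] : exists K : nat, enorm (F x) <= K%:R.
  by exists (Num.truncn (enorm (F x))).+1; rewrite ltW// truncnS_gt.
exists K => k Kk i; rewrite /Fk indicE mem_set; last first.
  by apply/TE; apply: le_trans hK _; rewrite ler_nat.
by rewrite scale1r subrr mxE normr0 ltW.
Qed.

End density.

(** * The A_p and log-Holder conditions *)

Section Ap_cube_bound.
Context {R : realType} {n : nat}.
Notation V := 'rV[R]_n.+1.
Notation mu := (@leb R n).
Implicit Types (F : V -> 'cV[R]_n.+1) (D E : set V).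

(* Without measurability the integral is the supremum over simple minorants. *)
Lemma lower_integral_le D D' (f g : V -> \bar R) :
  (forall x, D x -> 0 <= f x)%E -> (forall x, D' x -> 0 <= g x)%E ->
  (forall x, D x -> f x = 0 \/ D' x /\ f x <= g x)%E ->
  (\int[mu]_(x in D) f x <= \int[mu]_(x in D') g x)%E.
Proof.
move=> f0 g0 fg; rewrite (ge0_integralE _ f0) (ge0_integralE _ g0).
apply: ge_ereal_sup => _ [h hf <-]; apply: ereal_sup_ubound.
exists h => // x; apply: le_trans (hf x) _; rewrite !patchE.
case: ifPn => [/set_mem/fg[->|[D'x fgx]]|_].
- by case: ifPn => // /set_mem/g0.
- by rewrite mem_set.
by case: ifPn => // /set_mem/g0.
Qed.

Context (O O' : set V) (p : V -> \bar R) (W : V -> 'M[R]_n.+1).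
Context (oO : open O) (OO' : O `<=` O').
Context (p1 : forall x, O' x -> (1 <= p x)%E).
Context (pfin : forall x, O x -> p x \is a fin_num).
Context (mW : forall i j, measurable_fun O (fun x => W x i j)).
Context (mp : measurable_fun O p).
Context (Wunit : {ae mu, forall x, O' x -> W x \in unitmx}).

Let q x := fine (p x).
Let mO := measurable_open oO.

Let pE x : O x -> p x = (q x)%:E.
Proof. by move=> /pfin/fineK. Qed.

Let q1 x : O x -> 1 <= q x.
Proof. by move=> Ox; rewrite -lee_fin -pE//; apply: p1; exact: OO'. Qed.

Lemma measurable_fine_exponent : measurable_fun O q.
Proof. exact: (measurableT_comp (fine_measurable measurableT) mp). Qed.
Let mq := measurable_fine_exponent.

(** The dual exponent t/(t - 1). Written with a power, its composition with the exponent is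
    measurable by [measurable_powR2]. *)
Definition conj_exp (t : R) : R := t * (t - 1) `^ (-1).

Lemma hoelder_conjugateE (t : R) : 1 < t -> hoelder_conjugate t%:E = (conj_exp t)%:E.
Proof.
move=> t1; have t0 : t != 0 by rewrite gt_eqF//; lra.
rewrite /hoelder_conjugate/= eqe (negbTE t0) /conj_exp powR_inv1; last lra.
rewrite -EFinB /inve/= subr_eq0 gt_eqF//.
Qed.

Lemma young_conj (t s a : R) : 1 < t -> 0 <= s -> 0 <= a ->
  s * a <= s `^ conj_exp t + a `^ t.
Proof.
move=> t1 s0 a0; have t10 : 0 < t - 1 by lra.
have t0 : 0 < t by lra.
have rE : conj_exp t = t / (t - 1) by rewrite /conj_exp powR_inv1// ltW.
have r1 : 1 <= conj_exp t by rewrite rE ler_pdivlMr// mul1r; lra.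
have r0 : 0 < conj_exp t by lra.
have h : (conj_exp t)^-1 + t^-1 = 1.
  by rewrite rE; field; rewrite !gt_eqF.
apply: le_trans (conjugate_powR s0 a0 r0 t0 h) _.
apply: lerD; rewrite ler_pdivrMr// ler_peMr ?powR_ge0//; lra.
Qed.

(** Holder's inequality for variable exponents, from |W(x) F(y)| <= |W(x) W^-1(y)| |W(y) F(y)| and
    Young's inequality at each y. Where q = 1 the dual exponent is infinite and the essential
    supremum is used. The 2 adds the bounds 1 for the two modulars. *)
Lemma inner_norm_bound a l F x : 0 < l -> cube a l `<=` O ->
  (forall i, measurable_fun (cube a l) (fun y => F y i 0)) ->
  (pmod (cube a l) q W F <= 1)%E ->
  (2^-1%:E * \int[mu]_(y in cube a l) (enorm (W x *m F y))%:E <=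
   vnorm O' (hoelder_conjugate \o p)
     (fun y => (opnorm (W x *m invmx (W y)) * \1_(cube a l) y)%:E))%E.
Proof.
move=> l0 QO mF F1; set Q := cube a l in QO mF F1 *.
have mQ : measurable Q by exact: measurable_cube.
apply: le_ereal_inf_tmp => _ [m [m0 hm] <-].
pose k y : \bar R := ((opnorm (W x *m invmx (W y)) * \1_Q y)%:E * (m^-1)%:E)%E.
pose I := infinite_part O' (hoelder_conjugate \o p).
have op0 y : 0 <= opnorm (W x *m invmx (W y)) by exact: opnorm_ge0.
have int0 : (0 <= \int[mu]_(y in O' `\` I)
    poweR `|k y| (fine (hoelder_conjugate (p y))))%E.
  by apply: integral_ge0 => y _; exact: poweR_ge0.
have ess0 : (0 <= ess_sup mu ((abse \o k) \_ I))%E.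
  apply: ess_sup_gee; first exact: leb_setT_gt0.
  by apply: aeW => y; rewrite patchE; case: ifP => //= _; exact: abse_ge0.
have hint : (\int[mu]_(y in O' `\` I)
    poweR `|k y| (fine (hoelder_conjugate (p y))) <= 1)%E.
  by apply: le_trans hm; rewrite /modular leeDl.
have hess : (ess_sup mu ((abse \o k) \_ I) <= 1)%E.
  by apply: le_trans hm; rewrite /modular leeDr.
have [N [mN N0 hN]] := Wunit.
pose al y := enorm (W y *m F y).
pose be y := enorm (W x *m F y).
have al0 y : 0 <= al y by exact: enorm_ge0.
have be0 y : 0 <= be y by exact: enorm_ge0.
have mWQ i j : measurable_fun Q (fun y => W y i j) by exact: (measurable_funS mO QO (mW i j)).
have mqQ : measurable_fun Q q by exact: (measurable_funS mO QO mq).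
have mal : measurable_fun Q al by exact: (measurable_mulmx mWQ mF).
have mbe : measurable_fun Q be.
  exact: (@measurable_mulmx _ _ Q (fun=> W x) F (fun i j => measurable_cst (W x i j)) mF).
have malq : measurable_fun Q (fun y => al y `^ q y) by exact: (measurable_powR2 mQ mal mqQ).
pose E := (Q `&` q @^-1` `]1, +oo[) `\` N.
have mE : measurable E.
  apply: measurableD => //; exact: (mqQ mQ _ (measurable_itv `]1, +oo[)).
(* A measurable minorant of |W(x) W^-1(y)| / m, obtained as the quotient of |W(x) F| by |W F|. As 0
   to the power -1 is 0, it vanishes where W F = 0; off [N] the vector W(x) F vanishes there as
   well. *)
pose kt y := m^-1 * (be y * al y `^ (-1)).
have kt0 y : 0 <= kt y by rewrite !mulr_ge0 ?powR_ge0 ?invr_ge0// ltW.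
have mkt : measurable_fun Q kt.
  apply: (measurable_funM (measurable_cst _)); apply: (measurable_funM mbe).
  exact: (measurable_powR2 mQ mal (measurable_cst _)).
have mr : measurable_fun Q (fun y => conj_exp (q y)).
  apply: (measurable_funM mqQ); apply: (measurable_powR2 mQ _ (measurable_cst _)).
  exact: (measurable_funB mqQ (measurable_cst _)).
pose g y := \1_E y * kt y `^ conj_exp (q y).
have mg : measurable_fun Q g.
  apply: (measurable_funM (measurable_indic mE)); exact: (measurable_powR2 mQ mkt mr).
have g0 y : 0 <= g y by rewrite mulr_ge0 ?powR_ge0// indicE.
have unit y : O' y -> ~ N y -> W y \in unitmx.
  by move=> Oy; apply: contra_notT => nu; apply: hN => /(_ Oy); exact/negP.
have be_al y : O' y -> ~ N y -> be y <= opnorm (W x *m invmx (W y)) * al y.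
  move=> Oy /(unit _ Oy) u; have -> : be y = enorm ((W x *m invmx (W y)) *m (W y *m F y)).
    by rewrite /be mulmxA -(mulmxA (W x)) mulVmx// mulmx1.
  exact: enorm_mulmx_opnorm.
have ktle y : O' y -> ~ N y -> kt y <= m^-1 * opnorm (W x *m invmx (W y)).
  move=> Oy Ny; rewrite ler_wpM2l ?invr_ge0 ?(ltW m0)//.
  have := be_al y Oy Ny; have := al0 y; rewrite le_eqVlt => /orP[/eqP <- _|al1 h].
    by rewrite powR0 ?mulr0// oppr_eq0 oner_eq0.
  by rewrite powR_inv1 ?(ltW al1)// ler_pdivrMr.
have gint : (\int[mu]_(y in Q) (g y)%:E <= 1)%E.
  apply: le_trans hint; apply: lower_integral_le.
  - by move=> y _; rewrite lee_fin.
  - by move=> y _; exact: poweR_ge0.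
  move=> y Qy; have [Ey|Ey] := pselect (E y); last first.
    by left; rewrite /g indicE memNset// mul0r.
  right; have [[_ qy] Ny] := Ey; move: qy; rewrite /= in_itv/= andbT => qy.
  have Oy := QO _ Qy; have hc := hoelder_conjugateE qy.
  split.
    split; first exact: OO'.
    by move=> [_] /=; rewrite pE// hc.
  rewrite pE// hc /g !indicE !mem_set// mul1r mulr1 mulrC /=.
  have r0 : 0 <= conj_exp (q y) by rewrite /conj_exp mulr_ge0 ?powR_ge0//; lra.
  have kk := ktle y (OO' Oy) Ny; rewrite lee_fin ger0_norm ?(le_trans (kt0 y))//.
  exact: le_powR_l.
have hae : {ae mu, forall y, Q y -> ((m^-1 * be y)%:E <= (g y + al y `^ q y)%:E)%E}.
  have /ess_supP he := hess.
  have hN' : {ae mu, forall y, ~ N y}.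
    by exists N; split=> // y /= /contrapT.
  apply: filterS2 he hN' => y ky Ny Qy; have Oy := QO _ Qy; rewrite lee_fin.
  have be_kt : m^-1 * be y = kt y * al y.
    have := be_al y (OO' Oy) Ny; have := al0 y; rewrite /kt le_eqVlt => /orP[/eqP <-|al1 _].
      rewrite mulr0 => b0; have -> : be y = 0 by apply/eqP; rewrite eq_le b0 be0.
      by rewrite mulr0 mulr0.
    by rewrite powR_inv1 ?(ltW al1)// -!mulrA mulVf ?mulr1// gt_eqF.
  (* For q y = 1 the point belongs to [I] and the essential bound gives kt <= 1; for q y > 1 it
     belongs to [E] and Young's inequality applies. *)
  have := q1 Oy; rewrite le_eqVlt => /orP[/eqP qy|qy].
    have Iy : I y by split; [exact: OO'|rewrite /= pE// -qy /hoelder_conjugate /= eqe oner_eq0 -EFinB subrr /inve eqxx gt0_muley// lte_fin ltr01].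
    move: ky; rewrite patchE mem_set//= indicE mem_set//= mulr1 mulrC lee_fin => ky.
    rewrite -qy powRr1// be_kt; apply: ler_wpDl => //.
    rewrite ler_piMl//; apply: le_trans (ktle y (OO' Oy) Ny) _.
    exact: le_trans (ler_norm _) ky.
  have Ey : E y by split=> //; split=> //=; rewrite in_itv/= andbT.
  rewrite /g indicE mem_set// mul1r be_kt; exact: young_conj.
have h1 : (\int[mu]_(y in Q) (m^-1 * be y)%:E <= 2%:E)%E.
  apply: (@le_trans _ _ (\int[mu]_(y in Q) (g y + al y `^ q y)%:E)%E).
    apply: (ae_ge0_le_integral mQ _ _ _ _ hae).
    - by move=> y _; rewrite lee_fin mulr_ge0 ?invr_ge0 ?(ltW m0).
    - by apply/measurable_EFinP; exact: (measurable_funM (measurable_cst _) mbe).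
    - by move=> y _; rewrite lee_fin addr_ge0 ?powR_ge0.
    - by apply/measurable_EFinP; exact: (measurable_funD mg malq).
  rewrite (int_add mQ mg malq)//; last by move=> *; exact: powR_ge0.
  have -> : (2%:E : \bar R) = (1 + 1)%E by rewrite -EFinD.
  exact: (leeD gint F1).
move: h1; rewrite (int_scale mQ mbe) ?invr_ge0 ?(ltW m0)// lee_pdivrMl// => h1.
rewrite lee_pdivrMl//; apply: le_trans h1 _.
by rewrite -EFinM lee_fin mulrC.
Qed.

(** In the constant, 2 comes from [inner_norm_bound], 2^(n+1) from the crude bound for the measure
    of a cube, and A0 + 1 instead of A0 makes the norm inequality strict, so that the infimum yields
    an admissible divisor. *)
Lemma cube_bound_of_Ap (A0 : R) : 0 <= A0 -> (Ap_const O' p W <= A0%:E)%E ->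
  cube_bound O q W (2 * ((A0 + 1) * 2 ^+ n.+1)).
Proof.
move=> A00 hA a l F u l0 QO mF F1 mu_u hu; set Q := cube a l in QO mF F1 mu_u hu *.
have mQ : measurable Q by exact: measurable_cube.
pose N x := vnorm O' (hoelder_conjugate \o p)
  (fun y => (opnorm (W x *m invmx (W y)) * \1_Q y)%:E).
have uN x : Q x -> ((2^-1 * u x)%:E <= N x)%E.
  move=> Qx; have [u0 uF] := hu x Qx.
  apply: le_trans (inner_norm_bound x l0 QO mF F1).
  by rewrite EFinM; apply: lee_wpmul2l => //; rewrite lee_fin.
have /andP[mu0 muoo] := leb_cube_fin a l0.
have muE : mu Q = (fine (mu Q))%:E by rewrite fineK// ge0_fin_numE// ltW.
have fm0 : 0 < fine (mu Q) by rewrite -lte_fin -muE.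
have mule : fine (mu Q) <= (2 * l) ^+ n.+1.
  by rewrite -lee_fin -muE; exact: leb_cube_le.
have : (vnorm O' p (fun x => N x * (\1_Q x)%:E) < ((A0 + 1) * (2 * l) ^+ n.+1)%:E)%E.
  have hQ : ((mu Q)^-1 * vnorm O' p (fun x => N x * (\1_Q x)%:E) <= A0%:E)%E.
    apply: le_trans hA; apply: ereal_sup_ubound; exists a, l; split=> //.
    exact: subset_trans QO OO'.
  move: hQ; rewrite muE inver gt_eqF// lee_pdivrMl// => /le_lt_trans; apply.
  rewrite -EFinM lte_fin.
  apply: (@le_lt_trans _ _ ((2 * l) ^+ n.+1 * A0)); first by rewrite ler_wpM2r.
  by rewrite mulrC ltr_pM2r ?ltrDl// exprn_gt0// mulr_gt0.
move=> /ereal_inf_lt[_ [m [m0 hm] <-]]; rewrite lte_fin => /ltW mA.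
pose k x : \bar R := (N x * (\1_Q x)%:E * (m^-1)%:E)%E.
pose I := infinite_part O' p.
have ess0 : (0 <= ess_sup mu ((abse \o k) \_ I))%E.
  apply: ess_sup_gee; first exact: leb_setT_gt0.
  by apply: aeW => y; rewrite patchE; case: ifP => //= _; exact: abse_ge0.
have hint : (\int[mu]_(x in O' `\` I) poweR `|k x| (fine (p x)) <= 1)%E.
  by apply: le_trans hm; rewrite /modular leeDl.
apply: le_trans hint; apply: lower_integral_le.
- by move=> x _; rewrite lee_fin powR_ge0.
- by move=> x _; exact: poweR_ge0.
move=> x Qx; right; have Ox := QO _ Qx; split.
  by split; [exact: OO'|move=> [_]; rewrite pE].
have q0 : 0 < q x by apply: lt_le_trans (q1 Ox).
have [u0 _] := hu x Qx.
have l1 : 0 < l ^+ n.+1 by rewrite exprn_gt0.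
set A := 2 * _; have A_0 : 0 < A by rewrite !mulr_gt0 ?exprn_gt0// ltr_wpDl.
have mA2 : 2 * m <= A * l ^+ n.+1.
  by move: mA; rewrite exprMn /A -!mulrA => mA; rewrite ler_wpM2l.
have um : u x / (A * l ^+ n.+1) <= 2^-1 * u x * m^-1.
  have -> : 2^-1 * u x * m^-1 = u x / (2 * m) by rewrite invfM; ring.
  apply: (ler_wpM2l u0); rewrite lef_pV2 ?posrE//; first exact: (mulr_gt0 A_0 l1).
  by rewrite mulr_gt0.
have : ((2^-1 * u x * m^-1)%:E <= k x)%E.
  rewrite /k indicE mem_set// mule1 EFinM; apply: lee_wpmul2r; last exact: uN.
  by rewrite lee_fin invr_ge0 ltW.
have w0 : 0 <= u x / (A * l ^+ n.+1) by apply: (divr_ge0 u0); apply: mulr_ge0; apply: ltW.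
(* The inner norm may be infinite at some x; there the right-hand side is infinite because q x >
   0. *)
case: (k x) => [r| |] //=; last by move=> _; rewrite (gt_eqF q0) leey.
rewrite !lee_fin => ur; apply: le_powR_l; [exact: ltW|exact: w0|].
by apply: le_trans um (le_trans ur (ler_norm _)).
Qed.

End Ap_cube_bound.

(** * Consequences of log-Holder continuity *)

Section log_holder.
Context {R : realType} {n : nat}.
Notation V := 'rV[R]_n.+1.
Notation mu := (@leb R n).
Context (O : set V) (p : V -> \bar R) (p1 : forall x, O x -> (1 <= p x)%E).

Lemma log_holder_fin_num : log_holder O p -> forall x, O x -> p x \is a fin_num.
Proof.
move=> [C0 [Coo [poo [_ hoo]]]] x Ox; rewrite ge0_fin_numE; last exact: le_trans (p1 Ox).
by rewrite ltey; apply/eqP => px; have := hoo x Ox; rewrite px.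
Qed.

Lemma log_holder_bounded : log_holder O p -> exists P : R,
  forall x, O x -> fine (p x) <= P.
Proof.
move=> LH; have pfin := log_holder_fin_num LH; have [C0 [Coo [poo [_ hoo]]]] := LH.
exists (poo + `|Coo|) => x Ox; have := hoo x Ox.
rewrite -(fineK (pfin x Ox)) -EFinB /= lee_fin; set q := fine _; set t := ln _ => h.
have t1 : 1 <= t.
  rewrite -[leLHS]expRK ler_ln ?posrE ?expR_gt0//.
    by rewrite lerDl enorm_ge0.
  by rewrite ltr_wpDr ?enorm_ge0// expR_gt0.
have : q - poo <= `|Coo|.
  apply: le_trans (ler_norm _) (le_trans h _).
  apply: (@le_trans _ _ (`|Coo| / t)).
    by rewrite ler_wpM2r ?ler_norm// invr_ge0; lra.
  by rewrite ler_pdivrMr ?ler_peMr//; lra.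
lra.
Qed.

(** Points at coordinate distance at most 2 d have Euclidean distance r <= 2 N d. The choice d0 =
    1/(4 N^2) gives r^2 <= d, so - ln d <= 2 (- ln r), whence L = 2 |C0|; it also gives r < 1/2. *)
Lemma log_holder_osc : log_holder O p -> exists L d0 : R, 0 < d0 < 1 /\
  forall d (x y : V), 0 < d < d0 -> O x -> O y ->
    (forall i, `|x 0 i - y 0 i| <= 2 * d) ->
    `|fine (p x) - fine (p y)| * - ln d <= L.
Proof.
move=> LH; have pfin := log_holder_fin_num LH; have [C0 [Coo [poo [h0 _]]]] := LH.
pose N : R := n.+1%:R; have N1 : 1 <= N by rewrite ler1n.
exists (2 * `|C0|), ((4 * N * N)^-1).
have NN1 : 1 <= N * N by rewrite mulr_ege1.
have N4 : 1 < 4 * N * N by rewrite -mulrA; lra.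
split; first by rewrite invr_gt0 invf_lt1//; lra.
move=> d x y /andP[d_gt0 dd0] Ox Oy xy.
have dN : d * (4 * N * N) < 1 by rewrite -ltr_pdivlMr ?mul1r//; lra.
set r := enorm (x - y).
have r0 : 0 <= r by exact: enorm_ge0.
have rd : r <= N * (2 * d).
  apply: le_trans (enorm_le_sum _) _; rewrite big_ord1.
  apply: (@le_trans _ _ (\sum_(j < n.+1) 2 * d)).
    by apply: ler_sum => j _; rewrite !mxE.
  by rewrite sumr_const card_ord [leRHS]mulr_natl.
have [/enorm_eq0/subr0_eq -> |rn] := eqVneq r 0.
  by rewrite subrr normr0 mul0r mulr_ge0.
have rgt : 0 < r by rewrite lt0r rn.
have r2 : r ^+ 2 <= d.
  apply: (@le_trans _ _ ((N * (2 * d)) ^+ 2)).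
    by rewrite ler_pXn2r ?nnegrE// (le_trans r0).
  have -> : (N * (2 * d)) ^+ 2 = d * (d * (4 * N * N)) by ring.
  by rewrite ler_piMr// ltW.
have rhalf : r < 2^-1.
  have d2 : 2 * (N * (2 * d)) < 1.
    apply: le_lt_trans dN.
    have -> : d * (4 * N * N) = (2 * (N * (2 * d))) * N by ring.
    by apply: ler_peMr N1; rewrite !mulr_ge0 ?(ltW d_gt0) ?(le_trans ler01 N1).
  by apply: le_lt_trans rd _; lra.
have := h0 x y Ox Oy rhalf.
rewrite -(fineK (pfin x Ox)) -(fineK (pfin y Oy)) -EFinB /= lee_fin -/r => hr.
have lr : ln r *+ 2 <= ln d.
  by rewrite -lnXn// ler_ln ?posrE// exprn_gt0.
have lr0 : 0 < - ln r.
  by rewrite oppr_gt0 -ln1 ltr_ln ?posrE//; lra.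
move: hr; rewrite ler_pdivlMr// => hr.
set t := `|_| in hr *; have t0 : 0 <= t by exact: normr_ge0.
apply: (@le_trans _ _ (t * (- ln r * 2))).
  by rewrite ler_wpM2l// mulr_natr mulNrn lerN2.
rewrite mulrA [leRHS]mulrC ler_wpM2r//.
exact: le_trans hr (ler_norm _).
Qed.

End log_holder.

Lemma weight_setting_of_Ap (R : realType) (n : nat) (O : set 'rV[R]_n.+1)
    (p : 'rV[R]_n.+1 -> \bar R) (W : 'rV[R]_n.+1 -> 'M[R]_n.+1) :
  open O -> exponent O p -> log_holder O p -> matrix_weight O W ->
  matrix_Ap_larger O p W ->
  exists A P L d0, weight_setting O (fun x => fine (p x)) W A P L d0.
Proof.
move=> oO [mp p1] LH [mW _ _] [ O' [_ OO' [_ p1'] _ [Wu Apoo] ] ].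
have pfin := log_holder_fin_num p1 LH.
have [P hP] := log_holder_bounded p1 LH.
have [L [d0 [d01 osc]]] := log_holder_osc p1 LH.
pose A0 := `|fine (Ap_const O' p W)|.
have hA : (Ap_const O' p W <= A0%:E)%E.
  by move: Apoo; rewrite /A0; case: (Ap_const O' p W) => [r| |] //= _; rewrite ?leNye ?lee_fin ?ler_norm.
have A00 : 0 <= A0 by exact: normr_ge0.
exists (2 * ((A0 + 1) * 2 ^+ n.+1)), P, L, d0; constructor.
- exact: oO.
- exact: (measurable_fine_exponent mp).
- move=> x Ox; rewrite hP// andbT.
  by have := p1 x Ox; rewrite -(fineK (pfin x Ox)) lee_fin.
- exact: mW.
- have : 1 <= (2 : R) ^+ n.+1 by rewrite exprn_ege1// ler1n.
  move=> h; have h1 : 1 <= (A0 + 1) * 2 ^+ n.+1 by rewrite mulr_ege1// lerDr.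
  by rewrite mulr_ege1// ler1n.
- exact: (cube_bound_of_Ap oO OO' p1' pfin mW mp Wu A00 hA).
- exact: d01.
- exact: osc.
Qed.

(** * Weak gradients *)

Section cutoff.
Context {R : realType} {n : nat}.
Notation V := 'rV[R]_n.+1.
Notation mu := (@leb R n).
Implicit Types (b : V) (s : R) (O K : set V).

Lemma compact_cube (a : V) (l : R) : compact (cube a l).
Proof.
have -> : cube a l = [set v : V | forall i, `[a 0 i, a 0 i + l]%classic (v ord0 i)].
  by apply/seteqP; split => x xa i; have := xa i; rewrite /= in_itv.
exact: (@rV_compact _ _ (fun i => `[a 0 i, a 0 i + l]%classic)
  (fun i => @segment_compact R _ _)).
Qed.

(** The cutoff mollifies the box with coordinates in (b + s/4, b + s/2] at scale s/8. Looking back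
    by s/8, it is 1 on [inner], between b + 3s/8 and b + s/2, and it vanishes outside b + s/4 to b +
    5s/8, hence outside [core]. *)
Definition core b s : set V := cube (addc b (s / 4)) (s / 2).

Definition inner b s : set V :=
  [set x | forall i, b 0 i + 3 * s / 8 < x 0 i < b 0 i + s / 2].

Definition cutoff b s : V -> R :=
  moll (s / 8) \1_(box (addc b (s / 4), addc b (s / 2))).

Lemma core_Bx b s : 0 < s -> core b s `<=` Bx b s.
Proof.
by move=> s0 x xb i; have := xb i; rewrite /= !addcE => /andP[? ?]; apply/andP; split; lra.
Qed.

Lemma open_inner b s : open (inner b s).
Proof.
rewrite openE => x xb; apply/nbhs_coordP.
have [|r r0 hr] := @exists_min_ord R n.+1
    (fun i => Num.min (x 0 i - (b 0 i + 3 * s / 8)) (b 0 i + s / 2 - x 0 i)).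
  by move=> i; have /andP[h1 h2] := xb i; rewrite lt_min !subr_gt0 h1.
exists r => // y xy i; have := hr i; rewrite le_min => /andP[h1 h2].
by have := xy i; rewrite ltr_norml => /andP[h3 h4]; apply/andP; split; lra.
Qed.

Lemma cutoff_integrable0 b s : 0 < s ->
  mu.-integrable setT (EFin \o (\1_(box (addc b (s / 4), addc b (s / 2))) : V -> R)).
Proof.
move=> s0; apply: (indic_Bx_integrable s0 (b := b)); first exact: measurable_box.
by move=> x xb i; have := xb i; rewrite /= !addcE => /andP[? ?]; apply/andP; split; lra.
Qed.

Lemma smooth_cutoff b s : 0 < s -> smooth setT (cutoff b s).
Proof. by move=> s0; exact/smooth_moll/cutoff_integrable0. Qed.

Lemma cutoff_range b s x : 0 < s -> 0 <= cutoff b s x <= 1.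
Proof.
move=> s0; apply: moll_range; [by rewrite divr_gt0|exact: cutoff_integrable0|].
by move=> y; rewrite indicE; case: (y \in _); rewrite /= ?lexx ?ler01.
Qed.

Lemma cutoff_out b s x : 0 < s -> ~ core b s x -> cutoff b s x = 0.
Proof.
move=> s0 xb; apply: moll_const; first by rewrite divr_gt0.
move=> y xy; rewrite indicE memNset// => yb; apply: xb => i.
have /andP[h1 h2] := xy i; have := yb i; rewrite /= !addcE => /andP[h3 h4].
by apply/andP; split; lra.
Qed.

Lemma cutoff_inner b s x : 0 < s -> inner b s x -> cutoff b s x = 1.
Proof.
move=> s0 xb; apply: moll_const; first by rewrite divr_gt0.
move=> y xy; rewrite indicE mem_set// => i; rewrite /= !addcE.
have /andP[h1 h2] := xy i; have /andP[h3 h4] := xb i.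
by apply/andP; split; lra.
Qed.

(** Room for [moll_bound]: mollification spreads a field from [cube b s] into [cube b (2 * s)], and
    the doubled grid cells stick out below by one more mesh. *)
Definition inside O (c : V * R) := 0 < c.2 /\ cube (addc c.1 (- c.2)) (4 * c.2) `<=` O.

Lemma core_O O c : inside O c -> core c.1 c.2 `<=` O.
Proof. by move=> [s0 cO]; apply: subset_trans (Bx_O s0 cO); exact: core_Bx. Qed.

(** Cubes with rational data are enumerated through [unpickle]. Nonemptiness provides one admissible
    cube, used for every index that codes none. *)
Lemma inner_cover O : open O -> O !=set0 -> exists c : nat -> V * R,
  (forall k, inside O (c k)) /\ forall x, O x -> exists k, inner (c k).1 (c k).2 x.
Proof.
move=> oO [x0 Ox0].
pose rc (q : 'rV[rat]_n.+1 * rat) : V * R := (map_mx ratr q.1, ratr q.2).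
have H x : O x -> exists q, inside O (rc q) /\ inner (rc q).1 (rc q).2 x.
  move=> Ox; have /nbhs_coordP[e e0 xO] : nbhs x O by exact: open_nbhs_nbhs.
  have [|s /andP[s0 se]] := @rat_between R 0 (e / 4); first by rewrite divr_gt0.
  have /choice[f hf] (i : 'I_n.+1) : exists q : rat,
      x 0 i - (ratr s : R) / 2 < ratr q < x 0 i - 3 * ratr s / 8.
    by apply: rat_between; lra.
  exists (\row_i f i, s); split; first split => //=.
    move=> y yb; apply: xO => i; have := yb i; have /andP[h1 h2] := hf i.
    rewrite addcE !mxE => /andP[h3 h4].
    by rewrite ltr_norml; apply/andP; split; lra.
  by move=> i; have /andP[h1 h2] := hf i; rewrite /= !mxE; apply/andP; split; lra.
have [q0 [q0O _]] := H x0 Ox0.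
pose c k := if unpickle k is Some q then
  (if pselect (inside O (rc q)) then rc q else rc q0) else rc q0.
exists c; split=> [k|x /H[q [qO qx]]].
  by rewrite /c; case: (unpickle k) => [q|]//; case: pselect.
by exists (pickle q); rewrite /c pickleK; case: pselect.
Qed.

Lemma support_integrable O K (h w : V -> R) : open O -> L1loc O h -> smooth setT w ->
  compact K -> K `<=` O -> (forall x, ~ K x -> w x = 0) ->
  mu.-integrable setT (EFin \o (fun x => w x * h x)).
Proof.
move=> oO [mh hK] sw cK KO w0.
have cw : continuous w by move=> x; exact: (smooth_continuous sw).
have [C C0 wC] := compact_support_bounded cK cw w0.
have mK := measurable_compact cK.
have hi : mu.-integrable K (EFin \o h).
  apply/integrableP; split; last exact: (hK K KO cK).
  by apply/measurable_EFinP; exact: (measurable_funS (measurable_open oO) KO mh).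
have mw : measurable_fun K w by apply: measurable_funTS; exact: measurable_fun_continuous.
have wi := integrable_mul_bounded mK hi mw (fun x _ => wC x).
have := (integrable_mkcond (EFin \o (fun x => h x * w x)) mK).1 wi.
congr (mu.-integrable _ _); apply/funext => x; rewrite patchE /=.
case: ifPn => [_|xK]; first by rewrite mulrC.
by rewrite w0 ?mul0r// => Kx; move: xK; rewrite mem_set.
Qed.

Lemma smooth_partial_smooth (w : V -> R) i : smooth setT w -> smooth setT (partial i w).
Proof. by move=> sw s x _; have := sw (rcons s i) x I; rewrite /partials foldr_rcons. Qed.

(** The kernel centred at x need not be supported in [O], but its product with [w] is a test
    function there; testing the weak derivative on it yields the product rule under the
    mollification. *)
Lemma weak_partial_moll O K (f g w : V -> R) i d x : open O -> 0 < d ->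
  L1loc O f -> L1loc O g -> is_weak_partial O i f g -> smooth setT w ->
  compact K -> K `<=` O -> (forall x, ~ K x -> w x = 0) ->
  partial i (moll d (fun y => w y * f y)) x =
  moll d (fun y => w y * g y + partial i w y * f y) x.
Proof.
move=> oO d0 lf lg fg sw cK KO w0.
have clK := compact_closed_row cK.
have dw0 := partial_support i clK w0.
have sdw := smooth_partial_smooth i sw.
have wfi := support_integrable oO lf sw cK KO w0.
have wgi := support_integrable oO lg sw cK KO w0.
have dfi := support_integrable oO lf sdw cK KO dw0.
apply: moll_partial; first exact: wfi.
pose k y := kern d (x - y).
have sk : smooth setT k by exact: smooth_kernel.
have ki h : mu.-integrable setT (EFin \o h) -> mu.-integrable setT (EFin \o (fun y => h y * k y)).
  by move=> hi; exact: (@moll_integrable _ _ d h x hi).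
have dki : mu.-integrable setT (EFin \o (fun y => w y * f y * partial i k y)).
  have E : (fun y => w y * f y * partial i k y) = (fun y => - d^-1 *
      (w y * f y * mbump (dmbump i (fun=> (1, 0%N))) (d^-1 *: (x - y)))).
    apply/funext => y.
    by rewrite /partial (@derive_val _ _ _ _ _ _ _ (kernel_is_derive _ _ _ _ _)); ring.
  have ki' := convol_integrable x wfi
    (mbump_scale_bounded_lipschitz (dmbump i (fun=> (1, 0%N))) d^-1).
  by rewrite E; exact: (integrable_scale (- d^-1) measurableT ki').
have tphi : test_function O (fun y => w y * k y).
  split; first exact: (smoothM openT sw sk).
  by exists K; split=> // y /w0 ->; rewrite mul0r.
have hL : (\int[mu]_(y in O) (f y * partial i (fun y => w y * k y) y)%:E =
    \int[mu]_y (partial i w y * f y * k y + w y * f y * partial i k y)%:E)%E.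
  rewrite -(@integral_support _ _ O K
    (fun y => partial i w y * f y * k y + w y * f y * partial i k y) KO).
    by apply: eq_integral => y _; congr EFin; rewrite (partialM i sw sk)//; ring.
  by move=> y Ky; rewrite w0// dw0// !mul0r addr0.
have hR : (\int[mu]_(y in O) (g y * (w y * k y))%:E = \int[mu]_y (w y * g y * k y)%:E)%E.
  rewrite -(@integral_support _ _ O K (fun y => w y * g y * k y) KO).
    by apply: eq_integral => y _; congr EFin; ring.
  by move=> y Ky; rewrite w0// !mul0r.
have h := fg _ tphi; rewrite hL hR in h.
have {}h : \int[mu]_y (partial i w y * f y * k y + w y * f y * partial i k y) =
    - \int[mu]_y (w y * g y * k y) by rewrite /Rintegral h fineN.
move: h; rewrite (RintegralD measurableT (ki _ dfi) dki) => h.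
have -> : (fun y => (w y * g y + partial i w y * f y) * k y) =
    (fun y => w y * g y * k y + partial i w y * f y * k y).
  by apply/funext => y; ring.
rewrite (RintegralD measurableT (ki _ wgi) (ki _ dfi)).
by move: h; set A := (\int[mu]_y (partial i w y * f y * k y)); rewrite /k; lra.
Qed.

(** With exponent 1 and identity weight the modular is the L^1 norm, so convergence of
    mollifications in L^1 is an instance of [moll_converges]. The constant 2^(n+1) comes from
    [leb_cube_le]. *)
Lemma unit_weight_setting O : open O ->
  weight_setting O (fun=> 1) (fun=> 1%:M) (2 ^+ n.+1) 1 0 2^-1.
Proof.
move=> oO; constructor.
- exact: oO.
- exact: measurable_cst.
- by move=> x _; rewrite !lexx.
- by move=> i j; exact: measurable_cst.
- by rewrite exprn_ege1// ler1n.
- move=> a l F u l0 aO mF F1 mu_u hu; set Q := cube a l in aO mF F1 mu_u hu *.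
  have mQ : measurable Q by exact: measurable_cube.
  set T : R := 2 ^+ n.+1 * l ^+ n.+1; have T0 : 0 < T by rewrite mulr_gt0 ?exprn_gt0.
  apply: (@le_trans _ _ (\int[mu]_(x in Q) (cst T^-1 x)%:E)%E).
    apply: (le_int mQ _ (measurable_cst _)).
      exact: (measurable_powR2 mQ (measurable_funM mu_u (measurable_cst _)) (measurable_cst _)).
    move=> x Qx; have [u0 u1] := hu x Qx.
    have uT : 0 <= u x / T by rewrite divr_ge0// ltW.
    rewrite powRr1//; split; first exact: uT.
    rewrite ler_piMl ?invr_ge0 ?(ltW T0)// -lee_fin; apply: le_trans u1 _.
    apply: le_trans F1; rewrite le_eqVlt; apply/orP; left; apply/eqP.
    by apply: eq_integral => y _; rewrite powRr1 ?enorm_ge0.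
  rewrite (@integral_cst _ _ _ mu Q mQ (T^-1)%:E).
  have -> : 1%E = ((T^-1)%:E * T%:E)%E by rewrite -EFinM mulVf ?gt_eqF.
  apply: lee_wpmul2l; first by rewrite lee_fin invr_ge0 ltW.
  by rewrite /T -exprMn; exact: leb_cube_le.
- by rewrite invr_gt0 ltr0n invf_lt1// ltr1n.
- by move=> d x y _ _ _ _; rewrite subrr normr0 mul0r.
Qed.

(** For a cutoff w, the mollifications of w h are derivatives of mollifications of w 0, hence
    identically 0; they also converge to w h in L^1, so w h = 0 almost everywhere. Countably many
    cutoffs equal to 1 on the cubes [inner] cover [O]. *)
Lemma weak_partial0_ae0 O i (h : V -> R) : open O -> L1loc O h ->
  is_weak_partial O i (fun=> 0) h -> {ae mu, forall x, O x -> h x = 0}.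
Proof.
move=> oO lh wh.
have [neO|/set0P/negP/negPn/eqP ->] := pselect (O !=set0); last first.
  by apply: aeW.
have l0 : L1loc O (fun=> 0).
  split; first exact: measurable_cst.
  by move=> K KO cK; rewrite integral0_eq// => x _; rewrite normr0.
have [c [cO cov]] := inner_cover oO neO.
have S := unit_weight_setting oO.
suff H k : {ae mu, forall x, inner (c k).1 (c k).2 x -> h x = 0}.
  apply: filterS (ae_foralln H) => x hx /cov[k xk]; exact: hx xk.
have [s0 bO] := cO k; move: (c k) s0 bO => [b s] /= s0 bO {c cO cov}.
pose w := cutoff b s; pose f x := w x * h x.
have sw : smooth setT w by exact: smooth_cutoff.
have cK := @compact_cube (addc b (s / 4)) (s / 2).
have KO : core b s `<=` O by exact: (@core_O O (b, s)).
have w0 x : ~ core b s x -> w x = 0 by exact: cutoff_out.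
have fi : mu.-integrable setT (EFin \o f) by exact: (support_integrable oO lh sw cK KO w0).
pose F x : 'cV[R]_n.+1 := f x *: ecol 0.
have Fi : vintegrable F.
  move=> j; rewrite (_ : (fun x => _) = (fun x => (ecol 0 : 'cV[R]_n.+1) j 0 * f x)).
    exact: (integrable_scale _ measurableT fi).
  by apply/funext => x; rewrite mxE mulrC.
have sF : supported b s F.
  by move=> x xb; rewrite /F /f w0 ?mul0r ?scale0r// => /(core_Bx s0).
have pF D : (pmod D (fun=> 1%R) (fun=> 1%:M) F = \int[mu]_(x in D) `|(f x)%:E|)%E.
  apply: eq_integral => x _; rewrite mul1mx powRr1 ?enorm_ge0//.
  by rewrite /F enormZ enorm_delta mulr1.
have mO := measurable_open oO.
have Foo : (pmod O (fun=> 1%R) (fun=> 1%:M) F < +oo)%E.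
  rewrite pF; have /integrableP[/measurable_EFinP mf] := fi; apply: le_lt_trans.
  exact: (@int_subset _ _ _ _ (fun x => `|f x|) mO measurableT
    (measurableT_comp (@normr_measurable R setT) mf) (fun x _ => normr_ge0 _) (@subsetT _ O)).
have [_ _ cF] := moll_converges S s0 bO Fi sF Foo.
have mF m x : mollv (mesh s m) F x = 0.
  rewrite mollv_ecol//; have m0 := mesh_gt0 s0 m.
  have := weak_partial_moll x oO m0 l0 lh wh sw cK KO w0.
  rewrite (_ : (fun y => w y * h y + _) = f); last by apply/funext => y; rewrite mulr0 addr0.
  move=> <-; rewrite (_ : moll _ _ = cst 0); first by rewrite /partial derive_cst scale0r.
  by apply/funext => y; rewrite -[RHS](moll0 (mesh s m) y); apply: eq_moll => z; rewrite mulr0.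
have f0 : (\int[mu]_(x in O) `|(f x)%:E| = 0)%E.
  apply/eqP; rewrite eq_le integral_ge0// andbT; apply/lee_addgt0Pr => e e0.
  rewrite add0e; have [m /(_ m (leqnn m))] := cF e e0.
  have -> : (fun x => F x - mollv (mesh s m) F x) = F.
    by apply/funext => x; rewrite mF subr0.
  by rewrite pF.
have mf : measurable_fun O (EFin \o f).
  by have /integrableP[mf _] := fi; exact: measurable_funTS.
have := (ae_eq_integral_abs mu mO mf).1 f0; apply: filterS => x fx xb.
have /fx[] : O x.
  apply: KO => j; have /andP[h1 h2] := xb j; rewrite addcE.
  by apply/andP; split; move: s0 => ?; lra.
by rewrite /f /w (cutoff_inner s0 xb) mul1r.
Qed.

Lemma weak_gradient_unique O (f : V -> R) F G : open O ->
  is_weak_gradient O f F -> is_weak_gradient O f G ->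
  {ae mu, forall x, O x -> F x = G x}.
Proof.
move=> oO hF hG; have mO := measurable_open oO.
suff H (i : 'I_n.+1) : {ae mu, forall x, O x -> F x i 0 - G x i 0 = 0}.
  have : {ae mu, forall x, forall k : nat, O x -> F x (inord k) 0 - G x (inord k) 0 = 0}.
    by apply: ae_foralln => k; exact: H.
  apply: filterS => x hx Ox; apply/matrixP => i j; rewrite (ord1 j).
  by have /eqP := hx i Ox; rewrite inord_val subr_eq0 => /eqP.
have [[mF lF] wF] := hF i; have [[mG lG] wG] := hG i.
have lB : L1loc O (fun x => F x i 0 - G x i 0).
  split; first exact: (measurable_funB mF mG).
  move=> K KO cK; have mK := measurable_compact cK.
  have int (H : V -> 'cV[R]_n.+1) : measurable_fun O (fun x => H x i 0) ->
      (\int[mu]_(x in K) `|H x i 0|%:E < +oo)%E ->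
      mu.-integrable K (EFin \o (fun x => H x i 0)).
    move=> mH lH; apply/integrableP; split; last exact: lH.
    by apply/measurable_EFinP; exact: (measurable_funS mO KO mH).
  have := integrable_sub mK (int _ mF (lF _ KO cK)) (int _ mG (lG _ KO cK)).
  by move=> /integrableP[].
apply: (weak_partial0_ae0 (i := i) oO lB) => phi tphi.
have [sphi [K [cK KO phi0]]] := tphi.
have int (H : V -> 'cV[R]_n.+1) : L1loc O (fun x => H x i 0) ->
    mu.-integrable O (EFin \o (fun x => H x i 0 * phi x)).
  move=> lH; apply: (integrableS measurableT mO) => //.
  have := support_integrable oO lH sphi cK KO phi0.
  by congr (mu.-integrable _ _); apply/funext => x; rewrite /= mulrC.
have iF := int F (conj mF lF); have iG := int G (conj mG lG).
rewrite (eq_integral (fun=> 0%E)); last by move=> x _; rewrite mul0r.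
rewrite integral0 (eq_integral (fun x => (F x i 0 * phi x)%:E - (G x i 0 * phi x)%:E)%E); last first.
  by move=> x _; rewrite -EFinB -mulrBl.
rewrite (integralB mO iF iG).
have -> : (\int[mu]_(x in O) (F x i 0 * phi x)%:E = \int[mu]_(x in O) (G x i 0 * phi x)%:E)%E.
  by apply: oppe_inj; rewrite -wF// -wG.
by rewrite subee ?oppe0//; exact: integrable_fin_num.
Qed.

End cutoff.

(** * Modulars and norms *)

Section vnorm.
Context {R : realType} {n : nat}.
Notation V := 'rV[R]_n.+1.
Notation mu := (@leb R n).
Implicit Types (f g h : V -> R) (F G : V -> 'cV[R]_n.+1).
Context (O : set V) (p : V -> \bar R) (W : V -> 'M[R]_n.+1) (P : R).
Context (oO : open O) (mp : measurable_fun O p).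
Context (pfin : forall x, O x -> p x \is a fin_num).
Context (q1P : forall x, O x -> 1 <= fine (p x) <= P).
Context (mW : forall i j, measurable_fun O (fun x => W x i j)).

Let q x := fine (p x).
Let mO := measurable_open oO.
Let mq : measurable_fun O q := measurable_fine_exponent mp.

Definition rmodular h : \bar R := (\int[mu]_(x in O) (`|h x| `^ q x)%:E)%E.

Lemma measurable_rmodular h : measurable_fun O h ->
  measurable_fun O (fun x => `|h x| `^ q x).
Proof.
by move=> mh; exact: (measurable_powR2 mO (measurableT_comp (@normr_measurable R setT) mh) mq).
Qed.

Lemma modularE h : modular O p (fun x => (h x)%:E) = rmodular h.
Proof.
have I0 : infinite_part O p = set0.
  by apply/seteqP; split=> // x [/pfin + px]; rewrite px.
rewrite /modular I0 setD0 patch_set0 ess_sup_cst ?adde0//.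
exact: leb_setT_gt0.
Qed.

Lemma rmodular_le h g (c : R) : measurable_fun O h -> measurable_fun O g -> 1 <= c ->
  (forall x, O x -> `|h x| <= c * `|g x|) -> (rmodular h <= (c `^ P)%:E * rmodular g)%E.
Proof.
move=> mh mg c1 hg; have mg' := measurable_rmodular mg.
rewrite /rmodular -(int_scale mO mg' (fun x _ => powR_ge0 _ _) (powR_ge0 _ _)).
apply: (le_int mO (measurable_rmodular mh) (measurable_funM (measurable_cst _) mg')).
move=> x Ox; split; first exact: powR_ge0.
have /andP[q1 qP] : 1 <= q x <= P := q1P Ox.
apply: le_trans (powR_const_le c1 (normr_ge0 _) qP).
by apply: le_powR_l; [lra|exact: normr_ge0|exact: hg].
Qed.

Lemma rmodular_lty h : measurable_fun O h ->
  (vnorm O p (fun x => (h x)%:E) < +oo)%E -> (rmodular h < +oo)%E.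
Proof.
move=> mh /ereal_inf_lt[_ [l [l0 hl] <-] _].
have hl' : (rmodular (fun x => (h x / l)%R) <= 1)%E by rewrite -modularE.
have ml : measurable_fun O (fun x => (h x / l)%R) by exact: (measurable_funM mh (measurable_cst _)).
have l1 : 1 <= 1 + l by rewrite lerDl ltW.
have li0 : 0 <= l^-1 by rewrite invr_ge0 ltW.
apply: le_lt_trans (rmodular_le mh ml l1 _) _.
  move=> x _; rewrite normrM (ger0_norm li0).
  apply: (@le_trans _ _ (l * (`|h x| * l^-1))); first by rewrite mulrCA divff ?mulr1 ?lt0r_neq0.
  by rewrite ler_wpM2r ?mulr_ge0 ?invr_ge0 ?(ltW l0)// lerDr.
apply: lte_mul_pinfty; rewrite ?lee_fin ?powR_ge0//.
exact: le_lt_trans hl' (ltry _).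
Qed.

(** For l <= 1, division by l multiplies the modular by at most l^-P since exponents do not exceed
    P. Approximation in modular thus becomes approximation in norm. *)
Lemma vnorm_le_rmodular h (l : R) : measurable_fun O h -> 0 < l <= 1 ->
  (rmodular h <= (l `^ P)%:E)%E -> (vnorm O p (fun x => (h x)%:E) <= l%:E)%E.
Proof.
move=> mh /andP[l0 l1] hl; apply: ereal_inf_lbound; exists l => //; split=> //.
rewrite (_ : modular _ _ _ = rmodular (fun x => (h x / l)%R)); last first.
  exact: (modularE (fun x => (h x / l)%R)).
have ml : measurable_fun O (fun x => (h x / l)%R) by exact: (measurable_funM mh (measurable_cst _)).
have li : 1 <= l^-1 by rewrite invf_ge1.
have li0 : 0 <= l^-1 by rewrite invr_ge0 ltW.
apply: le_trans (rmodular_le ml mh li _) _.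
  by move=> x _; rewrite normrM (ger0_norm li0) mulrC.
apply: le_trans (lee_wpmul2l _ hl) _; first by rewrite lee_fin powR_ge0.
by rewrite -EFinM -powRM ?invr_ge0 ?(ltW l0)// mulVf ?powR1// gt_eqF.
Qed.

Lemma vnorm_lty h : measurable_fun O h -> (rmodular h < +oo)%E ->
  (vnorm O p (fun x => (h x)%:E) < +oo)%E.
Proof.
move=> mh hoo; have h0 : (0 <= rmodular h)%E.
  by apply: integral_ge0 => x _; rewrite lee_fin powR_ge0.
have [M M0 hM] : exists2 M : R, 0 <= M & rmodular h = M%:E.
  by exists (fine (rmodular h)); rewrite ?fine_ge0// fineK// ge0_fin_numE.
(* Since exponents are at least 1 and l >= 1, division by l multiplies the modular by at most 1/l,
   which brings it below M / (M + 1). *)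
pose l := M + 1; have l1 : 1 <= l by rewrite lerDr.
have l0 : 0 < l by apply: lt_le_trans l1.
apply: (@le_lt_trans _ _ l%:E); last exact: ltry.
apply: ereal_inf_lbound; exists l => //; split=> //.
rewrite (_ : modular _ _ _ = rmodular (fun x => (h x / l)%R)); last first.
  exact: (modularE (fun x => (h x / l)%R)).
have ml : measurable_fun O (fun x => (h x / l)%R) by exact: (measurable_funM mh (measurable_cst _)).
have mh' := measurable_rmodular mh.
have li0 : 0 <= l^-1 by rewrite invr_ge0 ltW.
apply: (@le_trans _ _ (\int[mu]_(x in O) (l^-1 * `|h x| `^ q x)%:E)%E).
  apply: (le_int mO (measurable_rmodular ml) (measurable_funM (measurable_cst _) mh')).
  move=> x Ox; split; first exact: powR_ge0.
  have /andP[q1 _] : 1 <= q x <= P := q1P Ox.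
  rewrite normrM (ger0_norm li0) powRM ?invr_ge0 ?(ltW l0)// mulrC.
  rewrite ler_wpM2r ?powR_ge0//; apply: powR_le_self => //.
  by rewrite invr_ge0 (ltW l0)/= invf_le1.
rewrite (int_scale mO mh' (fun x _ => powR_ge0 _ _) li0).
rewrite -/(rmodular h) hM -EFinM lee_fin ler_pdivrMl// mulr1.
by rewrite lerDl.
Qed.

Lemma rmodular_ae_eq g h : measurable_fun O g -> measurable_fun O h ->
  {ae mu, forall x, O x -> g x = h x} -> rmodular g = rmodular h.
Proof.
move=> mg mh gh.
have m1 := measurable_rmodular mg; have m2 := measurable_rmodular mh.
move/measurable_EFinP: m1 => m1; move/measurable_EFinP: m2 => m2.
apply: (@ge0_ae_eq_integral _ _ _ mu O _ _ mO m1 m2).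
- by move=> x _; rewrite lee_fin powR_ge0.
- by move=> x _; rewrite lee_fin powR_ge0.
by apply: filterS gh => x ghx Ox; rewrite /= ghx.
Qed.

Lemma vnorm_ae_eq g h : measurable_fun O g -> measurable_fun O h ->
  {ae mu, forall x, O x -> g x = h x} ->
  vnorm O p (fun x => (g x)%:E) = vnorm O p (fun x => (h x)%:E).
Proof.
move=> mg mh gh.
have H l : modular O p (fun x => (g x)%:E * (l^-1)%:E)%E =
    modular O p (fun x => (h x)%:E * (l^-1)%:E)%E.
  have -> : modular O p (fun x => (g x)%:E * (l^-1)%:E)%E = rmodular (fun x => (g x / l)%R).
    exact: (modularE (fun x => (g x / l)%R)).
  have -> : modular O p (fun x => (h x)%:E * (l^-1)%:E)%E = rmodular (fun x => (h x / l)%R).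
    exact: (modularE (fun x => (h x / l)%R)).
  apply: rmodular_ae_eq.
  - exact: (measurable_funM mg (measurable_cst _)).
  - exact: (measurable_funM mh (measurable_cst _)).
  by apply: filterS gh => x ghx Ox; rewrite ghx.
rewrite /vnorm; suff -> : [set l : R | 0 < l /\ (modular O p (fun x => (g x)%:E * (l^-1)%:E) <= 1)%E] =
  [set l : R | 0 < l /\ (modular O p (fun x => (h x)%:E * (l^-1)%:E) <= 1)%E] by [].
by apply/funext => l /=; rewrite H.
Qed.

(** The norm is defined with a chosen weak gradient; uniqueness almost everywhere allows any other
    one, in particular the classical gradient of a smooth function. *)
Lemma sobolev_normE v f F : is_weak_gradient O f F ->
  sobolev_norm O p v W f = (vnorm O p (fun x => (f x * v x)%:E) +
    vnorm O p (fun x => (enorm (W x *m F x))%:E))%E.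
Proof.
move=> fF; have fG : is_weak_gradient O f (weak_gradient O f) by apply: xgetPex; exists F.
have mv G : is_weak_gradient O f G -> measurable_fun O (fun x => enorm (W x *m G x)).
  by move=> fG'; exact: (measurable_mulmx mW (fun i => (fG' i).1.1)).
have /(vnorm_ae_eq (mv _ fG) (mv _ fF)) E : {ae mu, forall x, O x ->
    enorm (W x *m weak_gradient O f x) = enorm (W x *m F x)}.
  by apply: filterS (weak_gradient_unique oO fG fF) => x E Ox; rewrite E.
by rewrite /sobolev_norm E.
Qed.

End vnorm.

(** * The Meyers-Serrin construction *)

Lemma sum_stable (T : zmodType) (a : nat -> T) (M m : nat) :
  (forall k, (M <= k)%N -> a k = 0) -> (M <= m)%N -> \sum_(k < m) a k = \sum_(k < M) a k.
Proof.
move=> a0 /subnK <-; elim: (m - M)%N => [//|j IH].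
by rewrite addSn big_ord_recr/= a0 ?addr0// leq_addl.
Qed.

Section partition_of_unity.
Context {R : realType} {n : nat}.
Notation V := 'rV[R]_n.+1.
Notation mu := (@leb R n).
Context (O : set V) (c : nat -> V * R) (cO : forall k, inside O (c k)).

Let b k := (c k).1.
Let s k := (c k).2.
Let s0 k : 0 < s k. Proof. by have [] := cO k. Qed.

Let eta k := cutoff (b k) (s k).

(** What is left of 1 after the first [m] cutoffs. The functions [pou] are its successive
    decrements, so their sums telescope and equal 1 exactly once some cutoff equals 1. *)
Definition remainder m x : R := \prod_(k < m) (1 - eta k x).

Definition pou k x : R := remainder k x * eta k x.

Lemma remainderS m x : remainder m.+1 x = remainder m x - pou m x.
Proof. by rewrite /remainder big_ord_recr/= mulrBr mulr1. Qed.

Lemma sum_pou m x : \sum_(k < m) pou k x = 1 - remainder m x.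
Proof.
elim: m => [|m IH]; first by rewrite big_ord0 /remainder big_ord0 subrr.
by rewrite big_ord_recr/= IH remainderS; ring.
Qed.

Lemma smooth_pou k : smooth setT (pou k).
Proof.
have se j : smooth setT (eta j) by exact: smooth_cutoff.
have sN j : smooth setT (fun x => 1 - eta j x).
  have := smoothD openT (@smooth_cst _ _ setT 1) (smoothM openT (@smooth_cst _ _ setT (-1)) (se j)).
  by congr (smooth _ _); apply/funext => x /=; rewrite mulN1r.
apply: (smoothM openT _ (se k)); elim: k => [|k IH].
  have := @smooth_cst R n setT 1; congr (smooth _ _).
  by apply/funext => x; rewrite /remainder big_ord0.
have := smoothM openT IH (sN k); congr (smooth _ _).
by apply/funext => x; rewrite /remainder big_ord_recr.
Qed.

Lemma remainder_range m x : 0 <= remainder m x <= 1.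
Proof.
elim: m => [|m /andP[IH0 IH1]]; first by rewrite /remainder big_ord0 ler01 lexx.
have /andP[h1 h2] := cutoff_range (b m) x (s0 m); rewrite /remainder big_ord_recr/=.
have e0 : 0 <= 1 - eta m x by rewrite subr_ge0.
by rewrite mulr_ge0//= mulr_ile1// gerDl oppr_le0.
Qed.

Lemma pou_le1 k x : `|pou k x| <= 1.
Proof.
have /andP[r0 r1] := remainder_range k x.
have /andP[e0 e1] := cutoff_range (b k) x (s0 k).
by rewrite /pou (ger0_norm (mulr_ge0 r0 e0)) (mulr_ile1 r0 e0 r1 e1).
Qed.

Lemma pou_out k x : ~ core (b k) (s k) x -> pou k x = 0.
Proof. by move=> xk; rewrite /pou /eta cutoff_out ?mulr0. Qed.

Lemma remainder_inner k m x : inner (b k) (s k) x -> (k < m)%N -> remainder m x = 0.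
Proof.
move=> xk km; rewrite /remainder (bigD1 (Ordinal km))//=.
by rewrite /eta cutoff_inner// subrr mul0r.
Qed.

Lemma pou_late k j x : inner (b k) (s k) x -> (k < j)%N -> pou j x = 0.
Proof. by move=> xk kj; rewrite /pou (remainder_inner xk kj) mul0r. Qed.

Lemma sum_pou_inner k m x : inner (b k) (s k) x -> (k < m)%N ->
  \sum_(j < m) pou j x = 1.
Proof. by move=> xk km; rewrite sum_pou (remainder_inner xk km) subr0. Qed.

End partition_of_unity.

Section meyers_serrin.
Context {R : realType} {n : nat}.
Notation V := 'rV[R]_n.+1.
Notation mu := (@leb R n).
Context (O : set V) (c : nat -> V * R) (oO : open O) (cO : forall k, inside O (c k)).
Context (cov : forall x, O x -> exists k, inner (c k).1 (c k).2 x).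
Context (f : V -> R) (F : V -> 'cV[R]_n.+1) (lf : L1loc O f) (fF : is_weak_gradient O f F).
Context (t : nat -> R) (t0 : forall k, 0 < t k) (tk : forall k, t k < k.+1%:R^-1).

Let psi := pou c.
Let K k := core (c k).1 (c k).2.
Let spsi k : smooth setT (psi k) := smooth_pou cO k.
Let psi_out k x : ~ K k x -> psi k x = 0.
Proof. exact: pou_out. Qed.
Let cK k : compact (K k).
Proof. exact: compact_cube. Qed.
Let KO k : K k `<=` O.
Proof. exact: core_O (cO k). Qed.

Definition piece k x : R := psi k x * f x.
Definition gpiece k x : 'cV[R]_n.+1 :=
  \col_i (psi k x * F x i 0 + partial i (psi k) x * f x).
Definition mpiece k x : R := moll (t k) (piece k) x.
Definition mgpiece k x : 'cV[R]_n.+1 := mollv (t k) (gpiece k) x.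

Lemma piece_integrable k : mu.-integrable setT (EFin \o piece k).
Proof. exact: (support_integrable oO lf (spsi k) (@cK k) (@KO k) (@psi_out k)). Qed.

Lemma partial_psi_out k i x : ~ K k x -> partial i (psi k) x = 0.
Proof. exact: (partial_support i (compact_closed_row (@cK k)) (@psi_out k)). Qed.

Lemma gpiece_integrable k : vintegrable (gpiece k).
Proof.
move=> i; have lF := (fF i).1.
have h1 := support_integrable oO lF (spsi k) (@cK k) (@KO k) (@psi_out k).
have h2 := support_integrable oO lf (smooth_partial_smooth i (spsi k)) (@cK k) (@KO k)
  (@partial_psi_out k i).
have := integrableD measurableT h1 h2; congr (mu.-integrable _ _).
by apply/funext => x; rewrite /= mxE.
Qed.

Lemma smooth_mpiece k : smooth setT (mpiece k).
Proof. exact/smooth_moll/piece_integrable. Qed.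

Lemma partial_mpiece k i x : partial i (mpiece k) x = mgpiece k x i 0.
Proof.
have [lF wF] := fF i; rewrite mxE /mpiece.
rewrite (weak_partial_moll x oO (t0 k) lf lF wF (spsi k) (@cK k) (@KO k) (@psi_out k)).
by apply: eq_moll => y; rewrite mxE.
Qed.

Definition ball_at (x : V) (r : R) : set V := [set y | forall i, `|x 0 i - y 0 i| < r].

Lemma open_ball_at (x : V) (r : R) : open (ball_at x r).
Proof.
rewrite openE => y xy; apply/nbhs_coordP.
have [|d d0 hd] := @exists_min_ord R n.+1 (fun i => r - `|x 0 i - y 0 i|).
  by move=> i; rewrite subr_gt0; exact: xy.
exists d => // z yz i; have := hd i; have := yz i.
have := ler_distD (y 0 i) (x 0 i) (z 0 i); lra.
Qed.

Definition locally_finite x r m0 := 0 < r /\ forall y, ball_at x r y ->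
  [/\ O y, forall k, (m0 <= k)%N ->
        [/\ psi k y = 0, gpiece k y = 0, mpiece k y = 0 & mgpiece k y = 0] &
      forall m, (m0 <= m)%N -> \sum_(k < m) psi k y = 1].

(** Near x some cutoff equals 1, which kills all later [pou]. The mollified pieces look back by t k
    < 1/(k+1) only, so for large k they too vanish on the ball of half the radius. *)
Lemma pieces_locally_finite x : O x -> exists r m0, locally_finite x r m0.
Proof.
move=> Ox; have [k0 xk0] := cov Ox.
have /nbhs_coordP[e e0 xe] : nbhs x (inner (c k0).1 (c k0).2).
  by apply: open_nbhs_nbhs; split=> //; exact: open_inner.
have [m1 hm1] := exists_inv_lt (divr_gt0 e0 (ltr0n _ 2)).
have psi0 k y : (k0 < k)%N -> ball_at x e y -> psi k y = 0.
  by move=> kk xy; exact: (pou_late cO (xe _ xy)).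
have g0 k y : (k0 < k)%N -> ball_at x e y -> gpiece k y = 0.
  move=> kk xy; apply/matrixP => i j; rewrite !mxE psi0// mul0r add0r.
  have := eq_on_partials (g := cst 0) [:: i] (@open_ball_at x e) (fun z => psi0 k z kk) xy.
  by rewrite /partials /= => ->; rewrite /partial derive_cst mul0r.
exists (e / 2), (maxn k0.+1 m1); split; first by rewrite divr_gt0.
move=> y xy; have xye : ball_at x e y by move=> i; have := xy i; lra.
split.
- have yk := xe _ xye; apply: (@KO k0) => i; have /andP[h1 h2] := yk i.
  by rewrite addcE; have [s0 _] := cO k0; apply/andP; split; lra.
- move=> k; rewrite geq_max => /andP[kk0 km1].
  have tke : t k < e / 2 by apply: lt_trans (tk k) (hm1 k km1).
  have low z : lower_cube (t k) y z -> ball_at x e z.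
    move=> yz i; have := xy i; have /andP[h1 h2] := yz i.
    by rewrite !ltr_norml => /andP[h3 h4]; apply/andP; split; lra.
  split; [exact: psi0|exact: g0| |].
    apply: (moll_const (t0 k)) => z /low/(psi0 _ _ kk0) h.
    by rewrite /piece h mul0r.
  apply/matrixP => i j; rewrite !mxE; apply: (moll_const (t0 k)) => z /low/(g0 _ _ kk0) ->.
  by rewrite mxE.
move=> m; rewrite geq_max => /andP[kk0 _].
exact: (sum_pou_inner cO (xe _ xye) kk0).
Qed.

(** The number of terms [M x] has no regularity in x. Near a given point the length may be frozen at
    its value there, because further terms vanish; smoothness and derivatives are read off that
    finite sum. *)
Lemma approximation_exists : exists (g : V -> R) (M : V -> nat), [/\ smooth O g,
  forall x i, O x -> F x i 0 - partial i g x =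
    \sum_(k < M x) (gpiece k x i 0 - mgpiece k x i 0) &
  forall x, O x -> f x - g x = \sum_(k < M x) (piece k x - mpiece k x)].
Proof.
have /choice[M hM] : forall x, exists m0, O x -> exists r, locally_finite x r m0.
  move=> x; have [Ox|] := pselect (O x); last by exists 0%N.
  by have [r [m0 h]] := pieces_locally_finite Ox; exists m0 => _; exists r.
have center x r : 0 < r -> ball_at x r x by move=> r0 i; rewrite subrr normr0.
pose g x := \sum_(k < M x) mpiece k x.
have gE x m : O x -> (forall k, (m <= k)%N -> mpiece k x = 0) ->
    g x = \sum_(k < m) mpiece k x.
  move=> Ox hm; have [r [r0 hr]] := hM x Ox; have [_ h _] := hr x (center x r r0).
  have hM' k : (M x <= k)%N -> mpiece k x = 0 by move=> /h[].
  rewrite /g -(sum_stable hM' (leq_maxl (M x) m)).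
  by rewrite (sum_stable hm (leq_maxr (M x) m)).
have gloc x r : O x -> 0 < r -> locally_finite x r (M x) -> forall y, ball_at x r y ->
    g y = \sum_(k < M x) mpiece k y.
  move=> Ox r0 [_ hr] y /hr[Oy h _]; apply: gE => // k /h[]//.
exists g, M; split.
- apply: smooth_locally => x Ox; have [r lr] := hM x Ox; have [r0 _] := lr.
  exists (ball_at x r), (fun y => \sum_(k < M x) mpiece k y); split.
  + exact: open_ball_at.
  + exact: center.
  + apply: (@sub_smooth _ _ setT) => //.
    by apply: smooth_sum; [exact: openT|exact: smooth_mpiece].
  + by move=> y /(gloc _ _ Ox r0 lr).
- move=> x i Ox; have [r lr] := hM x Ox; have [r0 hr] := lr.
  have xx := center x r r0; have [_ _ one] := hr x xx.
  have := eq_on_partials [:: i] (@open_ball_at x r) (gloc _ _ Ox r0 lr) xx.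
  rewrite /partials /= => ->; rewrite (partial_sum _ _ smooth_mpiece I) sumrB.
  congr (_ - _); last by apply: eq_bigr => k _; rewrite partial_mpiece.
  under [RHS]eq_bigr do rewrite mxE; rewrite big_split/= -!mulr_suml one// mul1r.
  (* The partition sums to 1 on a whole ball, so the terms where the derivative falls on [psi k]
     cancel and only F is left. *)
  have d1 : \sum_(k < M x) partial i (psi k) x = 0.
    rewrite -(partial_sum _ _ spsi I).
    have E y : ball_at x r y -> \sum_(k < M x) psi k y = cst 1 y by move=> /hr[_ _ /(_ _ (leqnn _))].
    have := eq_on_partials [:: i] (@open_ball_at x r) E xx.
    by rewrite /partials /= => ->; rewrite /partial derive_cst.
  by rewrite d1 mul0r addr0.
move=> x Ox; have [r [r0 hr]] := hM x Ox; have [_ _ one] := hr x (center x r r0).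
by rewrite sumrB /piece -mulr_suml one// mul1r.
Qed.

End meyers_serrin.

Lemma sum_inv_pow2 (R : realFieldType) m : \sum_(k < m) ((2 : R) ^+ k.+1)^-1 <= 1.
Proof.
suff -> : \sum_(k < m) ((2 : R) ^+ k.+1)^-1 = 1 - (2 ^+ m)^-1 by rewrite gerDl oppr_le0 invr_ge0 exprn_ge0.
elim: m => [|m IH]; first by rewrite big_ord0 expr0 invr1 subrr.
rewrite big_ord_recr/= IH exprS; have : (2 : R) ^+ m != 0 by rewrite expf_neq0.
by move: (2 ^+ m) => z z0; field.
Qed.

(** * Modulars of countable sums *)

Section series.
Context {R : realType} {n : nat}.
Notation V := 'rV[R]_n.+1.
Notation mu := (@leb R n).
Context (O : set V) (p : V -> \bar R) (P : R).
Context (oO : open O) (mp : measurable_fun O p).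
Context (q1P : forall x, O x -> 1 <= fine (p x) <= P).

Let q x := fine (p x).
Let mO := measurable_open oO.
Notation rmod := (rmodular O p).
Let N : R := n.+1%:R.

Lemma int_sum m (g : nat -> V -> R) : (forall l, measurable_fun O (g l)) ->
  (forall l x, O x -> 0 <= g l x) ->
  (\int[mu]_(x in O) (\sum_(l < m) g l x)%:E = \sum_(l < m) \int[mu]_(x in O) (g l x)%:E)%E.
Proof.
move=> mg g0; elim: m => [|m IH].
  by rewrite big_ord0 -[RHS](integral0 mu O); apply: eq_integral => x _; rewrite big_ord0.
have ms : measurable_fun O (fun x => \sum_(l < m) g l x) by apply: measurable_sum => l; exact: mg.
rewrite big_ord_recr/= -IH -(int_add mO ms (mg m) _ (g0 m)).
  by apply: eq_integral => x _; rewrite big_ord_recr.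
by move=> x Ox; apply: sumr_ge0 => l _; exact: g0.
Qed.

Lemma rmodular_add_lty (g h : V -> R) : measurable_fun O g -> measurable_fun O h ->
  (rmod g < +oo)%E -> (rmod h < +oo)%E -> (rmod (fun x => (`|g x| + `|h x|)%R) < +oo)%E.
Proof.
move=> mg mh goo hoo.
have mg' := measurable_rmodular oO mp mg; have mh' := measurable_rmodular oO mp mh.
have mab (u : V -> R) : measurable_fun O u -> measurable_fun O (fun x => `|u x|).
  by move=> mu_u; exact: (measurableT_comp (@normr_measurable R setT) mu_u).
have ms := measurable_rmodular oO mp (measurable_funD (mab _ mg) (mab _ mh)).
have p0 (u : V -> R) x : O x -> 0 <= `|u x| `^ q x by move=> _; exact: powR_ge0.
apply: (@le_lt_trans _ _ (\int[mu]_(x in O) (2 `^ P * (`|g x| `^ q x + `|h x| `^ q x))%:E)%E).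
  apply: (le_int mO ms (measurable_funM (measurable_cst _) (measurable_funD mg' mh'))).
  move=> x Ox; split; first exact: powR_ge0.
  rewrite /= ger0_norm ?addr_ge0//; apply: powR_add_le => //.
  by have /andP[h1 h2] := q1P Ox; apply/andP; split; [exact: le_trans ler01 h1|exact: h2].
rewrite (int_scale mO (measurable_funD mg' mh') _ (powR_ge0 _ _)); last first.
  by move=> x Ox /=; rewrite addr_ge0// powR_ge0.
rewrite (int_add mO mg' mh' (p0 g) (p0 h)).
apply: (lte_mul_pinfty _ _ (lte_add_pinfty goo hoo)); last by [].
by rewrite lee_fin powR_ge0.
Qed.

(** The share delta / 2^(k+1) of the k-th piece, divided by the constant lost in [rmodular_series]:
    the weights 2^(k+1) and N, the factor N in the hypothesis, and N components. *)
Definition budget (delta : R) k : R :=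
  delta / (2 ^ k.+1)%:R / ((2 ^+ k.+1 * (N * N)) `^ P * N).

Lemma budget_gt0 delta k : 0 < delta -> 0 < budget delta k.
Proof.
move=> d0; rewrite /budget !divr_gt0 ?ltr0n ?expn_gt0// mulr_gt0// ?ltr0n//.
by apply: powR_gt0; rewrite !mulr_gt0 ?exprn_gt0 ?ltr0n.
Qed.

(** Countable subadditivity at the level of modulars. The pointwise sums are finite but of varying
    length, so each is bounded by one infinite series of nonnegative functions, which is then
    integrated termwise. *)
Lemma rmodular_series (h : V -> R) (e : nat -> nat -> V -> R) delta : 0 < delta ->
  measurable_fun O h -> (forall k l, measurable_fun O (e k l)) ->
  (forall k l x, 0 <= e k l x) ->
  (forall k l, (rmod (e k l) <= (budget delta k)%:E)%E) ->
  (forall x, O x -> exists m, `|h x| <= \sum_(k < m) N * \sum_(l < n.+1) e k l x) ->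
  (rmod h <= delta%:E)%E.
Proof.
move=> d0 mh me e0 eb hs.
have N1 : 1 <= N by rewrite ler1n.
have N0 : 0 < N by rewrite ltr0n.
have t0 k : 0 < (2 : R) ^+ k.+1 by rewrite exprn_gt0.
pose K k : R := (2 ^+ k.+1 * (N * N)) `^ P.
pose B k x := K k * \sum_(l < n.+1) `|e k l x| `^ q x.
have mel k l := measurable_rmodular oO mp (me k l).
have K0 k : 0 <= K k by exact: powR_ge0.
have ms k : measurable_fun O (fun x => \sum_(l < n.+1) `|e k l x| `^ q x).
  by apply: measurable_sum => l; exact: mel.
have s0 k x : O x -> 0 <= \sum_(l < n.+1) `|e k l x| `^ q x.
  by move=> _; apply: sumr_ge0 => l _; exact: powR_ge0.
have mB k : measurable_fun O (B k) by exact: (measurable_funM (measurable_cst _) (ms k)).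
have B0 k x : O x -> 0 <= B k x by move=> Ox; rewrite mulr_ge0// s0.
have intB k : (\int[mu]_(x in O) (B k x)%:E <= (delta / (2 ^ k.+1)%:R)%:E)%E.
  rewrite (int_scale mO (ms k) (s0 k) (K0 k)).
  rewrite (int_sum n.+1 (mel k) (fun l x _ => powR_ge0 _ _)).
  apply: (@le_trans _ _ ((K k)%:E * \sum_(l < n.+1) (budget delta k)%:E)%E).
    by apply: lee_wpmul2l; [rewrite lee_fin|apply: lee_sum => l _; exact: eb].
  rewrite sumEFin -EFinM lee_fin sumr_const card_ord -[X in _ * X]mulr_natl -/N /budget -/(K k).
  have Kn : K k != 0 by rewrite gt_eqF// powR_gt0// !mulr_gt0.
  have KN : K k * N != 0 by rewrite mulf_neq0// gt_eqF.
  by rewrite mulrA [X in X <= _]mulrC divfK.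
have pw x : O x -> exists m, `|h x| `^ q x <= \sum_(k < m) B k x.
  move=> Ox; have [m hm] := hs x Ox; exists m.
  have /andP[q1 qP] : 1 <= q x <= P := q1P Ox.
  have q0 : 0 <= q x by lra.
  apply: le_trans (le_powR_l q0 (normr_ge0 _) hm) _.
  pose a k := N * \sum_(l < n.+1) e k l x.
  have a0 k : 0 <= a k by rewrite mulr_ge0 ?(ltW N0)// sumr_ge0.
  (* The q-th power passes inside the sum over pieces with weights 2^(k+1), then inside the sum over
     components with weights N; in both cases the inverses sum to at most 1. *)
  apply: le_trans (powR_weighted_sum (m := m) (a := a) (c := fun k => 2 ^+ k.+1) q1 a0 t0 (sum_inv_pow2 _ m)) _.
  apply: ler_sum => k _; rewrite /a /B.
  pose a' l := 2 ^+ k.+1 * (N * e k l x).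
  have -> : 2 ^+ k.+1 * (N * \sum_(l < n.+1) e k l x) = \sum_(l < n.+1) a' l.
    by rewrite !mulr_sumr.
  have a0' l : 0 <= a' l by rewrite !mulr_ge0 ?(ltW N0)// ltW.
  have cN : \sum_(l < n.+1) N^-1 <= 1.
    by rewrite sumr_const card_ord -[N^-1 *+ _]mulr_natl mulfV// gt_eqF.
  apply: le_trans (powR_weighted_sum (m := n.+1) (a := a') (c := fun=> N) q1 a0' (fun=> N0) cN) _.
  rewrite mulr_sumr; apply: ler_sum => l _.
  have -> : N * a' l = (2 ^+ k.+1 * (N * N)) * `|e k l x|.
    by rewrite /a' ger0_norm//; ring.
  apply: powR_const_le => //.
  by rewrite mulr_ege1 ?mulr_ege1// exprn_ege1// ler1n.
have mBE k : measurable_fun O (fun x => (B k x)%:E) by apply/measurable_EFinP; exact: mB.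
have BE0 k x : O x -> (0 <= (B k x)%:E)%E by move=> Ox; rewrite lee_fin; exact: B0.
pose SB x := (\sum_(0 <= k <oo) (B k x)%:E)%E.
have mSB : measurable_fun O SB.
  exact: (@ge0_emeasurable_sum _ _ _ O (fun k x => (B k x)%:E) xpredT
    (fun k x Ox _ => BE0 k x Ox) (fun k _ => mBE k)).
apply: (@le_trans _ _ (\int[mu]_(x in O) SB x)%E).
  have /measurable_EFinP mh' := measurable_rmodular oO mp mh.
  apply: (@ge0_le_integral _ _ _ mu O mO _ SB _ mh' mSB).
    by move=> x _; rewrite lee_fin powR_ge0.
  move=> x Ox; have [m hm] := pw x Ox.
  apply: (@le_trans _ _ (\sum_(0 <= k < m) (B k x)%:E)%E).
    by rewrite sumEFin lee_fin big_mkord.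
  by apply: nneseries_lim_ge => k _ _; exact: BE0.
rewrite (integral_nneseries mu mO mBE BE0).
apply: le_trans (epsilon_trick0 xpredT (ltW d0)).
apply: lee_nneseries => k _; last exact: intB.
by move=> _; apply: integral_ge0 => x Ox; rewrite lee_fin; exact: B0.
Qed.

End series.

(** * Choice of the scales and the smooth approximation *)

Section approximation.
Context {R : realType} {n : nat}.
Notation V := 'rV[R]_n.+1.
Notation mu := (@leb R n).
Context (O : set V) (p : V -> \bar R) (W : V -> 'M[R]_n.+1) (A P L d0 : R).
Context (mp : measurable_fun O p) (pfin : forall x, O x -> p x \is a fin_num).
Context (S : weight_setting O (fun x => fine (p x)) W A P L d0).
Context (mv : measurable_fun O (fun x => opnorm (W x))).

Let q x := fine (p x).
Let v x := opnorm (W x).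
Let N : R := n.+1%:R.
Let oO := ws_open S.
Let mO := measurable_open oO.
Let mW := ws_measurable_weight S.
Let q1P : forall x, O x -> 1 <= fine (p x) <= P := ws_exponent S.
Notation rmod := (rmodular O p).

Lemma pmodE (G : V -> 'cV[R]_n.+1) : pmod O q W G = rmod (fun x => enorm (W x *m G x)).
Proof. by apply: eq_integral => x _; rewrite ger0_norm ?enorm_ge0. Qed.

Lemma good_dominated c (G : V -> 'cV[R]_n.+1) (H : V -> R) (C : R) : inside O c ->
  vintegrable G -> supported c.1 c.2 G -> measurable_fun O H -> (rmod H < +oo)%E -> 1 <= C ->
  (forall x, O x -> enorm (W x *m G x) <= C * `|H x|) -> good O q W c.1 c.2 G.
Proof.
move=> [s0 bO] Gi sG mH Hoo C1 GH.
have mG := sub_vmeasurable (D := O) (vintegrable_vmeasurable Gi).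
apply: (moll_converges S s0 bO Gi sG); rewrite pmodE.
apply: le_lt_trans (rmodular_le oO mp q1P (measurable_mulmx mW mG) mH C1 _) _.
  by move=> x Ox; rewrite ger0_norm ?enorm_ge0//; exact: GH.
by apply: (lte_mul_pinfty _ _ Hoo) => //; rewrite lee_fin powR_ge0.
Qed.

Context (f : V -> R) (F : V -> 'cV[R]_n.+1) (lf : L1loc O f) (fF : is_weak_gradient O f F).
Context (foo : (rmod (fun x => (f x * v x)%R) < +oo)%E).
Context (Foo : (rmod (fun x => enorm (W x *m F x)) < +oo)%E).

Let H x := `|f x * v x| + `|enorm (W x *m F x)|.
Let mfv : measurable_fun O (fun x => f x * v x) := measurable_funM lf.1 mv.
Let mWF : measurable_fun O (fun x => enorm (W x *m F x)) :=
  measurable_mulmx mW (fun i => (fF i).1.1).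

Let mH : measurable_fun O H.
Proof.
by apply: measurable_funD; apply: (measurableT_comp (@normr_measurable R setT)).
Qed.

Let Hoo : (rmod H < +oo)%E := rmodular_add_lty oO mp q1P mfv mWF foo Foo.

Let v0 x : 0 <= v x. Proof. exact: opnorm_ge0. Qed.

Let fvH x : `|f x| * v x <= `|H x|.
Proof.
apply: le_trans (ler_norm _); rewrite /H normrM (ger0_norm (v0 x)) lerDl.
exact: normr_ge0.
Qed.

Let WFH x : enorm (W x *m F x) <= `|H x|.
Proof.
apply: le_trans (ler_norm _); apply: le_trans (ler_norm _) _.
by rewrite /H lerDr normr_ge0.
Qed.

Context (c : nat -> V * R) (cO : forall k, inside O (c k)).

Let out k x : ~ Bx (c k).1 (c k).2 x -> ~ core (c k).1 (c k).2 x.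
Proof. by move=> xB /(core_Bx (cO k).1). Qed.

Lemma good_piece k j : good O q W (c k).1 (c k).2 (fun x => piece c f k x *: ecol j).
Proof.
have pi := piece_integrable oO cO lf k.
apply: (good_dominated (cO k) (H := H) (C := 1) _ _ mH Hoo (lexx 1)).
- move=> i; rewrite (_ : (fun x => _) = (fun x => (ecol j : 'cV[R]_n.+1) i 0 * piece c f k x)).
    exact: (integrable_scale _ measurableT pi).
  by apply/funext => x; rewrite mxE mulrC.
- by move=> x /out xk; rewrite /piece (pou_out cO xk) mul0r scale0r.
move=> x Ox; rewrite mul1r -scalemxAr enormZ /piece normrM; apply: le_trans (fvH x).
apply: ler_pM; [exact: mulr_ge0|exact: enorm_ge0| |exact: enorm_col_opnorm].
by rewrite ler_piMl// (pou_le1 cO).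
Qed.

(** The term f grad psi_k satisfies |W f grad psi_k| <= |f| v |grad psi_k|, and grad psi_k is
    bounded, being continuous with compact support. Both terms are thus controlled by H = |f v| + |W
    F|, of finite modular. *)
Lemma good_gpiece k : good O q W (c k).1 (c k).2 (gpiece c f F k).
Proof.
have N1 : 1 <= N by rewrite ler1n.
have N0 : 0 <= N by exact: le_trans N1.
have /choice[C hC] (i : 'I_n.+1) : exists C : R, 0 <= C /\ forall x, `|partial i (pou c k) x| <= C.
  have sd := smooth_partial_smooth i (smooth_pou cO k).
  have [C C0 h] := compact_support_bounded (@compact_cube _ _ _ _)
    (fun x => smooth_continuous sd I) (@partial_psi_out _ _ _ _ cO k i).
  by exists C.
pose C0 := \sum_i C i; have C00 : 0 <= C0 by apply: sumr_ge0 => i _; case: (hC i).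
have CC i : C i <= C0.
  by rewrite /C0 (bigD1 i)//= lerDl sumr_ge0// => j _; case: (hC j).
have c1 : 1 <= N * (1 + N * C0) by rewrite mulr_ege1// lerDl mulr_ge0.
apply: (good_dominated (cO k) (H := H) (gpiece_integrable oO cO lf fF k) _ mH Hoo c1).
  move=> x /out xk; apply/matrixP => i j; rewrite !mxE.
  by rewrite (pou_out cO xk) (partial_psi_out cO i xk) !mul0r addr0.
move=> x Ox; pose u : 'cV[R]_n.+1 := \col_i partial i (pou c k) x.
have uC : enorm u <= N * C0.
  apply: enorm_le_const => i; rewrite mxE; apply: le_trans (CC i).
  by have [_ ] := hC i.
have -> : gpiece c f F k x = pou c k x *: F x + f x *: u.
  by apply/matrixP => i j; rewrite (ord1 j) !mxE [f x * _]mulrC.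
have := enorm_sum_le [:: W x *m (pou c k x *: F x); W x *m (f x *: u)] id.
rewrite !big_cons !big_nil !addr0 mulmxDr => /le_trans; apply; rewrite -/N -mulrA.
apply: ler_wpM2l => //; rewrite mulrDl mul1r; apply: lerD.
  rewrite -scalemxAr enormZ; apply: le_trans (WFH x).
  by rewrite ler_piMl ?enorm_ge0// (pou_le1 cO).
rewrite -scalemxAr enormZ.
apply: (@le_trans _ _ (`|f x| * (v x * (N * C0)))).
  apply: ler_wpM2l => //; apply: le_trans (enorm_mulmx_opnorm _ _) _.
  exact: (ler_wpM2l (v0 x) uC).
have -> : `|f x| * (v x * (N * C0)) = N * C0 * (`|f x| * v x) by ring.
by apply: ler_wpM2l; [exact: mulr_ge0|exact: fvH].
Qed.

Lemma mollification_scale delta : 0 < delta -> exists t : nat -> R, forall k,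
  [/\ 0 < t k, t k < k.+1%:R^-1,
    (pmod O q W (fun x => (gpiece c f F k x - mgpiece c f F t k x)%R) <=
      (@budget R n P delta k)%:E)%E &
    forall j, (pmod O q W (fun x => (piece c f k x *: ecol j -
      mollv (t k) (fun y => piece c f k y *: ecol j) x)%R) <= (@budget R n P delta k)%:E)%E].
Proof.
move=> dgt.
have /choice[m hm] k : exists m, let t := mesh (c k).2 m in
  [/\ 0 < t, t < k.+1%:R^-1,
    (pmod O q W (fun x => (gpiece c f F k x - mollv t (gpiece c f F k) x)%R) <=
      (@budget R n P delta k)%:E)%E &
    forall j, (pmod O q W (fun x => (piece c f k x *: ecol j -
      mollv t (fun y => piece c f k y *: ecol j) x)%R) <= (@budget R n P delta k)%:E)%E].
  have s0 := (cO k).1; have b0 := @budget_gt0 R n P delta k dgt.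
  have [m1 h1] := mesh_small s0 (divr_gt0 ltr01 (ltr0Sn R k)).
  have [m2 h2] := good_cvg (good_gpiece k) b0.
  have /choice[m3 h3] j := good_cvg (good_piece k j) b0.
  exists (maxn m1 (maxn m2 (\max_j m3 j))); split.
  - exact: mesh_gt0.
  - by rewrite -[X in _ < X]mul1r; apply: h1; exact: leq_maxl.
  - by apply: h2; rewrite (leq_trans _ (leq_maxr _ _))// leq_maxl.
  move=> j; apply: h3; apply: leq_trans (leq_bigmax j) _.
  by rewrite (leq_trans _ (leq_maxr _ _))// leq_maxr.
by exists (fun k => mesh (c k).2 (m k)) => k; exact: hm k.
Qed.

Context (cov : forall x, O x -> exists k, inner (c k).1 (c k).2 x).

(** One sequence of scales serves both estimates. The scalar one is obtained from the fields (piece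
    - mollified piece) e_l, since v is at most N times the sum of the |W e_l|. *)
Lemma smooth_approximation delta : 0 < delta -> exists g : V -> R,
  [/\ smooth O g, (rmod (fun x => ((f x - g x) * v x)%R) <= delta%:E)%E &
    (rmod (fun x => enorm (W x *m (F x - \col_i partial i g x))) <= delta%:E)%E].
Proof.
move=> dgt; have [t ht] := mollification_scale dgt.
have t0 k : 0 < t k by case: (ht k).
have tk k : t k < k.+1%:R^-1 by case: (ht k).
have [g [M [sg dg fg]]] := approximation_exists oO cO cov lf fF t0 tk.
exists g; split; first exact: sg.
- have lg : L1loc O g by apply: (continuous_L1loc oO) => x Ox; exact: (smooth_continuous sg).
  have mfg : measurable_fun O (fun x => (f x - g x) * v x).
    exact: (measurable_funM (measurable_funB lf.1 lg.1) mv).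
  pose D k l x : 'cV[R]_n.+1 := piece c f k x *: ecol (inord l) -
    mollv (t k) (fun y => piece c f k y *: ecol (inord l)) x.
  have mD k l : vmeasurable O (D k l).
    have vi := good_integrable (good_piece k (inord l)).
    apply: vmeasurableB; last exact: (@vmeasurable_mollv _ _ O (t k) _ vi).
    exact: (sub_vmeasurable (vintegrable_vmeasurable vi)).
  apply: (@rmodular_series _ _ O p P oO mp q1P _ (fun k l x => enorm (W x *m D k l x)) _ dgt mfg).
  + by move=> k l; exact: (measurable_mulmx mW (mD k l)).
  + by move=> k l x; exact: enorm_ge0.
  + move=> k l; rewrite -(pmodE (D k l)); have [_ _ _ h] := ht k; exact: (h (inord l)).
  move=> x Ox; exists (M x); rewrite fg// normrM (ger0_norm (v0 x)).
  apply: (@le_trans _ _ (\sum_(k < M x) `|piece c f k x - mpiece c f t k x| * v x)).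
    by rewrite -mulr_suml; apply: ler_wpM2r => //; exact: ler_norm_sum.
  apply: ler_sum => k _.
  have DE (l : 'I_n.+1) : D k l x = (piece c f k x - mpiece c f t k x) *: ecol l.
    by rewrite /D inord_val mollv_ecol ?scalerBl//; exact: (piece_integrable oO cO lf).
  rewrite (eq_bigr (fun l => `|piece c f k x - mpiece c f t k x| * enorm (W x *m ecol l))); last first.
    by move=> l _; rewrite DE -scalemxAr enormZ.
  rewrite -mulr_sumr mulrCA; apply: ler_wpM2l => //; exact: opnorm_le_cols.
pose D k x : 'cV[R]_n.+1 := gpiece c f F k x - mgpiece c f F t k x.
have mD k : vmeasurable O (D k).
  have vi := good_integrable (good_gpiece k).
  apply: vmeasurableB; last exact: (@vmeasurable_mollv _ _ O (t k) _ vi).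
  exact: (sub_vmeasurable (vintegrable_vmeasurable vi)).
have mg i : measurable_fun O (partial i g).
  have lg : L1loc O (partial i g).
    by apply: (continuous_L1loc oO) => x Ox; case: (sg [:: i] x Ox).
  exact: lg.1.
have mFg : vmeasurable O (fun x => F x - \col_i partial i g x).
  apply: vmeasurableB => i; first exact: (fF i).1.1.
  by rewrite (_ : (fun x => _) = partial i g)//; apply/funext => x; rewrite mxE.
apply: (@rmodular_series _ _ O p P oO mp q1P _ (fun k l x => enorm (W x *m D k x)) _ dgt).
- exact: (measurable_mulmx mW mFg).
- by move=> k l; exact: (measurable_mulmx mW (mD k)).
- by move=> k l x; exact: enorm_ge0.
- move=> k l; rewrite -(pmodE (D k)); have [_ _ h _] := ht k; exact: h.
move=> x Ox; exists (M x); rewrite (ger0_norm (enorm_ge0 _)).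
have -> : F x - \col_i partial i g x = \sum_(k < M x) D k x.
  apply/matrixP => i j; rewrite (ord1 j) summxE !mxE dg//.
  by apply: eq_bigr => k _; rewrite !mxE.
rewrite mulmx_sumr; apply: le_trans (enorm_sum_le _ _) _.
rewrite mulr_sumr; apply: ler_sum => k _; apply: ler_wpM2l => //.
(* For gradients the error does not depend on [l]; a single term of the sum over components
   suffices. *)
by rewrite big_ord_recl/= lerDl sumr_ge0// => l _; exact: enorm_ge0.
Qed.

End approximation.

Lemma vnorm_ge0 (R : realType) (n : nat) (O : set 'rV[R]_n.+1) p f : (0 <= vnorm O p f)%E.
Proof. by apply: le_ereal_inf_tmp => _ [l [l0 _] <-]; rewrite lee_fin ltW. Qed.

Lemma L1locB (R : realType) (n : nat) (O : set 'rV[R]_n.+1) f g : open O ->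
  L1loc O f -> L1loc O g -> L1loc O (fun x => f x - g x).
Proof.
move=> oO lf lg; split; first exact: (measurable_funB lf.1 lg.1).
move=> K KO cK; have mK := measurable_compact cK.
have int h : L1loc O h -> leb.-integrable K (EFin \o h).
  move=> [mh hK]; apply/integrableP; split; last exact: (hK K KO cK).
  by apply/measurable_EFinP; exact: (measurable_funS (measurable_open oO) KO mh).
by have /integrableP[] := integrable_sub mK (int _ lf) (int _ lg).
Qed.

Lemma is_weak_gradientB (R : realType) (n : nat) (O : set 'rV[R]_n.+1) f g F G : open O ->
  L1loc O f -> L1loc O g -> is_weak_gradient O f F -> is_weak_gradient O g G ->
  is_weak_gradient O (fun x => f x - g x) (fun x => F x - G x).
Proof.
move=> oO lf lg fF gG i; have mO := measurable_open oO.
have [lF wF] := fF i; have [lG wG] := gG i.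
have FGE : (fun x => (F x - G x) i 0) = (fun x => F x i 0 - G x i 0).
  by apply/funext => x; rewrite !mxE.
rewrite FGE; split; first exact: L1locB.
move=> phi tphi; have [sphi [K [cK KO phi0]]] := tphi.
have dphi0 := partial_support i (compact_closed_row cK) phi0.
have sdphi := smooth_partial_smooth i sphi.
have int h w : L1loc O h -> smooth setT w -> (forall x, ~ K x -> w x = 0) ->
    leb.-integrable O (EFin \o (fun x => h x * w x)).
  move=> lh sw w0; apply: (integrableS measurableT mO (@subsetT _ O)).
  have := support_integrable oO lh sw cK KO w0.
  by congr (leb.-integrable _ _); apply/funext => x; rewrite /= mulrC.
have split_int h h' w : L1loc O h -> L1loc O h' -> smooth setT w ->
    (forall x, ~ K x -> w x = 0) ->
    (\int[leb]_(x in O) ((h x - h' x) * w x)%:E =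
     \int[leb]_(x in O) (h x * w x)%:E - \int[leb]_(x in O) (h' x * w x)%:E)%E.
  move=> lh lh' sw w0; rewrite -(integralB mO (int h w lh sw w0) (int h' w lh' sw w0)).
  by apply: eq_integral => x _; rewrite mulrBl EFinB.
have fin := integrable_fin_num mO (int _ _ lG sphi phi0).
rewrite (split_int _ _ _ lf lg sdphi dphi0) (split_int _ _ _ lF lG sphi phi0).
rewrite (wF _ tphi) (wG _ tphi) oppeK fin_num_oppeB//; exact: fin.
Qed.

Lemma smooth_is_weak_gradient (R : realType) (n : nat) (O : set 'rV[R]_n.+1) g : open O ->
  smooth O g -> L1loc O g /\ is_weak_gradient O g (fun x => \col_i partial i g x).
Proof.
move=> oO sg; split.
  by apply: (continuous_L1loc oO) => x Ox; exact: (smooth_continuous sg).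
move=> i; rewrite (_ : (fun x => _) = partial i g); last by apply/funext => x; rewrite mxE.
split; last exact: smooth_weak_partial.
by apply: (continuous_L1loc oO) => x Ox; case: (sg [:: i] x Ox).
Qed.

Section density.
Context {R : realType} {n : nat}.
Notation V := 'rV[R]_n.+1.
Context (O : set V) (p : V -> \bar R) (W : V -> 'M[R]_n.+1) (A P L d0 : R).
Context (mp : measurable_fun O p) (pfin : forall x, O x -> p x \is a fin_num).
Context (S : weight_setting O (fun x => fine (p x)) W A P L d0).
Context (mv : measurable_fun O (fun x => opnorm (W x))).

Let v x := opnorm (W x).

Lemma sobolevW_density f (e : R) : O !=set0 -> sobolevW O p v W f -> 0 < e ->
  exists g, [/\ smooth O g, sobolevW O p v W g &
    (sobolev_norm O p v W (fun x => (f x - g x)%R) < e%:E)%E].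
Proof.
move=> neO [[lf [F fF]] foo] e0.
have oO := ws_open S; have mW := ws_measurable_weight S.
have q1P : forall x, O x -> 1 <= fine (p x) <= P := ws_exponent S.
have normE h H : is_weak_gradient O h H -> sobolev_norm O p v W h = _ :=
  sobolev_normE oO mp pfin mW v (f := h) (F := H).
have mfv h : L1loc O h -> measurable_fun O (fun x => h x * v x).
  by move=> lh; exact: (measurable_funM lh.1 mv).
have mWF h H : is_weak_gradient O h H -> measurable_fun O (fun x => enorm (W x *m H x)).
  by move=> hH; exact: (measurable_mulmx mW (fun i => (hH i).1.1)).
move: foo; rewrite (normE _ _ fF) => foo.
have f1 : (rmodular O p (fun x => (f x * v x)%R) < +oo)%E.
  apply: (rmodular_lty oO mp pfin q1P (mfv _ lf)).
  by apply: le_lt_trans foo; rewrite leeDl// vnorm_ge0.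
have f2 : (rmodular O p (fun x => enorm (W x *m F x)) < +oo)%E.
  apply: (rmodular_lty oO mp pfin q1P (mWF _ _ fF)).
  by apply: le_lt_trans foo; rewrite leeDr// vnorm_ge0.
have [c [cO cov]] := inner_cover oO neO.
(* Each of the two norms will be at most l, so their sum is at most e / 2; [vnorm_le_rmodular]
   requires l <= 1 and modulars at most l^P. *)
pose l := Num.min 1 (e / 4).
have l0 : 0 < l by rewrite lt_min ltr01 divr_gt0.
have l1 : 0 < l <= 1 by rewrite l0 ge_min lexx.
have le4 : l <= e / 4 by rewrite ge_min lexx orbT.
have [g [sg g1 g2]] := smooth_approximation mp S mv lf fF f1 f2 cO cov (powR_gt0 P l0).
have [lg gG] := smooth_is_weak_gradient oO sg.
have fgG := is_weak_gradientB oO lf lg fF gG.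
have lfg : L1loc O (fun x => f x - g x) := L1locB oO lf lg.
exists g; split; first exact: sg.
- split; first by split; [exact: lg|exists (fun x => \col_i partial i g x)].
  (* Finiteness for g follows from g = f - (f - g), both terms having finite modular. *)
  rewrite (normE _ _ gG); apply: lte_add_pinfty.
    apply: (vnorm_lty oO mp pfin q1P (mfv _ lg)).
    have h := rmodular_add_lty oO mp q1P (mfv _ lf) (mfv _ lfg) f1 (le_lt_trans g1 (ltry _)).
    have mh : measurable_fun O (fun x => `|f x * v x| + `|(f x - g x) * v x|).
      by apply: measurable_funD; apply: (measurableT_comp (@normr_measurable R setT)); exact: mfv.
    apply: le_lt_trans (rmodular_le oO mp q1P (mfv _ lg) mh (lexx 1) _) _.
      move=> x _; rewrite mul1r [leRHS]ger0_norm ?addr_ge0//.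
      have -> : g x * v x = f x * v x - (f x - g x) * v x by ring.
      exact: ler_normB.
    by rewrite powR1 mul1e.
  apply: (vnorm_lty oO mp pfin q1P (mWF _ _ gG)).
  have h := rmodular_add_lty oO mp q1P (mWF _ _ fF) (mWF _ _ fgG) f2 (le_lt_trans g2 (ltry _)).
  have mh : measurable_fun O (fun x => `|enorm (W x *m F x)| +
      `|enorm (W x *m (F x - \col_i partial i g x))|).
    apply: measurable_funD; apply: (measurableT_comp (@normr_measurable R setT)).
      exact: (mWF _ _ fF).
    exact: (mWF _ _ fgG).
  have N1 : 1 <= n.+1%:R :> R by rewrite ler1n.
  apply: le_lt_trans (rmodular_le oO mp q1P (mWF _ _ gG) mh N1 _) _.
    move=> x _; rewrite (ger0_norm (enorm_ge0 _)) [X in _ <= _ * X]ger0_norm ?addr_ge0//.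
    rewrite !(ger0_norm (enorm_ge0 _)); set G := \col_i _.
    have := enorm_sum_le [:: W x *m F x; - (W x *m (F x - G))] id.
    rewrite !big_cons !big_nil !addr0 enormN.
    by rewrite -mulmxN -mulmxDr opprB addrC subrK.
  by apply: (lte_mul_pinfty _ _ h) => //; rewrite lee_fin powR_ge0.
rewrite (normE _ _ fgG).
apply: (@le_lt_trans _ _ (l%:E + l%:E)%E); last by rewrite -EFinD lte_fin; lra.
apply: leeD.
  exact: (vnorm_le_rmodular oO mp pfin q1P (mfv _ lfg) l1 g1).
exact: (vnorm_le_rmodular oO mp pfin q1P (mWF _ _ fgG) l1 g2).
Qed.

End density.

Theorem theorem1p6 (R : realType) (n : nat) (Omega : set 'rV[R]_n.+1)
    (p : 'rV[R]_n.+1 -> \bar R) (W : 'rV[R]_n.+1 -> 'M[R]_n.+1) :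
  open Omega ->
  exponent Omega p ->
  (1 <= exponent_inf Omega p)%E ->
  (exponent_inf Omega p <= exponent_sup Omega p)%E ->
  (exponent_sup Omega p < +oo)%E ->
  log_holder Omega p ->
  matrix_weight Omega W ->
  matrix_Ap_larger Omega p W ->
  let v := fun x => opnorm (W x) in
  sobolevW Omega p v W = sobolevH Omega p v W.
Proof.
move=> oO [mp p1] _ _ _ LH hW hAp v; apply/seteqP; split=> [f Wf|f []//].
split; first exact: Wf.
have [A [P [L [d0 S]]]] := weight_setting_of_Ap oO (conj mp p1) LH hW hAp.
have pfin := log_holder_fin_num p1 LH.
have mv : measurable_fun Omega (fun x => opnorm (W x)) by have [_ _ []] := hW.
(* The enumeration of cubes needs a point of [Omega]. On the empty set every modular is 0 and f
   itself is smooth vacuously; each norm is at most e / 4 because any positive number is admissible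
   in the infimum. *)
move=> e e0; have [ne|/set0P/negP/negPn/eqP O0] := pselect (Omega !=set0).
  exact: (sobolevW_density mp pfin S mv ne Wf e0).
have vnorm0 h : (vnorm Omega p h < (e / 2)%:E)%E.
  have e4 : 0 < e / 4 by rewrite divr_gt0.
  apply: (@le_lt_trans _ _ (e / 4)%:E); last by rewrite lte_fin; lra.
  apply: ereal_inf_lbound; exists (e / 4) => //; split=> //.
  rewrite /modular /infinite_part O0 set0D integral_set0 add0e.
  rewrite (_ : (_ \_ _) = cst 0%E) ?ess_sup_cst ?leb_setT_gt0//.
  by apply/funext => x; rewrite patchE memNset// => -[].
exists f; split; [by rewrite O0|exact: Wf|].
have -> : e%:E = ((e / 2)%:E + (e / 2)%:E)%E by rewrite -EFinD; congr EFin; lra.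
exact: lteD (vnorm0 _) (vnorm0 _).
Qed.
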